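(* Let $\kappa(t)=2/(4-3\cos^2t)^{3/2}$ be the curvature of the plane ellipse $\mathbf c(t)=(2\cos t,\sin t,0)$, so that $$\dot\kappa(t)=\frac{-18\cos t\,\sin t}{(4-3\cos^2t)^{5/2}}.$$ Consider the three-parameter family of canal surfaces $S_{\varepsilon,\rho,\mu}$ around the $2\pi$-periodic curve $$\mathbf c_\varepsilon(t)=(2\cos t,\ \sin t,\ \varepsilon\,\dot\kappa(t)),$$ with radial function $$r(t,\mu)=\rho+\mu\,\dot\kappa(t).$$ There are two smooth curves $\varepsilon=\varepsilon_1(\mu)=-\mu+O_1(\mu^2)$ and $\varepsilon=\varepsilon_2(\mu)=\mu+O_2(\mu^2)$ such that, for any $\rho,\mu$ small and positive (with $r(t,\mu)>0$ for all $t$), the canal surface $S_{\varepsilon,\rho,\mu}$ has two hyperbolic principal cycles for $\varepsilon\in\,]\varepsilon_1(\mu),\varepsilon_2(\mu)[$, and has one double principal cycle along the curves $\varepsilon=\varepsilon_1(\mu)$ and $\varepsilon=\varepsilon_2(\mu)$.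
   Context: Canal surfaces. Let $\mathbf c$ be a smooth closed bi-regular curve in $\mathbb R^3$ (curvature everywhere positive) with arc length $s$, total length $L$, Frenet frame $\{\mathbf t,\mathbf n,\mathbf b\}$, curvature $\kappa$ and torsion $\tau$ (with $\mathbf t'=\kappa\mathbf n$, $\mathbf n'=-\kappa\mathbf t+\tau\mathbf b$, $\mathbf b'=-\tau\mathbf n$, $'=d/ds$). Let $r>0$ be a smooth $L$-periodic function of $s$. The canal surface around $\mathbf c$ with radial function $r$ is the map of the torus $$\alpha(s,\varphi)=\mathbf c(s)+r\cos\theta\,\mathbf t+r\sin\theta\,[\cos\varphi\,\mathbf n+\sin\varphi\,\mathbf b],\qquad \cos\theta=-r'(s),\ \theta\in\,]0,\pi[,$$ with $(s,\varphi)\in\mathbb R^2$ modulo $L\times2\pi$, where it is required that $$\kappa(s)<\frac{1-r'(s)^2-r(s)r''(s)}{r(s)\sqrt{1-r'(s)^2}},$$ so that $\alpha$ is an immersion. It is the envelope of the spheres of radius $r(s)$ centered at $\mathbf c(s)$. Principal cycles. One principal foliation of $\alpha$ consists of the circles $s=$ constant (all closed). The other one, the minimal principal foliation, is orthogonal to these circles. When the curve is parametrized by a $T$-periodic parameter $t$ with $\dot s=|\dot{\mathbf c}|$ (dots denote $d/dt$), its leaves are the solution curves of $$\frac{d\varphi}{dt}=-\left[\tau(t)+\frac{\dot r(t)}{(\dot s(t)^2-\dot r(t)^2)^{1/2}}\,\kappa(t)\sin\varphi\right]\dot s(t),$$ where here $\kappa(t)$ and $\tau(t)$ denote the curvature and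 torsion of the center curve. For $S_{\varepsilon,\rho,\mu}$ one has $T=2\pi$, and the center curve is $\mathbf c_\varepsilon$, whose curvature depends on $\varepsilon$ and coincides with the function $\kappa(t)$ of the claim when $\varepsilon=0$. A principal cycle here is a periodic (closed) leaf of the minimal principal foliation. The return map is $\Pi(\varphi_0)=\Phi(T,\varphi_0)$, where $\Phi(\cdot,\varphi_0)$ is the solution with $\Phi(0,\varphi_0)=\varphi_0$; closed leaves that wind once in the $t$-direction and do not wind in $\varphi$ correspond to fixed points $\Pi(\varphi_0)=\varphi_0$ (with $\varphi_0$ taken modulo $2\pi$). Such a cycle is hyperbolic (simple) if $\Pi'(\varphi_0)\neq1$, and double (semi-stable, semi-hyperbolic) if $\Pi'(\varphi_0)=1$ and $\Pi''(\varphi_0)\ne0$. *)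

(* Defs.v *)
From Stdlib Require Import Reals Lra ZArith.
From Coquelicot Require Import Coquelicot.

Open Scope R_scope.

(** * Vectors of Euclidean 3-space *)

Definition vec : Type := (R * R * R)%type.

Definition vx (v : vec) : R := fst (fst v).
Definition vy (v : vec) : R := snd (fst v).
Definition vz (v : vec) : R := snd v.

Definition dot (v w : vec) : R := vx v * vx w + vy v * vy w + vz v * vz w.

Definition cross (v w : vec) : vec :=
  (vy v * vz w - vz v * vy w,
   vz v * vx w - vx v * vz w,
   vx v * vy w - vy v * vx w).

Definition vnorm (v : vec) : R := sqrt (dot v v).

Definition vDerive (f : R -> vec) (t : R) : vec :=
  (Derive (fun u => vx (f u)) t,
   Derive (fun u => vy (f u)) t,
   Derive (fun u => vz (f u)) t).

(** * Frenet apparatus of a curve in an arbitrary regular parameter *)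

Definition speed (c : R -> vec) (t : R) : R := vnorm (vDerive c t).

(** [dds c] and [vdds c] are the derivative d/ds with respect to the arc
    length of [c], expressed in the given parameter [t]. *)
Definition dds (c : R -> vec) (f : R -> R) (t : R) : R :=
  Derive f t / speed c t.

Definition vdds (c : R -> vec) (f : R -> vec) (t : R) : vec :=
  scal (/ speed c t) (vDerive f t).

Definition tangent (c : R -> vec) : R -> vec := vdds c c.

Definition curvature (c : R -> vec) (t : R) : R := vnorm (vdds c (tangent c) t).

Definition normal (c : R -> vec) (t : R) : vec :=
  scal (/ curvature c t) (vdds c (tangent c) t).

Definition binormal (c : R -> vec) (t : R) : vec :=
  cross (tangent c t) (normal c t).

(** * Canal surfaces *)

Definition theta (c : R -> vec) (r : R -> R) (t : R) : R := acos (- dds c r t).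

Definition canal (c : R -> vec) (r : R -> R) (t phi : R) : vec :=
  plus (plus (c t) (scal (r t * cos (theta c r t)) (tangent c t)))
       (scal (r t * sin (theta c r t))
          (plus (scal (cos phi) (normal c t)) (scal (sin phi) (binormal c t)))).

(** The bound on [dds c r t] says that [theta c r t] lies in ]0, PI[. *)
Definition is_canal (c : R -> vec) (r : R -> R) : Prop :=
  forall t : R,
    0 < speed c t /\ 0 < curvature c t /\ 0 < r t /\ Rabs (dds c r t) < 1 /\
    curvature c t <
      (1 - dds c r t ^ 2 - r t * dds c (dds c r) t)
      / (r t * sqrt (1 - dds c r t ^ 2)).

(** * Principal directions of a parametrized surface *)

Definition d1 (X : R -> R -> vec) (u v : R) : vec := vDerive (fun x => X x v) u.
Definition d2 (X : R -> R -> vec) (u v : R) : vec := vDerive (fun y => X u y) v.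

(** For [canal c r] this is the normal pointing towards the center curve, so
    that the circles [t = constant] have principal curvature [1 / r], the
    larger of the two principal curvatures. *)
Definition unit_normal (X : R -> R -> vec) (u v : R) : vec :=
  let w := cross (d1 X u v) (d2 X u v) in scal (/ vnorm w) w.

(** Rodrigues' equation dN = - k dX in the direction [(a, b)]. *)
Definition principal (X : R -> R -> vec) (u v a b k : R) : Prop :=
  (a <> 0 \/ b <> 0) /\
  plus (scal a (d1 (unit_normal X) u v)) (scal b (d2 (unit_normal X) u v)) =
  scal (- k) (plus (scal a (d1 X u v)) (scal b (d2 X u v))).

Definition minimal_principal (X : R -> R -> vec) (u v a b : R) : Prop :=
  exists k : R, principal X u v a b k /\
    forall a' b' k' : R, principal X u v a' b' k' -> k <= k'.

(** * Leaves of the minimal principal foliation and principal cycles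

    Here [X] is a canal surface, [T]-periodic in its first parameter [t] and
    [2 * PI]-periodic in its second parameter.  The circles [t = constant] are
    the leaves of the other principal foliation, hence the maximal leaves of
    the minimal one are graphs over the whole [t]-line, taken modulo the
    periods. *)

Definition leaf (X : R -> R -> vec) (phi : R -> R) : Prop :=
  forall t : R, exists d : R,
    is_derive phi t d /\ minimal_principal X t (phi t) 1 d.

(** The two graphs project onto the same subset of the torus. *)
Definition same_leaf (T : R) (phi psi : R -> R) : Prop :=
  exists m q : Z, forall t : R,
    psi t = phi (t + IZR m * T) + IZR q * (2 * PI).

Definition principal_cycle (T : R) (X : R -> R -> vec) (phi : R -> R) : Prop :=
  leaf X phi /\
  exists (p : nat) (q : Z), (0 < p)%nat /\
    forall t : R, phi (t + INR p * T) = phi t + IZR q * (2 * PI).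

(** [Phi t x] is the value at [t] of the unique leaf through [(0, x)]. *)
Definition is_flow (X : R -> R -> vec) (Phi : R -> R -> R) : Prop :=
  forall x : R,
    leaf X (fun t => Phi t x) /\ Phi 0 x = x /\
    forall phi : R -> R, leaf X phi -> phi 0 = x ->
      forall t : R, phi t = Phi t x.

Definition is_return_map (T : R) (X : R -> R -> vec) (Pi : R -> R) : Prop :=
  exists Phi : R -> R -> R,
    is_flow X Phi /\ forall x : R, Pi x = Phi T x.

Definition hyperbolic_cycle (T : R) (X : R -> R -> vec) (phi : R -> R) : Prop :=
  principal_cycle T X phi /\
  exists Pi : R -> R, is_return_map T X Pi /\
    Pi (phi 0) = phi 0 /\
    ex_derive Pi (phi 0) /\ Derive Pi (phi 0) <> 1.

Definition double_cycle (T : R) (X : R -> R -> vec) (phi : R -> R) : Prop :=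
  principal_cycle T X phi /\
  exists Pi : R -> R, is_return_map T X Pi /\
    Pi (phi 0) = phi 0 /\
    locally (phi 0) (fun x => ex_derive Pi x) /\ ex_derive_n Pi 2 (phi 0) /\
    Derive Pi (phi 0) = 1 /\ Derive_n Pi 2 (phi 0) <> 0.

Definition has_two_hyperbolic_cycles (T : R) (X : R -> R -> vec) : Prop :=
  exists phi1 phi2 : R -> R,
    hyperbolic_cycle T X phi1 /\ hyperbolic_cycle T X phi2 /\
    ~ same_leaf T phi1 phi2 /\
    forall psi : R -> R, principal_cycle T X psi ->
      same_leaf T phi1 psi \/ same_leaf T phi2 psi.

Definition has_one_double_cycle (T : R) (X : R -> R -> vec) : Prop :=
  exists phi : R -> R,
    double_cycle T X phi /\
    forall psi : R -> R, principal_cycle T X psi -> same_leaf T phi psi.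

(** * The three-parameter family around the ellipse *)

Definition kappa (t : R) : R := 2 / Rpower (4 - 3 * cos t ^ 2) (3 / 2).

Lemma kappa_arg_pos (t : R) : 0 < 4 - 3 * cos t ^ 2.
Proof. generalize (COS_bound t); nra. Qed.

Lemma Derive_kappa (t : R) :
  Derive kappa t = - 18 * cos t * sin t / Rpower (4 - 3 * cos t ^ 2) (5 / 2).
Proof.
apply is_derive_unique; unfold kappa.
set (u := fun t : R => 4 - 3 * cos t ^ 2).
assert (Hu : is_derive u t (6 * cos t * sin t)).
{ unfold u; auto_derive; [easy | ring]. }
assert (u0 : 0 < u t) by apply kappa_arg_pos.
assert (H : is_derive (fun t => Rpower (u t) (3 / 2)) t
          (6 * cos t * sin t * (3 / 2 * Rpower (u t) (3 / 2 - 1)))).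
{ apply (is_derive_comp (fun x => Rpower x (3 / 2)) u); [|exact Hu].
  apply is_derive_Reals, derivable_pt_lim_power, u0. }
assert (E3 : Rpower (u t) (3 / 2) = Rpower (u t) (1 / 2) * u t).
{ rewrite <- (Rpower_1 (u t)) at 3 by easy; rewrite <- Rpower_plus; f_equal; lra. }
assert (E5 : Rpower (u t) (5 / 2) = Rpower (u t) (1 / 2) * u t * u t).
{ rewrite <- E3; rewrite <- (Rpower_1 (u t)) at 3 by easy.
  rewrite <- Rpower_plus; f_equal; lra. }
assert (p0 : 0 < Rpower (u t) (1 / 2)) by apply exp_pos.
assert (q0 : Rpower (u t) (3 / 2) <> 0) by (apply Rgt_not_eq, exp_pos).
fold (u t); replace (3 / 2 - 1) with (1 / 2) in H by lra.
evar_last.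
{ apply (is_derive_scal (fun t => / Rpower (u t) (3 / 2)) t 2).
  apply is_derive_inv; [exact H | exact q0]. }
rewrite E5; simpl; rewrite E3; field; lra.
Qed.

Definition center (eps t : R) : vec := (2 * cos t, sin t, eps * Derive kappa t).

Lemma curvature_ellipse (t : R) : curvature (center 0) t = kappa t.
Proof.
set (u := fun t : R => 4 - 3 * cos t ^ 2).
assert (u0 : forall t, 0 < u t) by (intro; apply kappa_arg_pos).
assert (s0 : forall t, 0 < sqrt (u t)) by (intro; apply sqrt_lt_R0, u0).
assert (ss : forall t, sqrt (u t) * sqrt (u t) = u t)
  by (intro; apply sqrt_sqrt, Rlt_le, u0).
assert (cs : forall t, sin t ^ 2 = 1 - cos t ^ 2).
{ intro x; generalize (sin2_cos2 x); unfold Rsqr; intro; nra. }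
assert (Dc : forall t, vDerive (center 0) t = (- 2 * sin t, cos t, 0)).
{ intro x; unfold vDerive, center, vx, vy, vz; simpl.
  repeat apply f_equal2; apply is_derive_unique.
  - auto_derive; [easy | ring].
  - auto_derive; [easy | ring].
  - apply (is_derive_ext (fun _ => 0)); [intro; simpl; ring |].
    apply (@is_derive_const R_AbsRing R_NormedModule). }
assert (Sp : forall t, speed (center 0) t = sqrt (u t)).
{ intro x; unfold speed, vnorm; rewrite Dc; f_equal.
  unfold dot, vx, vy, vz, u; simpl; generalize (cs x); intro; nra. }
assert (Du : forall t, is_derive u t (6 * cos t * sin t)).
{ intro x; unfold u; auto_derive; [easy | ring]. }
assert (Tg : forall t, tangent (center 0) t =
           (- 2 * sin t / sqrt (u t), cos t / sqrt (u t), 0)).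
{ intro x; unfold tangent, vdds; rewrite Dc, Sp.
  unfold scal; simpl; unfold prod_scal, scal; simpl; unfold mult; simpl.
  unfold prod_scal, scal; simpl; unfold mult; simpl.
  repeat apply f_equal2;
    match goal with |- ?a = ?b => change (@eq R a b) end; unfold Rdiv; ring. }
assert (Ds : forall t, is_derive (fun t => sqrt (u t)) t
           (3 * cos t * sin t / sqrt (u t))).
{ intro x; evar_last; [apply is_derive_sqrt; [apply Du | apply u0] |].
  field; apply Rgt_not_eq, s0. }
assert (DT : vDerive (tangent (center 0)) t =
           (- 2 * cos t / sqrt (u t) ^ 3, - 4 * sin t / sqrt (u t) ^ 3, 0)).
{ unfold vDerive; repeat apply f_equal2; apply is_derive_unique.
  - apply (is_derive_ext (fun t => - 2 * sin t / sqrt (u t))).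
    { intro x; rewrite Tg; reflexivity. }
    evar_last.
    { apply is_derive_div; [| apply Ds | apply Rgt_not_eq, s0].
      apply (is_derive_scal sin t (- 2)), is_derive_Reals, derivable_pt_lim_sin. }
    generalize (s0 t) (ss t) (cs t); unfold u.
    set (w := sqrt _); intros w0 ww hs.
    assert (E : sin t * sin t = 1 - cos t ^ 2) by (rewrite <- hs; ring).
    apply (Rmult_eq_reg_r (w ^ 3)); [| apply pow_nonzero; lra].
    field_simplify; [| lra | lra].
    replace (w ^ 2) with (4 - 3 * cos t ^ 2) by (rewrite <- ww; ring).
    rewrite hs; ring.
  - apply (is_derive_ext (fun t => cos t / sqrt (u t))).
    { intro x; rewrite Tg; reflexivity. }
    evar_last.
    { apply is_derive_div; [| apply Ds | apply Rgt_not_eq, s0].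
      apply is_derive_Reals, derivable_pt_lim_cos. }
    generalize (s0 t) (ss t) (cs t); unfold u.
    set (w := sqrt _); intros w0 ww hs.
    apply (Rmult_eq_reg_r (w ^ 3)); [| apply pow_nonzero; lra].
    field_simplify; [| lra | lra].
    replace (w ^ 2) with (4 - 3 * cos t ^ 2) by (rewrite <- ww; ring).
    ring.
  - apply (is_derive_ext (fun _ => 0)).
    { intro x; rewrite Tg; reflexivity. }
    apply (@is_derive_const R_AbsRing R_NormedModule). }
assert (K : kappa t = 2 / sqrt (u t) ^ 3).
{ unfold kappa; fold (u t); f_equal.
  rewrite <- Rpower_sqrt by apply u0.
  rewrite <- Rpower_pow by apply exp_pos.
  rewrite Rpower_mult; f_equal; simpl; lra. }
rewrite K; unfold curvature, vdds; rewrite DT, Sp; unfold vnorm.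
assert (p0 : 0 < sqrt (u t) ^ 3) by (apply pow_lt, s0).
apply sqrt_lem_1.
- unfold dot; match goal with |- 0 <= ?a * ?a + ?b * ?b + ?c * ?c =>
    generalize (Rle_0_sqr a) (Rle_0_sqr b) (Rle_0_sqr c) end.
  unfold Rsqr; lra.
- apply Rlt_le, Rdiv_lt_0_compat; lra.
- unfold scal; simpl; unfold prod_scal, scal; simpl; unfold mult; simpl.
  unfold prod_scal, scal; simpl; unfold mult; simpl.
  unfold dot, vx, vy, vz; simpl.
  generalize (s0 t) (ss t) (cs t); unfold u.
  set (w := sqrt _); intros w0 ww hs.
  apply (Rmult_eq_reg_r (w ^ 8)); [| apply pow_nonzero; lra].
  field_simplify; [| lra | lra].
  replace (w ^ 2) with (4 - 3 * cos t ^ 2) by (rewrite <- ww; ring).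
  replace (sin t ^ 2) with (1 - cos t ^ 2) by (rewrite <- hs; ring).
  ring.
Qed.

Definition radius (rho mu t : R) : R := rho + mu * Derive kappa t.

Definition canal_family (eps rho mu : R) : R -> R -> vec :=
  canal (center eps) (radius rho mu).

(* Main.v *)
Require Import Defs.
From Stdlib Require Import Reals Lra Lia ZArith IndefiniteDescription.
From Coquelicot Require Import Coquelicot.
Open Scope R_scope.

(** By Rodrigues' equation in the Frenet frame, the leaves of the minimal
    principal foliation are the graphs of the solutions of
    [phi' = a t + b t * sin phi], where [a] depends on [t] and [eps], and [b] on
    [t], [eps] and [mu] ([leaf_canal_iff], [leaf_center_iff]).

    With [tan (phi / 2)] as unknown this is a Riccati equation, so the return
    map is a homography of the circle.  This is used through the chord formula
    [sin_half_flow]: a return map other than the identity has at most two fixed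
    points, two fixed points are hyperbolic with inverse multipliers, and at
    the only fixed point of a parabolic map the second derivative is not zero.
    A map with a fixed point has rotation number zero, so every closed leaf
    comes from a fixed point ([periodic_fixed]).

    The coefficients are even and [2 * PI]-periodic in [t], so the equation is
    reversible: [phi t] may be replaced by [c - phi (2 * PI - t)] for
    [c = PI] or [c = - PI].  The angles [PI / 2] and [- PI / 2] are fixed by
    these reflections, and the direction in which the return map moves them is
    the direction in which they move during half a period.  If one moves up
    and the other down there are two hyperbolic cycles
    ([two_hyperbolic_of_half_turn]); if exactly one of them returns, it lies on
    a double cycle ([one_double_of_half_turn]).  Moreover [a] is odd and [b]
    even in [eps], so [phi -> - phi] exchanges the two angles together with
    [eps] and [- eps], and only the displacement [displ eps mu] of [- PI / 2]
    matters: one takes for [eps2] the solution of [displ (eps2 mu) mu = 0], and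
    [eps1 = - eps2].

    To first order [displ eps mu] is [J0 * (eps - mu)], with [J0] the integral
    of the squared derivative of [kappa] over half a period: if [w] is the speed of the ellipse,
    the torsion and the term in [mu] both integrate by parts to [J0], thanks to
    [w + w'' = 2 * kappa] ([average_a1], [average_b1]).  The implicit function
    theorem gives [eps2].  Its smoothness needs smooth dependence of solutions
    on parameters; the predicate [reg] expresses smoothness by Taylor
    expansions with quadratic error, uniformly in time, and the gradient of a
    solution is again built from the solution by integration, so regularity
    bootstraps ([psi_reg], [implicit_curve]). *)

Ltac Rsimpl := unfold minus, plus, opp, scal, zero; simpl; unfold mult; simpl.

(** * Elementary estimates *)

Lemma is_derive_Rconst (k t : R) : is_derive (fun _ => k) t 0.
Proof. exact (@is_derive_const R_AbsRing R_NormedModule k t). Qed.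

Lemma is_derive_Rplus (f g : R -> R) t f' g' : is_derive f t f' -> is_derive g t g' ->
  is_derive (fun u => f u + g u) t (f' + g').
Proof. apply (is_derive_plus f g). Qed.

Lemma is_derive_Rminus (f g : R -> R) t f' g' : is_derive f t f' -> is_derive g t g' ->
  is_derive (fun u => f u - g u) t (f' - g').
Proof. apply (is_derive_minus f g). Qed.

Lemma is_derive_Rmult (f g : R -> R) t f' g' : is_derive f t f' -> is_derive g t g' ->
  is_derive (fun u => f u * g u) t (f' * g t + f t * g').
Proof. intros F G; apply (is_derive_mult f g t f' g' F G); intros; apply Rmult_comm. Qed.

Lemma RInt_00 (g : R -> R) : RInt g 0 0 = 0.
Proof. apply (@RInt_point R_CompleteNormedModule). Qed.

Lemma Rabs_mult_le x y A B : Rabs x <= A -> Rabs y <= B -> Rabs (x * y) <= A * B.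
Proof. intros; rewrite Rabs_mult; apply Rmult_le_compat; try apply Rabs_pos; easy. Qed.

Lemma Rabs_mult_le1 x y A : Rabs x <= A -> Rabs y <= 1 -> Rabs (x * y) <= A.
Proof. intros; rewrite <- (Rmult_1_r A); apply Rabs_mult_le; easy. Qed.

Lemma Rabs_sin_le x : Rabs (sin x) <= 1.
Proof. apply Rabs_le, SIN_bound. Qed.

Lemma Rabs_cos_le x : Rabs (cos x) <= 1.
Proof. apply Rabs_le, COS_bound. Qed.

Lemma exp_nonneg x : 0 <= exp x.
Proof. apply Rlt_le, exp_pos. Qed.

Lemma is_derive_continuous (f : R -> R) (t l : R) :
  is_derive f t l -> continuous f t.
Proof.
intros H; apply (@ex_derive_continuous R_AbsRing R_NormedModule); exists l; exact H.
Qed.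

Lemma is_derive_RInt0 (g : R -> R) (t : R) :
  (forall s, continuous g s) -> is_derive (fun u => RInt g 0 u) t (g t).
Proof.
intros Hg; apply (is_derive_RInt g _ 0); [|apply Hg].
apply filter_forall; intros u; apply (@RInt_correct R_CompleteNormedModule).
apply (@ex_RInt_continuous R_CompleteNormedModule); intros z _; apply Hg.
Qed.

Lemma is_derive_cst_RInt0 (x : R) (g : R -> R) (t : R) :
  (forall s, continuous g s) -> is_derive (fun u => x + RInt g 0 u) t (g t).
Proof.
intros Hg; rewrite <- (Rplus_0_l (g t)).
apply (is_derive_Rplus (fun _ => x)); [apply is_derive_Rconst|apply is_derive_RInt0, Hg].
Qed.

Lemma RInt_lin (g h : R -> R) (x y t : R) :
  (forall s, continuous g s) -> (forall s, continuous h s) ->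
  RInt (fun s => g s * x + h s * y) 0 t = RInt g 0 t * x + RInt h 0 t * y.
Proof.
intros Hg Hh; apply (@is_RInt_unique R_CompleteNormedModule).
assert (C : forall k : R -> R, (forall s, continuous k s) -> is_RInt k 0 t (RInt k 0 t)).
{ intros k Hk; apply (@RInt_correct R_CompleteNormedModule).
  apply (@ex_RInt_continuous R_CompleteNormedModule); intros z _; apply Hk. }
apply (is_RInt_ext (fun s => @plus R_NormedModule (scal x (g s)) (scal y (h s))));
  [intros; Rsimpl; ring|].
replace (RInt g 0 t * x + RInt h 0 t * y) with
  (@plus R_NormedModule (scal x (RInt g 0 t)) (scal y (RInt h 0 t)))
  by (unfold plus, scal; simpl; unfold mult; simpl; ring).
apply (is_RInt_plus (V := R_NormedModule)); apply (is_RInt_scal (V := R_NormedModule)), C;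
  assumption.
Qed.

Lemma derive_nonneg_le (f df : R -> R) (a b : R) :
  a <= b -> (forall s, a <= s <= b -> is_derive f s (df s) /\ 0 <= df s) ->
  f a <= f b.
Proof.
intros ab H.
destruct (MVT_gen f a b df) as [c [Hc E]].
- intros s; rewrite Rmin_left, Rmax_right by lra; intros Hs; apply H; lra.
- intros s; rewrite Rmin_left, Rmax_right by lra; intros Hs.
  apply continuity_pt_filterlim, (is_derive_continuous f s (df s)), H; lra.
- rewrite Rmin_left, Rmax_right in Hc by lra.
  assert (0 <= df c) by (apply H; lra); nra.
Qed.

Lemma derive_zero_eq (f : R -> R) (a b : R) :
  (forall s, is_derive f s 0) -> f a = f b.
Proof.
intros H.
assert (W : forall x y, x <= y -> f x = f y).
{ intros x y xy; apply Rle_antisym.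
  - apply (derive_nonneg_le f (fun _ => 0)); [lra|]; intros s _; split; [apply H|lra].
  - cut (- f x <= - f y); [lra|].
    apply (derive_nonneg_le (fun s => - f s) (fun _ => - 0)); [lra|].
    intros s _; split; [|lra].
    apply (is_derive_opp f s 0), H. }
destruct (Rle_dec a b); [apply W; lra | symmetry; apply W; lra].
Qed.

(** Comparing derivatives instead of integrals avoids all integrability side
    conditions. *)
Lemma derive_abs_le (f df g dg : R -> R) (a b : R) :
  a <= b ->
  (forall s, a <= s <= b ->
     is_derive f s (df s) /\ is_derive g s (dg s) /\ Rabs (df s) <= dg s) ->
  Rabs (f b - f a) <= g b - g a.
Proof.
intros ab H.
assert (H1 : g a - f a <= g b - f b).
{ apply (derive_nonneg_le (fun s => g s - f s) (fun s => dg s - df s)); [lra|].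
  intros s Hs; destruct (H s Hs) as (F & G & L); split.
  - apply (is_derive_minus g f s); assumption.
  - apply Rabs_le_between in L; lra. }
assert (H2 : g a + f a <= g b + f b).
{ apply (derive_nonneg_le (fun s => g s + f s) (fun s => dg s + df s)); [lra|].
  intros s Hs; destruct (H s Hs) as (F & G & L); split.
  - apply (is_derive_plus g f s); assumption.
  - apply Rabs_le_between in L; lra. }
apply Rabs_le; lra.
Qed.

Lemma derive_bound (f df : R -> R) (K a b : R) :
  a <= b ->
  (forall s, a <= s <= b -> is_derive f s (df s) /\ Rabs (df s) <= K) ->
  Rabs (f b - f a) <= K * (b - a).
Proof.
intros ab H; replace (K * (b - a)) with (K * b - K * a) by ring.
apply (derive_abs_le f df (fun s => K * s) (fun _ => K)); [lra|].
intros s Hs; destruct (H s Hs); split; [easy|split; [|easy]].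
auto_derive; [easy|ring].
Qed.

(** The square of the difference, unlike its absolute value, is
    differentiable; adding [eta ^ 2] to it absorbs the inhomogeneity. *)
Lemma gronwall (D dD : R -> R) (L eta t : R) :
  0 <= t -> 0 <= L ->
  (forall s, 0 <= s <= t ->
     is_derive D s (dD s) /\ Rabs (dD s) <= L * Rabs (D s) + eta) ->
  D t ^ 2 + eta ^ 2 <= (D 0 ^ 2 + eta ^ 2) * exp ((2 * L + 1) * t).
Proof.
intros t0 L0 H.
(* the exponential factor makes [h] increasing *)
set (c := 2 * L + 1).
set (h := fun s => - ((D s ^ 2 + eta ^ 2) * exp (- c * s))).
assert (M : h 0 <= h t).
{ apply (derive_nonneg_le h
    (fun s => exp (- c * s) * (c * (D s ^ 2 + eta ^ 2) - 2 * D s * dD s))); [lra|].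
  intros s Hs; destruct (H s Hs) as [HD B]; split.
  - unfold h; auto_derive; [exists (dD s); exact HD|].
    replace (Derive (fun x : R => D x) s) with (dD s)
      by (symmetry; apply is_derive_unique, HD); ring.
  - apply Rmult_le_pos; [apply Rlt_le, exp_pos|].
    assert (2 * D s * dD s <= 2 * Rabs (D s) * Rabs (dD s)).
    { replace (2 * D s * dD s) with (2 * (D s * dD s)) by ring.
      rewrite Rmult_assoc, <- Rabs_mult; generalize (Rle_abs (D s * dD s)); lra. }
    assert (Rabs (D s) ^ 2 = D s ^ 2) by apply pow2_abs.
    generalize (Rabs_pos (D s)) (Rabs_pos (dD s)); intros.
    assert (Rabs (D s) * Rabs (dD s) <= Rabs (D s) * (L * Rabs (D s) + eta))
      by (apply Rmult_le_compat_l; lra).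
    assert (0 <= L * eta ^ 2) by (apply Rmult_le_pos; [lra|apply pow2_ge_0]).
    assert (0 <= D s ^ 2 - 2 * (Rabs (D s) * eta) + eta ^ 2).
    { rewrite <- pow2_abs; generalize (pow2_ge_0 (Rabs (D s) - eta)); lra. }
    assert (Rabs (D s) * (L * Rabs (D s) + eta) = L * D s ^ 2 + Rabs (D s) * eta)
      by (rewrite <- pow2_abs; ring).
    unfold c; lra. }
unfold h in M; rewrite Rmult_0_r, exp_0 in M.
apply (Rmult_le_reg_r (exp (- c * t))); [apply exp_pos|].
rewrite Rmult_assoc, <- exp_plus.
replace (c * t + - c * t) with 0 by ring; rewrite exp_0; lra.
Qed.

(** * Flow of a bounded Lipschitz scalar equation *)

Definition solves (f : R -> R -> R) (phi : R -> R) : Prop :=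
  forall t, is_derive phi t (f t (phi t)).

Lemma solves_continuous f phi t : solves f phi -> continuous phi t.
Proof. intros H; eapply is_derive_continuous, H. Qed.

Lemma solves_unique (f : R -> R -> R) (M : R) (phi psi : R -> R) (t1 : R) :
  (forall t x y, Rabs (f t x - f t y) <= M * Rabs (x - y)) ->
  solves f phi -> solves f psi -> phi t1 = psi t1 -> forall t, phi t = psi t.
Proof.
intros Lip Hp Hq E t.
assert (M0 : 0 <= M).
{ generalize (Lip 0 1 0) (Rabs_pos (f 0 1 - f 0 0)); rewrite Rminus_0_r, Rabs_R1; lra. }
(* [sg] is the direction of time *)
assert (W : forall sg u, 0 <= u -> sg = 1 \/ sg = -1 ->
          phi (t1 + sg * u) = psi (t1 + sg * u)).
{ intros sg u u0 Hsg.
  assert (G := gronwall (fun s => phi (t1 + sg * s) - psi (t1 + sg * s))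
    (fun s => sg * (f (t1 + sg * s) (phi (t1 + sg * s))
                    - f (t1 + sg * s) (psi (t1 + sg * s)))) M 0 u u0 M0).
  assert (Z : (phi (t1 + sg * u) - psi (t1 + sg * u)) ^ 2 <= 0).
  { replace 0 with ((0 ^ 2 + 0 ^ 2) * exp ((2 * M + 1) * u)) by ring.
    eapply Rle_trans; [|eapply Rle_trans; [apply G|]].
    - lra.
    - intros s Hs; split.
      + assert (A : is_derive (fun s => t1 + sg * s) s sg) by (auto_derive; [easy|ring]).
        evar_last.
        * apply (is_derive_minus (fun s => phi (t1 + sg * s)) (fun s => psi (t1 + sg * s)));
            [apply (is_derive_comp phi)|apply (is_derive_comp psi)];
            first [apply A | apply Hp | apply Hq].
        * Rsimpl; ring.
      + rewrite Rabs_mult, Rplus_0_r.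
        replace (Rabs sg) with 1
          by (destruct Hsg; subst; [rewrite Rabs_R1 | rewrite Rabs_left]; lra).
        rewrite Rmult_1_l; apply Lip.
    - rewrite Rmult_0_r, Rplus_0_r, E, Rminus_diag; lra. }
  assert (0 <= (phi (t1 + sg * u) - psi (t1 + sg * u)) ^ 2) by apply pow2_ge_0.
  apply Rminus_diag_uniq; nra. }
destruct (Rle_dec t1 t).
- replace t with (t1 + 1 * (t - t1)) by ring; apply W; [lra|auto].
- replace t with (t1 + (-1) * (t1 - t)) by ring; apply W; [lra|auto].
Qed.

(** Two solutions cannot cross: they would agree at the crossing. *)
Lemma solves_lt (f : R -> R -> R) (M : R) (phi psi : R -> R) (t1 : R) :
  (forall t x y, Rabs (f t x - f t y) <= M * Rabs (x - y)) ->
  solves f phi -> solves f psi -> phi t1 < psi t1 -> forall t, phi t < psi t.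
Proof.
intros Lip Hp Hq L t.
destruct (Rlt_or_le (phi t) (psi t)) as [|G]; [easy|exfalso].
destruct (IVT_gen (fun s => phi s - psi s) t t1 0) as [z [_ Z]].
- intros s; apply continuity_pt_filterlim.
  apply (continuous_minus phi psi); eapply solves_continuous; eauto.
- rewrite Rmin_right, Rmax_left; lra.
- assert (phi t1 = psi t1)
    by (apply (solves_unique f M phi psi z); trivial; lra); lra.
Qed.

Section Picard.

Variables (f : R -> R -> R) (M : R).
Hypothesis M0 : 0 < M.
Hypothesis f_cont : forall phi : R -> R, (forall t, continuous phi t) ->
  forall t, continuous (fun s => f s (phi s)) t.
Hypothesis f_bound : forall t x, Rabs (f t x) <= M.
Hypothesis f_lip : forall t x y, Rabs (f t x - f t y) <= M * Rabs (x - y).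

Fixpoint picard (n : nat) (x t : R) : R :=
  match n with
  | O => x
  | S n => x + RInt (fun s => f s (picard n x s)) 0 t
  end.

Definition flow (t x : R) : R := real (Lim_seq (fun n => picard n x t)).

Let w (t : R) : R := cosh (2 * M * t).

Lemma picard_cont n x t : continuous (picard n x) t.
Proof.
revert t; induction n as [|n IH]; intros t; simpl; [apply continuous_const|].
apply (continuous_plus (fun _ => x)); [apply continuous_const|].
eapply is_derive_continuous, is_derive_RInt0, f_cont, IH.
Qed.

Lemma picard_S_derive n x t : is_derive (picard (S n) x) t (f t (picard n x t)).
Proof.
simpl; apply (is_derive_cst_RInt0 x (fun s => f s (picard n x s))), f_cont, picard_cont.
Qed.

Lemma picard_0 n x : picard n x 0 = x.
Proof.
destruct n; simpl; [easy|]; rewrite RInt_00; ring.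
Qed.

Lemma sinh_le_cosh u : Rabs (sinh u) <= cosh u.
Proof.
unfold sinh, cosh; generalize (exp_pos u) (exp_pos (- u)); intros.
apply Rabs_le; lra.
Qed.

Lemma w_ge_1 t : 1 <= w t.
Proof.
unfold w, cosh; set (u := 2 * M * t).
assert (exp u * exp (- u) = 1) by (rewrite <- exp_plus, Rplus_opp_r; apply exp_0).
generalize (exp_pos u) (exp_pos (- u)); intros.
generalize (pow2_ge_0 (exp u - exp (- u))); nra.
Qed.

(** The weight [w] grows so fast that integrating it gains a factor 2; this
    makes the Picard operator a contraction on the whole line at once. *)
Lemma weighted_bound (g dg : R -> R) (K t : R) :
  g 0 = 0 -> 0 <= K ->
  (forall s, is_derive g s (dg s) /\ Rabs (dg s) <= M * (K * w s)) ->
  Rabs (g t) <= K / 2 * w t.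
Proof.
intros g0 K0 H.
set (h := fun s => K / 2 * sinh (2 * M * s)).
assert (Hh : forall s, is_derive h s (M * (K * w s))).
{ intros s; unfold h, w, sinh, cosh; auto_derive; [easy|].
  field. }
assert (B : Rabs (g t) <= Rabs (h t)).
{ assert (h0 : h 0 = 0) by (unfold h; rewrite Rmult_0_r, sinh_0; ring).
  destruct (Rle_dec 0 t).
  - apply Rle_trans with (h t - h 0); [|rewrite h0, Rminus_0_r; apply Rle_abs].
    rewrite <- (Rminus_0_r (g t)), <- g0 at 1.
    apply (derive_abs_le g dg h (fun s => M * (K * w s))); [lra|].
    intros s _; split; [apply H|split; [apply Hh|apply H]].
  - apply Rle_trans with (h 0 - h t); [|rewrite h0, Rminus_0_l, <- Rabs_Ropp; apply Rle_abs].
    rewrite <- Rabs_Ropp; replace (- g t) with (g 0 - g t) by lra.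
    apply (derive_abs_le g dg h (fun s => M * (K * w s))); [lra|].
    intros s _; split; [apply H|split; [apply Hh|apply H]]. }
eapply Rle_trans; [apply B|]; unfold h; rewrite Rabs_mult, Rabs_pos_eq by lra.
apply Rmult_le_compat_l; [lra|apply sinh_le_cosh].
Qed.

Lemma picard_step n x t :
  Rabs (picard (S n) x t - picard n x t) <= (/ 2) ^ n * w t.
Proof.
revert t; induction n as [|n IH]; intros t.
- eapply Rle_trans; [apply (weighted_bound
    (fun t => picard 1 x t - x) (fun s => f s x) 1)|].
  + rewrite picard_0; ring.
  + lra.
  + intros s; split.
    * evar_last; [apply (is_derive_minus (picard 1 x) (fun _ => x));
        [apply picard_S_derive|apply is_derive_Rconst]|].
      Rsimpl; ring.
    * generalize (w_ge_1 s) (f_bound s x); nra.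
  + generalize (w_ge_1 t); simpl; lra.
- eapply Rle_trans; [apply (weighted_bound
    (fun t => picard (S (S n)) x t - picard (S n) x t)
    (fun s => f s (picard (S n) x s) - f s (picard n x s)) ((/ 2) ^ n))|].
  + rewrite !picard_0; ring.
  + apply pow_le; lra.
  + intros s; split.
    * apply (is_derive_minus (picard (S (S n)) x) (picard (S n) x)); apply picard_S_derive.
    * eapply Rle_trans; [apply f_lip|]; apply Rmult_le_compat_l; [lra|apply IH].
  + simpl; right; field.
Qed.

Lemma picard_cauchy n m x t :
  Rabs (picard (n + m) x t - picard n x t) <= 2 * w t * (/ 2) ^ n.
Proof.
(* the telescoped geometric sum, kept exact for the induction *)
cut (Rabs (picard (n + m) x t - picard n x t) <= 2 * w t * ((/ 2) ^ n - (/ 2) ^ (n + m))).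
{ assert (0 <= (/ 2) ^ (n + m)) by (apply pow_le; lra).
  generalize (w_ge_1 t); nra. }
induction m as [|m IH].
- rewrite Nat.add_0_r, Rminus_diag, Rabs_R0; lra.
- rewrite Nat.add_succ_r.
  replace (picard (S (n + m)) x t - picard n x t) with
    ((picard (S (n + m)) x t - picard (n + m) x t) + (picard (n + m) x t - picard n x t))
    by ring.
  eapply Rle_trans; [apply Rabs_triang|].
  generalize (picard_step (n + m) x t); simpl ((/ 2) ^ S _); lra.
Qed.

Lemma pow_half_lt (c e : R) : 0 < e -> exists n, c * (/ 2) ^ n < e.
Proof.
intros e0.
assert (L : is_lim_seq (fun n => c * (/ 2) ^ n) 0).
{ replace (Finite 0) with (Rbar_mult c 0) by (simpl; f_equal; ring).
  apply is_lim_seq_scal_l, is_lim_seq_geom; rewrite Rabs_pos_eq; lra. }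
apply is_lim_seq_spec in L; destruct (L (mkposreal e e0)) as [n Hn].
exists n; specialize (Hn n (le_n n)); simpl in Hn.
rewrite Rminus_0_r in Hn; apply Rabs_lt_between in Hn; lra.
Qed.

Lemma picard_lim x t : is_lim_seq (fun n => picard n x t) (flow t x).
Proof.
apply Lim_seq_correct', ex_lim_seq_cauchy_corr; intros e.
destruct (pow_half_lt (4 * w t) e (cond_pos e)) as [N HN]; exists N.
assert (A : forall n, (N <= n)%nat -> Rabs (picard n x t - picard N x t) < e / 2).
{ intros n Hn; replace n with (N + (n - N))%nat by lia.
  eapply Rle_lt_trans; [apply picard_cauchy|lra]. }
intros n m Hn Hm.
replace (picard n x t - picard m x t) with
  ((picard n x t - picard N x t) - (picard m x t - picard N x t)) by ring.
eapply Rle_lt_trans; [apply Rabs_triang|]; rewrite Rabs_Ropp.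
generalize (A n Hn) (A m Hm) (cond_pos e); lra.
Qed.

Lemma flow_picard n x t : Rabs (flow t x - picard n x t) <= 2 * w t * (/ 2) ^ n.
Proof.
change (Rbar_le (Finite (Rabs (flow t x - picard n x t))) (Finite (2 * w t * (/ 2) ^ n))).
apply (is_lim_seq_le (fun m => Rabs (picard (n + m) x t - picard n x t))
         (fun _ => 2 * w t * (/ 2) ^ n)).
- intros m; apply picard_cauchy.
- apply (is_lim_seq_abs _ (flow t x - picard n x t)).
  apply is_lim_seq_minus'; [|apply is_lim_seq_const].
  apply (is_lim_seq_ext (fun m => picard (m + n) x t));
    [intros m; f_equal; lia|].
  apply (is_lim_seq_incr_n (fun m => picard m x t)), picard_lim.
- apply is_lim_seq_const.
Qed.

Lemma picard_lip n x t s : t <= s -> Rabs (picard n x s - picard n x t) <= M * (s - t).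
Proof.
intros ts; destruct n as [|n].
- simpl; rewrite Rminus_diag, Rabs_R0; nra.
- apply (derive_bound _ (fun u => f u (picard n x u))); [lra|].
  intros u _; split; [apply picard_S_derive|apply f_bound].
Qed.

Lemma flow_lip x t s : t <= s -> Rabs (flow s x - flow t x) <= M * (s - t).
Proof.
intros ts.
change (Rbar_le (Finite (Rabs (flow s x - flow t x))) (Finite (M * (s - t)))).
apply (is_lim_seq_le (fun m => Rabs (picard m x s - picard m x t)) (fun _ => M * (s - t))).
- intros m; apply picard_lip, ts.
- apply (is_lim_seq_abs _ (flow s x - flow t x)).
  apply is_lim_seq_minus'; apply picard_lim.
- apply is_lim_seq_const.
Qed.

Lemma flow_cont x t : continuous (fun t => flow t x) t.
Proof.
apply continuity_pt_filterlim; intros e e0.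
exists (e / M); split; [apply Rdiv_lt_0_compat; lra|].
intros s [_ Hs]; simpl in *; unfold Rdist in *.
apply Rle_lt_trans with (M * Rabs (s - t)).
- destruct (Rle_dec t s).
  + rewrite (Rabs_pos_eq (s - t)) by lra; apply flow_lip; lra.
  + rewrite Rabs_minus_sym, (Rabs_minus_sym s), (Rabs_pos_eq (t - s)) by lra.
    apply flow_lip; lra.
- apply Rmult_lt_reg_r with (/ M); [apply Rinv_0_lt_compat; lra|].
  replace (M * Rabs (s - t) * / M) with (Rabs (s - t)) by (field; lra); exact Hs.
Qed.

Lemma flow_integral x t : flow t x = x + RInt (fun s => f s (flow s x)) 0 t.
Proof.
set (g := fun t => x + RInt (fun s => f s (flow s x)) 0 t).
assert (Hg : forall s, is_derive g s (f s (flow s x))).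
{ intros s; apply (is_derive_cst_RInt0 x (fun s => f s (flow s x))), f_cont, flow_cont. }
assert (B : forall n, Rabs (g t - flow t x) <= 2 * w t * (/ 2) ^ n).
{ intros n.
  replace (g t - flow t x) with
    ((g t - picard (S n) x t) - (flow t x - picard (S n) x t)) by ring.
  eapply Rle_trans; [apply Rabs_triang|]; rewrite Rabs_Ropp.
  generalize (flow_picard (S n) x t); simpl ((/ 2) ^ S n).
  cut (Rabs (g t - picard (S n) x t) <= 2 * (/ 2) ^ n / 2 * w t); [lra|].
  apply (weighted_bound (fun t => g t - picard (S n) x t)
           (fun s => f s (flow s x) - f s (picard n x s))).
  - rewrite picard_0; unfold g; rewrite RInt_00; ring.
  - assert (0 <= (/ 2) ^ n) by (apply pow_le; lra); lra.
  - intros s; split.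
    + apply (is_derive_minus g (picard (S n) x)); [apply Hg|apply picard_S_derive].
    + eapply Rle_trans; [apply f_lip|]; apply Rmult_le_compat_l; [lra|].
      generalize (flow_picard n x s); lra. }
fold (g t); symmetry; apply Rminus_diag_uniq, Rabs_eq_0, Rle_antisym; [|apply Rabs_pos].
apply Rnot_lt_le; intros L.
destruct (pow_half_lt (2 * w t) _ L) as [n Hn]; specialize (B n); lra.
Qed.

Lemma flow_solves x : solves f (fun t => flow t x).
Proof.
intros t; apply (is_derive_ext (fun t => x + RInt (fun s => f s (flow s x)) 0 t)).
{ intros s; symmetry; apply flow_integral. }
apply (is_derive_cst_RInt0 x (fun s => f s (flow s x))), f_cont, flow_cont.
Qed.

Lemma flow_0 x : flow 0 x = x.
Proof. rewrite flow_integral, RInt_00; ring. Qed.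

End Picard.

(** * Linearization with quadratic error *)

Lemma taylor_quadratic (H H1 H2 : R -> R) (K x y : R) :
  (forall z, Rmin x y <= z <= Rmax x y ->
     is_derive H z (H1 z) /\ is_derive H1 z (H2 z) /\ Rabs (H2 z) <= K) ->
  Rabs (H x - H y - H1 y * (x - y)) <= K * (x - y) ^ 2.
Proof.
intros A.
assert (Pt : forall z, Rmin y x <= z <= Rmax y x -> Rmin x y <= z <= Rmax x y)
  by (intros z; rewrite (Rmin_comm y), (Rmax_comm y); easy).
destruct (MVT_gen H y x H1) as [c [Hc E]].
{ intros z Hz; apply A, Pt; lra. }
{ intros z Hz; apply continuity_pt_filterlim, (is_derive_continuous H z (H1 z)), A, Pt; lra. }
destruct (MVT_gen H1 y c H2) as [e [He F]].
{ intros z Hz; apply A.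
  unfold Rmin, Rmax in *; repeat destruct Rle_dec; lra. }
{ intros z Hz; apply continuity_pt_filterlim, (is_derive_continuous H1 z (H2 z)), A.
  unfold Rmin, Rmax in *; repeat destruct Rle_dec; lra. }
assert (B : Rabs (H2 e) <= K).
{ apply A; unfold Rmin, Rmax in *; repeat destruct Rle_dec; lra. }
rewrite E; replace (H1 c * (x - y) - H1 y * (x - y)) with (H2 e * ((c - y) * (x - y)))
  by (rewrite <- Rmult_assoc, <- F; ring).
rewrite Rabs_mult; apply Rmult_le_compat; [apply Rabs_pos|apply Rabs_pos|easy|].
rewrite Rabs_mult, <- pow2_abs; simpl; rewrite Rmult_1_r.
apply Rmult_le_compat_r; [apply Rabs_pos|].
unfold Rmin, Rmax in Hc; destruct (Rle_dec y x).
- rewrite !Rabs_pos_eq; lra.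
- rewrite !Rabs_left1; lra.
Qed.

(** The form in which differentiability is obtained below: a first order
    expansion with quadratic error. *)
Lemma is_derive_quadratic (f : R -> R) (y l d K : R) :
  0 < d -> (forall x, Rabs (x - y) < d ->
    Rabs (f x - f y - l * (x - y)) <= K * (x - y) ^ 2) -> is_derive f y l.
Proof.
intros d0 H; apply is_derive_Reals; intros e e0.
assert (K0 : 0 < Rabs K + 1) by (generalize (Rabs_pos K); lra).
assert (m0 : 0 < Rmin d (e / (Rabs K + 1)))
  by (apply Rmin_glb_lt; [lra|apply Rdiv_lt_0_compat; lra]).
exists (mkposreal _ m0); intros h h0 Hh; simpl in Hh.
assert (Hd : Rabs h < d) by (eapply Rlt_le_trans; [apply Hh|apply Rmin_l]).
assert (He : Rabs h < e / (Rabs K + 1)) by (eapply Rlt_le_trans; [apply Hh|apply Rmin_r]).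
assert (ah : 0 < Rabs h) by (apply Rabs_pos_lt, h0).
replace ((f (y + h) - f y) / h - l) with ((f (y + h) - f y - l * h) / h) by (field; easy).
unfold Rdiv; rewrite Rabs_mult, Rabs_inv.
apply Rmult_lt_reg_r with (Rabs h); [easy|].
rewrite Rmult_assoc, Rinv_l, Rmult_1_r by lra.
specialize (H (y + h)); replace (y + h - y) with h in H by ring.
eapply Rle_lt_trans; [apply H, Hd|].
rewrite <- pow2_abs; simpl; rewrite Rmult_1_r, <- Rmult_assoc.
apply Rmult_lt_compat_r; [easy|].
apply Rle_lt_trans with (Rabs K * Rabs h);
  [apply Rmult_le_compat_r; [lra|apply Rle_abs]|].
apply Rmult_lt_compat_l with (r := Rabs K + 1) in He; [|lra].
replace ((Rabs K + 1) * (e / (Rabs K + 1))) with e in He by (field; lra); lra.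
Qed.

Lemma abs_RInt_bound (g : R -> R) (K t s : R) :
  (forall u, continuous g u) -> 0 <= s <= t ->
  (forall u, 0 <= u <= t -> Rabs (g u) <= K) -> Rabs (RInt g 0 s) <= K * t.
Proof.
intros Hg Hs B.
assert (K0 : 0 <= K) by (generalize (B s Hs) (Rabs_pos (g s)); lra).
apply Rle_trans with (K * (s - 0)); [|apply Rmult_le_compat_l; lra].
replace (RInt g 0 s) with (RInt g 0 s - RInt g 0 0) by (rewrite RInt_00; ring).
apply (derive_bound (fun u => RInt g 0 u) g); [lra|].
intros u Hu; split; [apply is_derive_RInt0, Hg|apply B; lra].
Qed.

Lemma exp_le u v : u <= v -> exp u <= exp v.
Proof. intros [H|H]; [left; apply exp_increasing, H|right; f_equal; exact H]. Qed.

(** Variation of constants: [D] stays close to the solution of the linear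
    equation [x' = al x + g].  With [D] a difference of two solutions of a
    nonlinear equation, the error [Q] is quadratic, which gives derivatives
    with respect to initial values and parameters. *)
Lemma linear_perturbation (D dD al g : R -> R) (K Q t : R) :
  0 <= t -> (forall s, continuous al s) -> (forall s, continuous g s) ->
  (forall s, 0 <= s <= t ->
     is_derive D s (dD s) /\ Rabs (al s) <= K /\
     Rabs (dD s - al s * D s - g s) <= Q) ->
  Rabs (D t - exp (RInt al 0 t) *
          (D 0 + RInt (fun s => g s * exp (- RInt al 0 s)) 0 t))
    <= exp (2 * (K * t)) * (Q * t).
Proof.
intros t0 Hal Hg H.
set (A := fun s => RInt al 0 s).
assert (HA : forall s, is_derive A s (al s)) by (intros s; apply is_derive_RInt0, Hal).
set (G := fun s => g s * exp (- A s)).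
assert (HG : forall s, continuous G s).
{ intros s; apply (continuous_mult g); [apply Hg|].
  apply (continuous_comp (fun s => - A s) exp).
  - apply (continuous_opp A); eapply is_derive_continuous, HA.
  - eapply is_derive_continuous, is_derive_exp. }
assert (AK : forall s, 0 <= s <= t -> Rabs (A s) <= K * t).
{ intros s Hs; apply abs_RInt_bound; [easy|lra|intros; apply H; lra]. }
assert (Q0 : 0 <= Q).
{ generalize (proj2 (proj2 (H 0 (conj (Rle_refl 0) t0)))).
  generalize (Rabs_pos (dD 0 - al 0 * D 0 - g 0)); lra. }
assert (B := derive_bound (fun s => D s * exp (- A s) - RInt G 0 s)
  (fun s => exp (- A s) * (dD s - al s * D s - g s)) (exp (K * t) * Q) 0 t t0).
cbv beta in B.
assert (B' : Rabs (D t * exp (- A t) - RInt G 0 t - D 0) <= exp (K * t) * Q * t).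
{ replace (exp (K * t) * Q * t) with (exp (K * t) * Q * (t - 0)) by ring.
  replace (D 0) with (D 0 * exp (- A 0) - RInt G 0 0).
  2: { unfold A; rewrite !RInt_00, Ropp_0, exp_0; ring. }
  apply B; intros s Hs; destruct (H s Hs) as (HD & _ & Hr); split.
  - evar_last.
    + apply (is_derive_minus (fun s => D s * exp (- A s)) (fun s => RInt G 0 s));
        [|apply is_derive_RInt0, HG].
      apply (is_derive_mult D (fun s => exp (- A s))); [apply HD| |intros; apply Rmult_comm].
      apply (is_derive_comp exp (fun s => - A s)); [apply is_derive_exp|].
      apply (is_derive_opp A), HA.
    + unfold G; Rsimpl; ring.
  - apply Rabs_mult_le; [|easy].
    rewrite Rabs_pos_eq by apply exp_nonneg; apply exp_le.
    specialize (AK s Hs); apply Rabs_le_between in AK; lra. }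
replace (D t - exp (A t) * (D 0 + RInt G 0 t)) with
  (exp (A t) * (D t * exp (- A t) - RInt G 0 t - D 0)).
2: { rewrite exp_Ropp; field; apply Rgt_not_eq, exp_pos. }
rewrite Rabs_mult, Rabs_pos_eq by apply exp_nonneg.
replace (2 * (K * t)) with (K * t + K * t) by ring; rewrite exp_plus, Rmult_assoc.
apply Rmult_le_compat; [apply exp_nonneg|apply Rabs_pos| |lra].
apply exp_le; specialize (AK t (conj t0 (Rle_refl t))); apply Rabs_le_between in AK; lra.
Qed.

Lemma sin_taylor x y : Rabs (sin x - sin y - cos y * (x - y)) <= 1 * (x - y) ^ 2.
Proof.
apply (taylor_quadratic sin cos (fun z => - sin z)); intros z _; split; [|split].
- apply is_derive_sin.
- apply is_derive_cos.
- rewrite Rabs_Ropp; apply Rabs_sin_le.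
Qed.

Lemma cos_taylor x y : Rabs (cos x - cos y - (- sin y) * (x - y)) <= 1 * (x - y) ^ 2.
Proof.
apply (taylor_quadratic cos (fun z => - sin z) (fun z => - cos z)); intros z _; split; [|split].
- apply is_derive_cos.
- apply (is_derive_opp sin), is_derive_sin.
- rewrite Rabs_Ropp; apply Rabs_cos_le.
Qed.

Lemma sin_lip x y : Rabs (sin x - sin y) <= Rabs (x - y).
Proof.
destruct (MVT_gen sin y x cos) as [c [_ E]].
- intros; apply is_derive_sin.
- intros; apply continuity_sin.
- rewrite E, Rabs_mult; rewrite <- (Rmult_1_l (Rabs (x - y))) at 2.
  apply Rmult_le_compat_r; [apply Rabs_pos|apply Rabs_cos_le].
Qed.

(** * The angle equation and its return map *)

Lemma sin_2PI_shift x k : sin (x + IZR k * (2 * PI)) = sin x.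
Proof.
assert (N : forall n x, sin (x + INR n * (2 * PI)) = sin x)
  by (intros n z; rewrite <- (sin_period z n); f_equal; ring).
destruct (Z.le_ge_cases 0 k) as [L|L].
- rewrite <- (Z2Nat.id k L), <- INR_IZR_INZ; apply N.
- rewrite <- (N (Z.to_nat (- k)) (x + IZR k * (2 * PI))); f_equal.
  rewrite INR_IZR_INZ, Z2Nat.id by lia; rewrite opp_IZR; ring.
Qed.

(** With [l' = B cos p] and [m' = B cos q], the exponential exactly cancels the
    growth of the chord, because [sin p - sin q] and [cos p + cos q] share the
    factor [cos ((p + q) / 2)]. *)
Lemma chord_derive (A B : R) (p q l m : R -> R) (s : R) :
  is_derive p s (A + B * sin (p s)) -> is_derive q s (A + B * sin (q s)) ->
  is_derive l s (B * cos (p s)) -> is_derive m s (B * cos (q s)) ->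
  is_derive (fun t => sin ((p t - q t) / 2) * exp (- ((l t + m t) / 2))) s 0.
Proof.
intros Hp Hq Hl Hm; evar_last.
- apply (is_derive_mult (fun t => sin ((p t - q t) / 2))
           (fun t => exp (- ((l t + m t) / 2)))); [| |intros; apply Rmult_comm].
  + apply (is_derive_comp sin (fun t => (p t - q t) / 2)); [apply is_derive_sin|].
    apply (is_derive_ext (fun t => / 2 * (p t - q t)));
      [intros t; unfold Rdiv; apply Rmult_comm|].
    apply is_derive_scal, (is_derive_minus p q); [apply Hp|apply Hq].
  + apply (is_derive_comp exp (fun t => - ((l t + m t) / 2))); [apply is_derive_exp|].
    apply (is_derive_ext (fun t => - / 2 * (l t + m t)));
      [intros t; unfold Rdiv; rewrite <- Ropp_mult_distr_l, Rmult_comm; easy|].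
    apply is_derive_scal, (is_derive_plus l m); [apply Hl|apply Hm].
- set (P := p s); set (Q := q s).
  match goal with |- context [exp ?z] => set (e := exp z) end.
  replace (sin P) with (sin ((P + Q) / 2 + (P - Q) / 2)) by (f_equal; field).
  replace (sin Q) with (sin ((P + Q) / 2 - (P - Q) / 2)) by (f_equal; field).
  replace (cos P) with (cos ((P + Q) / 2 + (P - Q) / 2)) by (f_equal; field).
  replace (cos Q) with (cos ((P + Q) / 2 - (P - Q) / 2)) by (f_equal; field).
  rewrite sin_plus, sin_minus, cos_plus, cos_minus.
  generalize (sin ((P + Q) / 2)) (cos ((P + Q) / 2)) (sin ((P - Q) / 2)) (cos ((P - Q) / 2)).
  clearbody e; intros; Rsimpl; field.
Qed.

Section AngleEquation.

Variables (a b : R -> R) (M T : R).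
Hypothesis a_cont : forall t, continuous a t.
Hypothesis b_cont : forall t, continuous b t.
Hypothesis M0 : 0 < M.
Hypothesis ab_bound : forall t, Rabs (a t) + Rabs (b t) <= M.
Hypothesis T0 : 0 < T.
Hypothesis a_per : forall t, a (t + T) = a t.
Hypothesis b_per : forall t, b (t + T) = b t.

Definition angle_eq (a b : R -> R) (t x : R) : R := a t + b t * sin x.

Let f := angle_eq a b.

Lemma angle_eq_cont (phi : R -> R) : (forall t, continuous phi t) ->
  forall t, continuous (fun s => f s (phi s)) t.
Proof.
intros H t; apply (continuous_plus a); [apply a_cont|].
apply (continuous_mult b); [apply b_cont|].
apply (continuous_comp phi sin); [apply H|].
eapply is_derive_continuous, is_derive_sin.
Qed.

Lemma angle_eq_bound t x : Rabs (f t x) <= M.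
Proof.
eapply Rle_trans; [|apply (ab_bound t)]; eapply Rle_trans; [apply Rabs_triang|].
apply Rplus_le_compat_l, Rabs_mult_le1; [apply Rle_refl|apply Rabs_sin_le].
Qed.

Lemma b_bound t : Rabs (b t) <= M.
Proof. generalize (ab_bound t) (Rabs_pos (a t)); lra. Qed.

Lemma angle_eq_lip t x y : Rabs (f t x - f t y) <= M * Rabs (x - y).
Proof.
unfold f, angle_eq; replace (a t + b t * sin x - (a t + b t * sin y))
  with (b t * (sin x - sin y)) by ring.
apply Rabs_mult_le; [apply b_bound|apply sin_lip].
Qed.

Definition aflow : R -> R -> R := flow (angle_eq a b).
Definition ret (x : R) : R := aflow T x.

Lemma aflow_solves x : solves f (fun t => aflow t x).
Proof.
apply (flow_solves f M M0 angle_eq_cont angle_eq_bound angle_eq_lip).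
Qed.

Lemma aflow_0 x : aflow 0 x = x.
Proof. apply (flow_0 f M M0 angle_eq_cont angle_eq_bound angle_eq_lip). Qed.

Lemma aflow_cont x t : continuous (fun t => aflow t x) t.
Proof. eapply solves_continuous, aflow_solves. Qed.

Lemma aflow_unique phi : solves f phi -> forall t, phi t = aflow t (phi 0).
Proof.
intros H; apply (solves_unique f M _ _ 0 angle_eq_lip H (aflow_solves _)).
rewrite aflow_0; easy.
Qed.

Lemma aflow_lt x y t : x < y -> aflow t x < aflow t y.
Proof.
intros L; apply (solves_lt f M (fun t => aflow t x) (fun t => aflow t y) 0);
  try apply aflow_solves; [apply angle_eq_lip|rewrite !aflow_0; easy].
Qed.

Lemma solves_translate phi k : solves f phi ->
  solves f (fun t => phi (t + T) + IZR k * (2 * PI)).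
Proof.
intros H t; unfold f, angle_eq; rewrite sin_2PI_shift, <- a_per, <- b_per.
evar_last.
- apply (is_derive_plus (fun t => phi (t + T)) (fun _ => IZR k * (2 * PI)));
    [|apply is_derive_Rconst].
  apply (is_derive_comp phi (fun t => t + T)); [apply H|].
  auto_derive; [easy|reflexivity].
- unfold f, angle_eq; Rsimpl; ring.
Qed.

Lemma aflow_shift t x k :
  aflow (t + T) x + IZR k * (2 * PI) = aflow t (ret x + IZR k * (2 * PI)).
Proof.
rewrite (aflow_unique _ (solves_translate _ k (aflow_solves x))).
unfold ret; rewrite Rplus_0_l; easy.
Qed.

Lemma aflow_2PI t x k : aflow t (x + IZR k * (2 * PI)) = aflow t x + IZR k * (2 * PI).
Proof.
symmetry; assert (H : solves f (fun t => aflow t x + IZR k * (2 * PI))).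
{ intros s; unfold f, angle_eq; rewrite sin_2PI_shift; evar_last.
  - apply (is_derive_plus (fun t => aflow t x) (fun _ => IZR k * (2 * PI)));
      [apply aflow_solves|apply is_derive_Rconst].
  - unfold f, angle_eq; Rsimpl; ring. }
rewrite (aflow_unique _ H), aflow_0; easy.
Qed.

Lemma aflow_period t x : aflow (t + T) x = aflow t (ret x).
Proof. generalize (aflow_shift t x 0); rewrite !Rmult_0_l, !Rplus_0_r; easy. Qed.

Lemma aflow_iter n t x : aflow (t + INR n * T) x = aflow t (Nat.iter n ret x).
Proof.
revert t; induction n as [|n IH]; intros t; [simpl; f_equal; ring|].
rewrite S_INR; replace (t + (INR n + 1) * T) with (t + T + INR n * T) by ring.
rewrite IH, aflow_period; easy.
Qed.

Lemma ret_2PI x k : ret (x + IZR k * (2 * PI)) = ret x + IZR k * (2 * PI).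
Proof. apply aflow_2PI. Qed.

Lemma ret_lt x y : x < y -> ret x < ret y.
Proof. apply aflow_lt. Qed.

(** With [x = tan (phi / 2)] the equation becomes a Riccati equation, so that
    [ret] acts on the circle as a homography; [logmult] is the logarithm of
    the derivative of the flow in the initial angle, and [sin_half_flow] is the formula for the chord between
    two images under a homography. *)
Definition logmult (t x : R) : R := RInt (fun s => b s * cos (aflow s x)) 0 t.

Lemma bcos_cont x t : continuous (fun s => b s * cos (aflow s x)) t.
Proof.
apply (continuous_mult b); [apply b_cont|].
apply (continuous_comp (fun s => aflow s x) cos); [apply aflow_cont|].
eapply is_derive_continuous, is_derive_cos.
Qed.

Lemma logmult_derive t x : is_derive (fun t => logmult t x) t (b t * cos (aflow t x)).
Proof. apply (is_derive_RInt0 (fun s => b s * cos (aflow s x))), bcos_cont. Qed.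

Lemma logmult_0 x : logmult 0 x = 0.
Proof. apply RInt_00. Qed.

Lemma sin_half_flow t x y :
  sin ((aflow t x - aflow t y) / 2) =
  sin ((x - y) / 2) * exp ((logmult t x + logmult t y) / 2).
Proof.
set (h := fun t => sin ((aflow t x - aflow t y) / 2)
                   * exp (- ((logmult t x + logmult t y) / 2))).
assert (E : h t = h 0).
{ apply derive_zero_eq; intros s; unfold h.
  apply (chord_derive (a s) (b s)); try apply aflow_solves; apply logmult_derive. }
unfold h in E; rewrite !aflow_0, !logmult_0 in E.
replace (- ((0 + 0) / 2)) with 0 in E by field; rewrite exp_0, Rmult_1_r in E.
rewrite <- E, Rmult_assoc, <- exp_plus.
replace (- _ + _) with 0 by ring; rewrite exp_0; ring.
Qed.

Lemma aflow_close t x y : 0 <= t ->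
  (aflow t x - aflow t y) ^ 2 <= (x - y) ^ 2 * exp ((2 * M + 1) * t).
Proof.
intros t0.
assert (G := gronwall (fun s => aflow s x - aflow s y)
  (fun s => f s (aflow s x) - f s (aflow s y)) M 0 t t0 (Rlt_le _ _ M0)).
cbv beta in G; rewrite !aflow_0 in G.
replace (0 ^ 2) with 0 in G by ring; rewrite !Rplus_0_r in G; apply G.
intros s _; split.
- apply (is_derive_minus (fun s => aflow s x) (fun s => aflow s y)); apply aflow_solves.
- rewrite Rplus_0_r; apply angle_eq_lip.
Qed.

Lemma ret_derive y : is_derive ret y (exp (logmult T y)).
Proof.
apply (is_derive_quadratic _ _ _ 1
  (exp (2 * (M * T)) * (M * exp ((2 * M + 1) * T) * T))); [lra|].
intros x _.
set (Q := M * exp ((2 * M + 1) * T)).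
assert (L := linear_perturbation (fun s => aflow s x - aflow s y)
  (fun s => f s (aflow s x) - f s (aflow s y)) (fun s => b s * cos (aflow s y))
  (fun _ => 0) M (Q * (x - y) ^ 2) T (Rlt_le _ _ T0) (bcos_cont y)).
cbv beta in L.
replace (RInt (fun s => 0 * _) 0 T) with 0 in L.
2: { symmetry; rewrite (RInt_ext _ (fun _ => 0)) by (intros; apply Rmult_0_l).
     rewrite RInt_const; Rsimpl; ring. }
rewrite !aflow_0, Rplus_0_r in L; fold (logmult T y) in L; unfold ret.
eapply Rle_trans; [apply L|].
- intros; apply continuous_const.
- intros s Hs; split; [|split].
  + apply (is_derive_minus (fun s => aflow s x) (fun s => aflow s y)); apply aflow_solves.
  + apply Rabs_mult_le1; [apply b_bound|apply Rabs_cos_le].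
  + unfold f, angle_eq; match goal with |- Rabs ?z <= _ => replace z with
      (b s * (sin (aflow s x) - sin (aflow s y) - cos (aflow s y) * (aflow s x - aflow s y)))
      by ring end.
    unfold Q; rewrite Rmult_assoc; apply Rabs_mult_le; [apply b_bound|].
    eapply Rle_trans; [apply sin_taylor|]; rewrite Rmult_1_l.
    eapply Rle_trans; [apply aflow_close; lra|]; rewrite Rmult_comm.
    apply Rmult_le_compat_r; [apply pow2_ge_0|]; apply exp_le.
    apply Rmult_le_compat_l; lra.
- right; ring.
Qed.

(** * Fixed points of the return map *)

Lemma ret_between x1 x : ret x1 = x1 -> x1 <= x < x1 + 2 * PI ->
  x1 <= ret x < x1 + 2 * PI.
Proof.
intros F [[L|E] U].
- split; [left; rewrite <- F; apply ret_lt, L|].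
  apply ret_lt in U; rewrite <- (Rmult_1_l (2 * PI)), ret_2PI, F in U; lra.
- rewrite <- E, F; generalize PI_RGT_0; lra.
Qed.

Lemma mod_2PI x1 x :
  exists k x', x = x' + IZR k * (2 * PI) /\ x1 <= x' < x1 + 2 * PI.
Proof.
assert (P := PI_RGT_0).
set (r := (x - x1) / (2 * PI)); exists (Int_part r), (x - IZR (Int_part r) * (2 * PI)).
split; [ring|]; destruct (base_Int_part r) as [A B].
assert (E : x = x1 + r * (2 * PI)) by (unfold r; field; lra).
rewrite E at 1 2; nra.
Qed.

Lemma chord_pos u v : u < v < u + 2 * PI -> sin ((u - v) / 2) <> 0.
Proof.
intros H; assert (0 < sin ((v - u) / 2)) by (apply sin_gt_0; lra).
replace ((u - v) / 2) with (- ((v - u) / 2)) by field; rewrite sin_neg; lra.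
Qed.

(** The chord between two fixed points is preserved, so their multipliers are
    inverse to each other. *)
Lemma logmult_opp x y : ret x = x -> ret y = y -> x < y < x + 2 * PI ->
  logmult T x + logmult T y = 0.
Proof.
intros Fx Fy H; generalize (sin_half_flow T x y) (chord_pos x y H).
fold (ret x) (ret y); rewrite Fx, Fy; intros E N.
assert (E1 : exp ((logmult T x + logmult T y) / 2) = exp 0).
{ rewrite exp_0; apply Rmult_eq_reg_l with (sin ((x - y) / 2)); [lra|easy]. }
apply exp_inv in E1; lra.
Qed.

(** A homography with a fixed point of multiplier 1 and a second fixed point
    is the identity. *)
Lemma ret_rigid x1 x2 : ret x1 = x1 -> logmult T x1 = 0 -> ret x2 = x2 ->
  x1 < x2 < x1 + 2 * PI -> forall x, ret x = x.
Proof.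
intros F1 L1 F2 H x.
assert (L2 : logmult T x2 = 0) by (generalize (logmult_opp x1 x2 F1 F2 H); lra).
assert (W : forall y, x1 <= y < x1 + 2 * PI -> ret y = y).
{ intros y Hy.
  generalize (sin_half_flow T y x1) (sin_half_flow T y x2) (chord_pos x1 x2 H).
  fold (ret y) (ret x1) (ret x2); rewrite F1, F2, L1, L2, Rplus_0_r.
  set (e := exp _); set (A := (ret y - x1) / 2); set (B := (y - x1) / 2).
  set (d := (x1 - x2) / 2).
  replace ((ret y - x2) / 2) with (A + d) by (unfold A, d; field).
  replace ((y - x2) / 2) with (B + d) by (unfold B, d; field).
  rewrite !sin_plus; intros E1 E2 N.
  assert (E3 : cos A = e * cos B).
  { apply Rmult_eq_reg_r with (sin d); [|easy].
    rewrite E1 in E2; lra. }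
  assert (Z : sin (A - B) = 0) by (rewrite sin_minus, E1, E3; ring).
  assert (R := ret_between x1 y F1 Hy).
  destruct (Rtotal_order (A - B) 0) as [N1|[N1|N1]].
  - assert (sin (- (A - B)) > 0) by (apply sin_gt_0; unfold A, B in *; lra).
    rewrite sin_neg in *; lra.
  - unfold A, B in N1; lra.
  - assert (sin (A - B) > 0) by (apply sin_gt_0; unfold A, B in *; lra); lra. }
destruct (mod_2PI x1 x) as (k & y & -> & Hy).
rewrite ret_2PI, W; easy.
Qed.

(** Three fixed points would have pairwise inverse multipliers, hence all
    multipliers equal to 1. *)
Lemma fixed_points_two x1 x2 x : ret x1 = x1 -> ret x2 = x2 ->
  x1 < x2 < x1 + 2 * PI -> logmult T x1 <> 0 -> ret x = x ->
  exists k, x = x1 + IZR k * (2 * PI) \/ x = x2 + IZR k * (2 * PI).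
Proof.
intros F1 F2 H L Fx.
destruct (mod_2PI x1 x) as (k & y & -> & Hy); exists k.
assert (Fy : ret y = y) by (rewrite ret_2PI in Fx; lra).
destruct (Req_dec y x1) as [->|N1]; [auto|].
destruct (Req_dec y x2) as [->|N2]; [auto|exfalso; apply L].
assert (E1 := logmult_opp x1 x2 F1 F2 H).
assert (E2 := logmult_opp x1 y F1 Fy ltac:(lra)).
destruct (Rlt_or_le x2 y).
- assert (E3 := logmult_opp x2 y F2 Fy ltac:(lra)); lra.
- assert (E3 := logmult_opp y x2 Fy F2 ltac:(lra)); lra.
Qed.

Lemma fixed_points_one x1 z x : ret x1 = x1 -> logmult T x1 = 0 -> ret z <> z ->
  ret x = x -> exists k, x = x1 + IZR k * (2 * PI).
Proof.
intros F1 L1 Nz Fx.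
destruct (mod_2PI x1 x) as (k & y & -> & Hy); exists k.
destruct (Req_dec y x1) as [->|N1]; [easy|exfalso; apply Nz].
apply (ret_rigid x1 y); trivial; [rewrite ret_2PI in Fx|]; lra.
Qed.

Lemma iter_ret_2PI n x k :
  Nat.iter n ret (x + IZR k * (2 * PI)) = Nat.iter n ret x + IZR k * (2 * PI).
Proof. induction n as [|n IH]; simpl; [easy|rewrite IH; apply ret_2PI]. Qed.

(** Used with both orders: under a monotone map an orbit keeps moving in the
    direction of its first step. *)
Lemma iter_ret_inv (lt : R -> R -> Prop) y n :
  (forall u v w, lt u v -> lt v w -> lt u w) ->
  (forall u v, lt u v -> lt (ret u) (ret v)) ->
  lt y (ret y) -> lt y (Nat.iter (S n) ret y).
Proof.
intros Tr Mo H; induction n as [|n IH]; [easy|].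
apply (Tr _ _ _ H), Mo, IH.
Qed.

(** A monotone circle map with a fixed point has rotation number zero, and
    then each orbit is monotone. *)
Lemma periodic_fixed x1 x n q : ret x1 = x1 -> (0 < n)%nat ->
  Nat.iter n ret x = x + IZR q * (2 * PI) -> ret x = x.
Proof.
intros F1 Hn; destruct n as [|n]; [lia|clear Hn].
destruct (mod_2PI x1 x) as (k & y & -> & Hy).
rewrite iter_ret_2PI, ret_2PI; intros E.
assert (B : forall m, x1 <= Nat.iter m ret y < x1 + 2 * PI).
{ induction m as [|m IH]; [easy|apply ret_between; easy]. }
assert (q0 : q = 0%Z).
{ assert (P := PI_RGT_0); specialize (B (S n)).
  assert (Eq : IZR q * (2 * PI) = Nat.iter (S n) ret y - y) by lra.
  assert (-1 < IZR q < 1) by nra.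
  assert ((-1 < q)%Z) by (apply lt_IZR; lra).
  assert ((q < 1)%Z) by (apply lt_IZR; lra); lia. }
rewrite q0 in E.
destruct (Rtotal_order (ret y) y) as [L|[L|L]]; [|lra|].
- assert (Nat.iter (S n) ret y < y); [|lra].
  apply (iter_ret_inv (fun u v => v < u)); trivial; intros; [lra|apply ret_lt; easy].
- assert (y < Nat.iter (S n) ret y); [|lra].
  apply (iter_ret_inv Rlt); trivial; intros; [lra|apply ret_lt; easy].
Qed.

(** The chord formula with the second point fixed expresses the derivative of
    [ret], and hence its second derivative, through [ret] itself. *)
Lemma ret_double x1 : ret x1 = x1 -> logmult T x1 = 0 -> ret (x1 + PI) <> x1 + PI ->
  ex_derive_n ret 2 x1 /\ Derive_n ret 2 x1 <> 0.
Proof.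
intros F1 L1 N.
(* with this reference point [sin ((x - y0) / 2)] is stationary at [x1], equal to -1 *)
set (y0 := x1 + PI) in *; set (S := exp (logmult T y0 / 2)).
assert (S0 : 0 < S) by apply exp_pos.
set (g := fun x => sin ((ret x - ret y0) / 2) / (sin ((x - y0) / 2) * S)).
assert (P := PI_RGT_0).
assert (Hx : sin ((x1 - y0) / 2) = -1).
{ replace ((x1 - y0) / 2) with (- (PI / 2)) by (unfold y0; field).
  rewrite sin_neg, sin_PI2; ring. }
assert (Hg : locally x1 (fun x => g x ^ 2 = Derive ret x)).
{ assert (d0 : 0 < PI) by easy; exists (mkposreal PI d0); intros x Bx.
  assert (B : Rabs (x - x1) < PI) by exact Bx; apply Rabs_lt_between in B.
  assert (C : sin ((x - y0) / 2) <> 0) by (apply chord_pos; unfold y0; lra).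
  rewrite (is_derive_unique _ _ _ (ret_derive x)); unfold g.
  generalize (sin_half_flow T x y0); fold (ret x) (ret y0); intros ->.
  replace (logmult T x) with (logmult T x / 2 + logmult T x / 2) at 2 by field.
  replace ((logmult T x + logmult T y0) / 2) with (logmult T x / 2 + logmult T y0 / 2)
    by field.
  rewrite !exp_plus; fold S; field; lra. }
set (l := - (cos ((x1 - ret y0) / 2) / (2 * S))).
assert (Dg : is_derive g x1 l).
{ unfold g; auto_derive.
  - repeat match goal with |- _ /\ _ => split end; try exact I;
      [eexists; apply ret_derive|replace ((x1 + - y0) * / 2) with ((x1 - y0) / 2) by easy; rewrite Hx; lra].
  - replace ((x1 + - y0) * / 2) with ((x1 - y0) / 2) by easy.
    replace ((ret x1 + - ret y0) * / 2) with ((ret x1 - ret y0) / 2) by easy.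
    rewrite Hx; change (fun x => ret x) with ret.
    rewrite (is_derive_unique _ _ _ (ret_derive x1)), L1, exp_0, F1.
    replace (cos ((x1 - y0) / 2)) with 0.
    2: { replace ((x1 - y0) / 2) with (- (PI / 2)) by (unfold y0; field).
         rewrite cos_neg, cos_PI2; easy. }
    unfold l; field; lra. }
assert (g2 : g x1 ^ 2 = 1).
{ rewrite (locally_singleton _ _ Hg), (is_derive_unique _ _ _ (ret_derive x1)), L1.
  apply exp_0. }
assert (D2 : is_derive (Derive ret) x1 (2 * g x1 * l)).
{ apply (is_derive_ext_loc _ _ _ _ Hg); evar_last; [apply is_derive_pow, Dg|].
  simpl; ring. }
split; [exists (2 * g x1 * l); exact D2|].
change (Derive (Derive ret) x1 <> 0); rewrite (is_derive_unique _ _ _ D2).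
assert (y1 : x1 <= ret y0 < x1 + 2 * PI)
  by (apply ret_between; [easy|unfold y0; lra]).
assert (g0 : g x1 <> 0) by (intros Z; rewrite Z in g2; lra).
intros Z; apply Rmult_integral in Z; destruct Z as [Z|Z]; [lra|].
assert (C : cos ((x1 - ret y0) / 2) = 0).
{ unfold l in Z; apply Rmult_eq_reg_r with (/ (2 * S)); [unfold Rdiv in Z; lra|].
  apply Rinv_neq_0_compat; lra. }
replace ((x1 - ret y0) / 2) with (- ((ret y0 - x1) / 2)) in C by field.
rewrite cos_neg in C.
apply N; destruct (Rtotal_order ((ret y0 - x1) / 2) (PI / 2)) as [U|[U|U]].
(* the only chord through [x1] with vanishing cosine is the diameter *)
- assert (0 < cos ((ret y0 - x1) / 2)) by (apply cos_gt_0; lra); lra.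
- unfold y0 at 2; lra.
- assert (cos ((ret y0 - x1) / 2) < 0) by (apply cos_lt_0; lra); lra.
Qed.

(** * Reversibility *)

Hypothesis a_even : forall t, a (- t) = a t.
Hypothesis b_even : forall t, b (- t) = b t.

(** The coefficients are even about [T / 2], so reversing time there, together
    with a reflection of the angle that preserves sines, maps solutions to
    solutions. *)
Lemma solves_reverse phi c : (forall x, sin (c - x) = sin x) -> solves f phi ->
  solves f (fun t => c - phi (T - t)).
Proof.
intros Hc H t.
assert (Ea : a (T - t) = a t) by (rewrite <- a_even, <- a_per; f_equal; ring).
assert (Eb : b (T - t) = b t) by (rewrite <- b_even, <- b_per; f_equal; ring).
evar_last.
- apply (is_derive_minus (fun _ => c) (fun t => phi (T - t)));
    [apply is_derive_Rconst|].
  apply (is_derive_comp phi (fun t => T - t)); [apply H|].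
  auto_derive; [easy|reflexivity].
- unfold f, angle_eq; rewrite Hc, Ea, Eb; Rsimpl; ring.
Qed.

Lemma ret_reflect c x : (forall x, sin (c - x) = sin x) -> ret x = x ->
  ret (c - x) = c - x.
Proof.
intros Hc F; unfold ret.
assert (E := aflow_unique _ (solves_reverse _ c Hc (aflow_solves x)) T).
cbv beta in E; rewrite Rminus_0_r, Rminus_diag, aflow_0 in E.
fold (ret x) in E; rewrite F in E; symmetry; exact E.
Qed.

Lemma aflow_half_rev c x :
  T - T / 2 = T / 2 /\ c - aflow (T - T / 2) x = c - aflow (T / 2) x.
Proof. replace (T - T / 2) with (T / 2) by field; easy. Qed.

(** If the solution from a fixed angle [x] of the reflection is below [x] after
    half a period, its reversed copy lies above it there, hence everywhere. *)
Lemma ret_lt_half x : (forall y, sin (2 * x - y) = sin y) ->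
  aflow (T / 2) x < x -> ret x < x.
Proof.
intros Hc H; unfold ret.
assert (L := solves_lt f M (fun t => aflow t x) (fun t => 2 * x - aflow (T - t) x) (T / 2)
  angle_eq_lip (aflow_solves x) (solves_reverse _ _ Hc (aflow_solves x))).
cbv beta in L; rewrite (proj2 (aflow_half_rev _ _)) in L.
specialize (L ltac:(lra) 0); rewrite aflow_0, Rminus_0_r in L; lra.
Qed.

Lemma ret_gt_half x : (forall y, sin (2 * x - y) = sin y) ->
  x < aflow (T / 2) x -> x < ret x.
Proof.
intros Hc H; unfold ret.
assert (L := solves_lt f M (fun t => 2 * x - aflow (T - t) x) (fun t => aflow t x) (T / 2)
  angle_eq_lip (solves_reverse _ _ Hc (aflow_solves x)) (aflow_solves x)).
cbv beta in L; rewrite (proj2 (aflow_half_rev _ _)) in L.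
specialize (L ltac:(lra) 0); rewrite aflow_0, Rminus_0_r in L; lra.
Qed.

(** On a symmetric closed solution, [b cos phi] is odd about [T / 2]. *)
Lemma ret_eq_half x : (forall y, sin (2 * x - y) = sin y) ->
  (forall y, cos (2 * x - y) = - cos y) ->
  aflow (T / 2) x = x -> ret x = x /\ logmult T x = 0.
Proof.
intros Hs Hc H.
assert (E : forall t, 2 * x - aflow (T - t) x = aflow t x).
{ apply (solves_unique f M _ _ (T / 2) angle_eq_lip
    (solves_reverse _ _ Hs (aflow_solves x)) (aflow_solves x)).
  rewrite (proj2 (aflow_half_rev _ _)); lra. }
split.
- generalize (E 0); rewrite aflow_0, Rminus_0_r; fold (ret x); lra.
- set (J := fun t => logmult (T - t) x - logmult t x).
  assert (EJ : J 0 = J (T / 2)).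
  { apply derive_zero_eq; intros s; evar_last.
    - apply (is_derive_minus (fun t => logmult (T - t) x) (fun t => logmult t x));
        [|apply logmult_derive].
      apply (is_derive_comp (fun t => logmult t x) (fun t => T - t));
        [apply logmult_derive|auto_derive; [easy|reflexivity]].
    - replace (b (T - s)) with (b s) by (rewrite <- b_even, <- b_per; f_equal; ring).
      rewrite <- (E s), Hc; Rsimpl; ring. }
  unfold J in EJ; rewrite (proj1 (aflow_half_rev 0 x)), logmult_0, !Rminus_0_r in EJ; lra.
Qed.

(** * Principal cycles of a surface whose leaves solve the angle equation *)

Variable X : R -> R -> vec.
Hypothesis leaf_iff : forall phi, leaf X phi <-> solves f phi.

Lemma is_flow_aflow : is_flow X aflow.
Proof.
intros x; split; [apply leaf_iff, aflow_solves|split; [apply aflow_0|]].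
intros phi H <-; apply aflow_unique, leaf_iff, H.
Qed.

Lemma is_return_map_ret : is_return_map T X ret.
Proof. exists aflow; split; [apply is_flow_aflow|easy]. Qed.

Lemma cycle_of_fixed x : ret x = x -> principal_cycle T X (fun t => aflow t x).
Proof.
intros F; split; [apply leaf_iff, aflow_solves|].
exists 1%nat, 0%Z; split; [lia|]; intros t; simpl INR.
rewrite Rmult_1_l, aflow_period, F; ring.
Qed.

Lemma fixed_of_cycle x1 psi : ret x1 = x1 -> principal_cycle T X psi ->
  ret (psi 0) = psi 0.
Proof.
intros F [L (p & q & Hp & E)].
apply leaf_iff in L; assert (U := aflow_unique psi L).
apply (periodic_fixed x1 _ p q F Hp).
specialize (E 0); rewrite U, Rplus_0_l in E.
rewrite <- (Rplus_0_l (INR p * T)), aflow_iter, aflow_0 in E; exact E.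
Qed.

Lemma same_leaf_of_start x k psi : leaf X psi -> psi 0 = x + IZR k * (2 * PI) ->
  same_leaf T (fun t => aflow t x) psi.
Proof.
intros L E; exists 0%Z, k; intros t.
rewrite (aflow_unique psi (proj1 (leaf_iff _) L)), E, aflow_2PI, Rmult_0_l, Rplus_0_r.
easy.
Qed.

Lemma aflow_fixed_periodic x m t : ret x = x -> aflow (t + IZR m * T) x = aflow t x.
Proof.
intros F.
assert (N : forall n t, aflow (t + INR n * T) x = aflow t x).
{ induction n as [|n IH]; intros u; [simpl; f_equal; ring|].
  rewrite S_INR; replace (u + (INR n + 1) * T) with (u + INR n * T + T) by ring.
  rewrite aflow_period, F; apply IH. }
destruct (Z.le_ge_cases 0 m) as [L|L].
- rewrite <- (Z2Nat.id m L), <- INR_IZR_INZ; apply N.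
- rewrite <- (N (Z.to_nat (- m)) (t + IZR m * T)); f_equal.
  rewrite INR_IZR_INZ, Z2Nat.id by lia; rewrite opp_IZR; ring.
Qed.

Lemma hyperbolic_of_fixed x : ret x = x -> logmult T x <> 0 ->
  hyperbolic_cycle T X (fun t => aflow t x).
Proof.
intros F L; split; [apply cycle_of_fixed, F|].
exists ret; rewrite aflow_0; split; [apply is_return_map_ret|split; [easy|]].
assert (D := ret_derive x); split; [eexists; apply D|].
rewrite (is_derive_unique _ _ _ D), <- exp_0; intros E; apply L, exp_inv, E.
Qed.

Lemma sin_reflect_half_PI s : s = 1 \/ s = -1 -> let c := 2 * (s * (PI / 2)) in
  (forall y, sin (c - y) = sin y) /\ (forall y, cos (c - y) = - cos y).
Proof.
assert (S : forall y, sin (PI - y) = sin y) by (intros; apply sin_PI_x).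
assert (C : forall y, cos (PI - y) = - cos y)
  by (intros; rewrite Rtrigo_facts.cos_pi_minus; easy).
intros [-> | ->]; split; intros y.
- rewrite <- S; f_equal; field.
- rewrite <- C; f_equal; field.
- replace (2 * (-1 * (PI / 2)) - y) with (- (PI + y)) by field.
  rewrite sin_neg, Rplus_comm, neg_sin; ring.
- replace (2 * (-1 * (PI / 2)) - y) with (- (PI + y)) by field.
  rewrite cos_neg, Rplus_comm, neg_cos; ring.
Qed.

(** The two displacements have opposite signs, so a fixed point lies between
    [- PI / 2] and [PI / 2]; its mirror image is the second one.  Neither has
    multiplier 1, since [ret] is not the identity. *)
Lemma two_hyperbolic_of_half_turn :
  aflow (T / 2) (- (PI / 2)) < - (PI / 2) -> PI / 2 < aflow (T / 2) (PI / 2) ->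
  has_two_hyperbolic_cycles T X.
Proof.
intros Hm Hp; assert (P := PI_RGT_0).
destruct (sin_reflect_half_PI (-1)) as [Sm _]; [auto|].
destruct (sin_reflect_half_PI 1) as [Sp _]; [auto|].
assert (Rm : ret (- (PI / 2)) < - (PI / 2)).
{ apply ret_lt_half; [|easy]; intros y; rewrite <- (Sm y); f_equal; ring. }
assert (Rp : PI / 2 < ret (PI / 2)).
{ apply ret_gt_half; [|easy]; intros y; rewrite <- (Sp y); f_equal; ring. }
destruct (IVT_gen (fun x => ret x - x) (- (PI / 2)) (PI / 2) 0) as (x1 & B & Z).
{ intros x; apply continuity_pt_filterlim.
  apply (continuous_minus ret (fun x => x)); [|apply continuous_id].
  eapply is_derive_continuous, ret_derive. }
{ rewrite Rmin_left, Rmax_right; lra. }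
rewrite Rmin_left, Rmax_right in B by lra.
assert (F1 : ret x1 = x1) by lra; clear Z.
assert (B' : - (PI / 2) < x1 < PI / 2).
{ split; apply Rnot_le_lt; intros L.
  - replace x1 with (- (PI / 2)) in F1; lra.
  - replace x1 with (PI / 2) in F1; lra. }
assert (F2 : ret (PI - x1) = PI - x1)
  by (apply ret_reflect; [intros; apply sin_PI_x|easy]).
assert (H12 : x1 < PI - x1 < x1 + 2 * PI) by lra.
assert (L1 : logmult T x1 <> 0).
{ intros L; generalize (ret_rigid x1 _ F1 L F2 H12 (PI / 2)); lra. }
assert (L2 : logmult T (PI - x1) <> 0)
  by (generalize (logmult_opp _ _ F1 F2 H12); lra).
exists (fun t => aflow t x1), (fun t => aflow t (PI - x1)).
split; [apply hyperbolic_of_fixed; easy|split; [apply hyperbolic_of_fixed; easy|split]].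
- intros (m & q & E); specialize (E 0); rewrite aflow_fixed_periodic, !aflow_0 in E by easy.
  assert (0 < IZR q < 1) by nra.
  assert ((0 < q)%Z) by (apply lt_IZR; lra).
  assert ((q < 1)%Z) by (apply lt_IZR; lra); lia.
- intros psi Hpsi; assert (F := fixed_of_cycle x1 psi F1 Hpsi).
  destruct (fixed_points_two x1 (PI - x1) _ F1 F2 H12 L1 F) as [k [E|E]];
    [left|right]; (eapply same_leaf_of_start; [apply Hpsi|apply E]).
Qed.

(** A closed leaf through [s * (PI / 2)] is its own mirror image, which forces
    multiplier 1; the displacement at the opposite angle shows that [ret] is
    not the identity. *)
Lemma one_double_of_half_turn s : s = 1 \/ s = -1 ->
  aflow (T / 2) (s * (PI / 2)) = s * (PI / 2) ->
  s * aflow (T / 2) (- s * (PI / 2)) < - (PI / 2) ->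
  has_one_double_cycle T X.
Proof.
intros Hs H N; assert (P := PI_RGT_0).
destruct (sin_reflect_half_PI s Hs) as [Ss Cs].
destruct (ret_eq_half _ Ss Cs H) as [F L].
destruct (sin_reflect_half_PI (- s)) as [Sm _]; [lra|].
assert (Nz : ret (- s * (PI / 2)) <> - s * (PI / 2)).
{ destruct Hs as [-> | ->].
  - apply Rlt_not_eq, ret_lt_half; [exact Sm|lra].
  - apply Rgt_not_eq, ret_gt_half; [exact Sm|lra]. }
set (x0 := s * (PI / 2)) in *.
assert (N' : ret (x0 + PI) <> x0 + PI).
{ destruct Hs as [E|E].
  - replace (x0 + PI) with (- s * (PI / 2) + IZR 1 * (2 * PI))
      by (unfold x0; rewrite E; simpl; field).
    rewrite ret_2PI; lra.
  - replace (x0 + PI) with (- s * (PI / 2)) by (unfold x0; rewrite E; field); easy. }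
exists (fun t => aflow t x0); split.
- split; [apply cycle_of_fixed, F|]; exists ret; rewrite aflow_0.
  destruct (ret_double x0 F L N') as [D2 N2].
  split; [apply is_return_map_ret|split; [easy|split; [|split; [easy|split; [|easy]]]]].
  + apply filter_forall; intros x; eexists; apply ret_derive.
  + rewrite (is_derive_unique _ _ _ (ret_derive x0)), L; apply exp_0.
- intros psi Hpsi; assert (Fp := fixed_of_cycle x0 psi F Hpsi).
  destruct (fixed_points_one x0 _ _ F L N' Fp) as [k E].
  eapply same_leaf_of_start; [apply Hpsi|apply E].
Qed.

End AngleEquation.

(** * Functions of time depending smoothly on two parameters *)

Definition box (d e m : R) : Prop := Rabs e <= d /\ Rabs m <= d.

Definition bounded_cont (d tau : R) (g : R -> R -> R -> R) : Prop :=
  (forall e m, box d e m -> forall t, continuous (fun t => g t e m) t) /\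
  exists K, forall t e m, 0 <= t <= tau -> box d e m -> Rabs (g t e m) <= K.

Definition has_gradient (d tau : R) (g gE gM : R -> R -> R -> R) : Prop :=
  exists K, forall t e m e0 m0, 0 <= t <= tau -> box d e m -> box d e0 m0 ->
    Rabs (g t e m - g t e0 m0 - gE t e0 m0 * (e - e0) - gM t e0 m0 * (m - m0))
      <= K * (Rabs (e - e0) + Rabs (m - m0)) ^ 2.

(** Smoothness in the parameters, uniformly in time, is expressed by first
    order Taylor expansions with quadratic error.  Unlike derivatives, these
    can be integrated in time and composed along curves of parameters without
    any theorem on exchange of limits. *)
Fixpoint reg (d tau : R) (n : nat) (g : R -> R -> R -> R) : Prop :=
  bounded_cont d tau g /\
  match n with
  | O => True
  | S n => exists gE gM, reg d tau n gE /\ reg d tau n gM /\ has_gradient d tau g gE gM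
  end.

Section Regularity.

Variables d tau : R.
Hypothesis tau0 : 0 <= tau.

Notation bc := (bounded_cont d tau).
Notation grad := (has_gradient d tau).
Notation reg := (reg d tau).

Lemma reg_bc n g : reg n g -> bc g.
Proof. destruct n; intros [H _]; exact H. Qed.

Lemma reg_pred n g : reg (S n) g -> reg n g.
Proof.
revert g; induction n as [|n IH]; intros g [B (gE & gM & HE & HM & G)]; [easy|].
split; [easy|exists gE, gM; auto].
Qed.

Lemma grad_ext g gE gM h hE hM :
  (forall t e m, box d e m -> g t e m = h t e m) ->
  (forall t e m, box d e m -> gE t e m = hE t e m) ->
  (forall t e m, box d e m -> gM t e m = hM t e m) ->
  grad g gE gM -> grad h hE hM.
Proof.
intros Eg EE EM [K HK]; exists K; intros t e m e0 m0 Ht B B0.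
rewrite <- !Eg, <- EE, <- EM by easy; apply HK; easy.
Qed.

Lemma reg_ext n g h : (forall t e m, box d e m -> g t e m = h t e m) ->
  reg n g -> reg n h.
Proof.
intros E Hg.
assert (B : bc h).
{ destruct (reg_bc _ _ Hg) as [C [K HK]]; split.
  - intros e m B t; apply (continuous_ext (fun t => g t e m)); [|apply C, B].
    intros; apply E, B.
  - exists K; intros t e m Ht B; rewrite <- E by easy; apply HK; easy. }
destruct n as [|n]; [easy|split; [easy|]].
destruct Hg as [_ (gE & gM & HE & HM & HG)]; exists gE, gM.
split; [easy|split; [easy|apply (grad_ext g gE gM); easy]].
Qed.

Lemma bc_pos_bound g : bc g -> exists K, 0 <= K /\
  forall t e m, 0 <= t <= tau -> box d e m -> Rabs (g t e m) <= K.
Proof.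
intros [_ [K H]]; exists (Rabs K); split; [apply Rabs_pos|].
intros t e m Ht B; eapply Rle_trans; [apply H; easy|apply Rle_abs].
Qed.

Lemma dist_bound e m e0 m0 : box d e m -> box d e0 m0 ->
  0 <= Rabs (e - e0) + Rabs (m - m0) <= 4 * d.
Proof.
intros [A B] [C D]; split.
- generalize (Rabs_pos (e - e0)) (Rabs_pos (m - m0)); lra.
- unfold Rminus.
  generalize (Rabs_triang e (- e0)) (Rabs_triang m (- m0)); rewrite !Rabs_Ropp; lra.
Qed.

Lemma grad_pos_bound g gE gM : grad g gE gM -> exists K, 0 <= K /\
  forall t e m e0 m0, 0 <= t <= tau -> box d e m -> box d e0 m0 ->
    Rabs (g t e m - g t e0 m0 - gE t e0 m0 * (e - e0) - gM t e0 m0 * (m - m0))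
      <= K * (Rabs (e - e0) + Rabs (m - m0)) ^ 2.
Proof.
intros [K H]; exists (Rabs K); split; [apply Rabs_pos|].
intros t e m e0 m0 Ht B B0; eapply Rle_trans; [apply H; easy|].
apply Rmult_le_compat_r; [apply pow2_ge_0|apply Rle_abs].
Qed.

Lemma grad_lip g gE gM : bc gE -> bc gM -> grad g gE gM -> exists L, 0 <= L /\
  forall t e m e0 m0, 0 <= t <= tau -> box d e m -> box d e0 m0 ->
    Rabs (g t e m - g t e0 m0) <= L * (Rabs (e - e0) + Rabs (m - m0)).
Proof.
intros HE HM HG.
destruct (bc_pos_bound _ HE) as (A & A0 & BA), (bc_pos_bound _ HM) as (B & B0 & BB),
  (grad_pos_bound _ _ _ HG) as (K & K0 & BK).
exists (A + B + K * (4 * Rabs d)); split.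
{ generalize (Rabs_pos d); intros; nra. }
intros t e m e0 m0 Ht Hb Hb0.
assert (N := dist_bound _ _ _ _ Hb Hb0).
specialize (BA t e0 m0 Ht Hb0); specialize (BB t e0 m0 Ht Hb0).
specialize (BK t e m e0 m0 Ht Hb Hb0).
generalize (Rabs_pos (e - e0)) (Rabs_pos (m - m0)); intros Pe Pm.
assert (QE : Rabs (gE t e0 m0 * (e - e0)) <= A * Rabs (e - e0))
  by (rewrite Rabs_mult; apply Rmult_le_compat_r; easy).
assert (QM : Rabs (gM t e0 m0 * (m - m0)) <= B * Rabs (m - m0))
  by (rewrite Rabs_mult; apply Rmult_le_compat_r; easy).
set (N' := Rabs (e - e0) + Rabs (m - m0)) in *.
assert (QK : K * N' ^ 2 <= K * (4 * Rabs d) * N').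
{ rewrite Rmult_assoc; apply Rmult_le_compat_l; [easy|].
  simpl; rewrite Rmult_1_r; apply Rmult_le_compat_r; [easy|].
  generalize (Rle_abs d); lra. }
replace (g t e m - g t e0 m0) with
  ((g t e m - g t e0 m0 - gE t e0 m0 * (e - e0) - gM t e0 m0 * (m - m0))
   + (gE t e0 m0 * (e - e0) + gM t e0 m0 * (m - m0))) by ring.
eapply Rle_trans; [apply Rabs_triang|].
assert (Rabs (gE t e0 m0 * (e - e0) + gM t e0 m0 * (m - m0)) <= A * N' + B * N').
{ eapply Rle_trans; [apply Rabs_triang|]; unfold N'; nra. }
lra.
Qed.

Lemma reg_lip n g : reg (S n) g -> exists L, 0 <= L /\
  forall t e m e0 m0, 0 <= t <= tau -> box d e m -> box d e0 m0 ->
    Rabs (g t e m - g t e0 m0) <= L * (Rabs (e - e0) + Rabs (m - m0)).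
Proof.
intros [_ (gE & gM & HE & HM & HG)].
apply (grad_lip g gE gM); [eapply reg_bc|eapply reg_bc|]; eauto.
Qed.

Lemma bc_plus g h : bc g -> bc h -> bc (fun t e m => g t e m + h t e m).
Proof.
intros Hg Hh; split.
- intros e m B t; apply (continuous_plus (fun t => g t e m)); [apply Hg|apply Hh]; easy.
- destruct (bc_pos_bound _ Hg) as (A & _ & BA), (bc_pos_bound _ Hh) as (C & _ & BC).
  exists (A + C); intros t e m Ht B; eapply Rle_trans; [apply Rabs_triang|].
  apply Rplus_le_compat; auto.
Qed.

Lemma bc_mult g h : bc g -> bc h -> bc (fun t e m => g t e m * h t e m).
Proof.
intros Hg Hh; split.
- intros e m B t; apply (continuous_mult (fun t => g t e m)); [apply Hg|apply Hh]; easy.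
- destruct (bc_pos_bound _ Hg) as (A & _ & BA), (bc_pos_bound _ Hh) as (C & _ & BC).
  exists (A * C); intros t e m Ht B; apply Rabs_mult_le; auto.
Qed.

Lemma grad_plus g gE gM h hE hM : grad g gE gM -> grad h hE hM ->
  grad (fun t e m => g t e m + h t e m) (fun t e m => gE t e m + hE t e m)
       (fun t e m => gM t e m + hM t e m).
Proof.
intros [K HK] [C HC]; exists (K + C); intros t e m e0 m0 Ht B B0.
specialize (HK t e m e0 m0 Ht B B0); specialize (HC t e m e0 m0 Ht B B0).
rewrite (Rmult_plus_distr_r K C); eapply Rle_trans; [|apply Rplus_le_compat; eassumption].
eapply Rle_trans; [|apply Rabs_triang]; right; f_equal; ring.
Qed.

Lemma grad_mult g gE gM h hE hM : bc g -> bc gE -> bc gM -> bc h -> bc hE -> bc hM ->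
  grad g gE gM -> grad h hE hM ->
  grad (fun t e m => g t e m * h t e m)
       (fun t e m => gE t e m * h t e m + g t e m * hE t e m)
       (fun t e m => gM t e m * h t e m + g t e m * hM t e m).
Proof.
intros Bg BgE BgM Bh BhE BhM HG HH.
destruct (grad_lip _ _ _ BgE BgM HG) as (L & L0 & BL).
destruct (grad_lip _ _ _ BhE BhM HH) as (L' & L0' & BL').
destruct (bc_pos_bound _ Bg) as (A & A0 & BA), (bc_pos_bound _ Bh) as (C & C0 & BC).
destruct HG as [K HK], HH as [K' HK'].
exists (C * K + A * K' + L * L'); intros t e m e0 m0 Ht B B0.
specialize (HK t e m e0 m0 Ht B B0); specialize (HK' t e m e0 m0 Ht B B0).
specialize (BL t e m e0 m0 Ht B B0); specialize (BL' t e m e0 m0 Ht B B0).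
specialize (BA t e0 m0 Ht B0); specialize (BC t e0 m0 Ht B0).
set (N := Rabs (e - e0) + Rabs (m - m0)) in *.
match type of HK with Rabs ?z <= _ => set (r := z) in * end.
match type of HK' with Rabs ?z <= _ => set (r' := z) in * end.
match goal with |- Rabs ?z <= _ => replace z with
  (h t e0 m0 * r + g t e0 m0 * r' + (g t e m - g t e0 m0) * (h t e m - h t e0 m0))
  by (unfold r, r'; ring) end.
replace ((C * K + A * K' + L * L') * N ^ 2) with
  (C * (K * N ^ 2) + A * (K' * N ^ 2) + (L * N) * (L' * N)) by ring.
eapply Rle_trans; [apply Rabs_triang|apply Rplus_le_compat].
- eapply Rle_trans; [apply Rabs_triang|apply Rplus_le_compat];
    apply Rabs_mult_le; easy.
- apply Rabs_mult_le; easy.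
Qed.

(** [P] describes a range of [g] on which [H] has a Taylor expansion. *)
Lemma grad_comp (H H1 : R -> R) (P : R -> Prop) (K : R) g gE gM :
  (forall x y, P x -> P y -> Rabs (H x - H y - H1 y * (x - y)) <= K * (x - y) ^ 2) ->
  (forall t e m, 0 <= t <= tau -> box d e m -> P (g t e m)) ->
  bc (fun t e m => H1 (g t e m)) -> bc gE -> bc gM -> grad g gE gM ->
  grad (fun t e m => H (g t e m)) (fun t e m => H1 (g t e m) * gE t e m)
       (fun t e m => H1 (g t e m) * gM t e m).
Proof.
intros HT HP B1 BE BM HG.
destruct (grad_lip _ _ _ BE BM HG) as (L & L0 & BL).
destruct (bc_pos_bound _ B1) as (A & A0 & BA).
destruct HG as [C HC]; exists (Rabs K * L ^ 2 + A * C); intros t e m e0 m0 Ht B B0.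
specialize (HC t e m e0 m0 Ht B B0); specialize (BL t e m e0 m0 Ht B B0).
specialize (BA t e0 m0 Ht B0).
specialize (HT _ _ (HP t e m Ht B) (HP t e0 m0 Ht B0)).
set (N := Rabs (e - e0) + Rabs (m - m0)) in *.
match type of HC with Rabs ?z <= _ => set (r := z) in * end.
match type of HT with Rabs ?z <= _ => set (r' := z) in * end.
match goal with |- Rabs ?z <= _ => replace z with (r' + H1 (g t e0 m0) * r)
  by (unfold r, r'; ring) end.
rewrite (Rmult_plus_distr_r (Rabs K * L ^ 2)).
eapply Rle_trans; [apply Rabs_triang|apply Rplus_le_compat].
- eapply Rle_trans; [apply HT|]; rewrite Rmult_assoc.
  apply Rle_trans with (Rabs K * (g t e m - g t e0 m0) ^ 2).
  + apply Rmult_le_compat_r; [apply pow2_ge_0|apply Rle_abs].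
  + apply Rmult_le_compat_l; [apply Rabs_pos|].
    rewrite <- Rpow_mult_distr, <- pow2_abs; apply pow_incr.
    split; [apply Rabs_pos|easy].
- rewrite Rmult_assoc; apply Rabs_mult_le; easy.
Qed.

Lemma reg_plus n g h : reg n g -> reg n h -> reg n (fun t e m => g t e m + h t e m).
Proof.
revert g h; induction n as [|n IH]; intros g h Hg Hh.
- split; [apply bc_plus; [apply Hg|apply Hh]|easy].
- destruct Hg as [Bg (gE & gM & HE & HM & HG)], Hh as [Bh (hE & hM & HE' & HM' & HG')].
  split; [apply bc_plus; easy|].
  eexists; eexists; split; [|split; [|apply (grad_plus _ _ _ _ _ _ HG HG')]];
    apply IH; easy.
Qed.

Lemma reg_mult n g h : reg n g -> reg n h -> reg n (fun t e m => g t e m * h t e m).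
Proof.
revert g h; induction n as [|n IH]; intros g h Hg Hh.
- split; [apply bc_mult; [apply Hg|apply Hh]|easy].
- assert (Pg := reg_pred _ _ Hg); assert (Ph := reg_pred _ _ Hh).
  destruct Hg as [Bg (gE & gM & HE & HM & HG)], Hh as [Bh (hE & hM & HE' & HM' & HG')].
  split; [apply bc_mult; easy|].
  eexists; eexists; split; [|split; [|apply (grad_mult g gE gM h hE hM)]];
    try (eapply reg_bc; eassumption); try easy;
    apply reg_plus; apply IH; easy.
Qed.

Lemma reg_zero n : reg n (fun _ _ _ => 0).
Proof.
assert (B : bc (fun _ _ _ => 0)).
{ split; [intros; apply continuous_const|exists 0; intros; rewrite Rabs_R0; lra]. }
induction n as [|n IH]; split; try easy.
exists (fun _ _ _ => 0), (fun _ _ _ => 0); split; [easy|split; [easy|]].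
exists 0; intros; match goal with |- Rabs ?z <= _ => replace z with 0 by ring end.
rewrite Rabs_R0; lra.
Qed.

Lemma continuous_bounded (h : R -> R) (a b : R) : a <= b ->
  (forall t, continuous h t) -> exists K, forall t, a <= t <= b -> Rabs (h t) <= K.
Proof.
intros ab Hh.
assert (C : forall c, a <= c <= b -> continuity_pt h c)
  by (intros c _; apply continuity_pt_filterlim, Hh).
destruct (continuity_ab_maj h a b ab C) as [x [Hx _]].
destruct (continuity_ab_min h a b ab C) as [y [Hy _]].
exists (Rmax (Rabs (h x)) (Rabs (h y))); intros t Ht.
specialize (Hx t Ht); specialize (Hy t Ht).
unfold Rmax; destruct Rle_dec; unfold Rabs in *; repeat destruct Rcase_abs; lra.
Qed.

Lemma reg_time n (h : R -> R) : (forall t, continuous h t) -> reg n (fun t _ _ => h t).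
Proof.
intros Hh.
assert (B : bc (fun t _ _ => h t)).
{ split; [intros; apply Hh|].
  destruct (continuous_bounded h 0 tau tau0 Hh) as [K HK]; exists K; auto. }
destruct n as [|n]; split; try easy.
exists (fun _ _ _ => 0), (fun _ _ _ => 0).
split; [apply reg_zero|split; [apply reg_zero|]].
exists 0; intros; match goal with |- Rabs ?z <= _ => replace z with 0 by ring end.
rewrite Rabs_R0; lra.
Qed.

Lemma reg_const n c : reg n (fun _ _ _ => c).
Proof. apply (reg_time n (fun _ => c)); intros; apply continuous_const. Qed.

Lemma reg_scal n c g : reg n g -> reg n (fun t e m => c * g t e m).
Proof. apply reg_mult, reg_const. Qed.

Lemma reg_eps n : reg n (fun _ e _ => e).
Proof.
assert (B : bc (fun _ e _ => e)).
{ split; [intros; apply continuous_const|exists d; intros t e m _ [A _]; exact A]. }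
destruct n as [|n]; split; try easy.
exists (fun _ _ _ => 1), (fun _ _ _ => 0).
split; [apply reg_const|split; [apply reg_const|]].
exists 0; intros; match goal with |- Rabs ?z <= _ => replace z with 0 by ring end.
rewrite Rabs_R0; lra.
Qed.

Lemma reg_mu n : reg n (fun _ _ m => m).
Proof.
assert (B : bc (fun _ _ m => m)).
{ split; [intros; apply continuous_const|exists d; intros t e m _ [_ A]; exact A]. }
destruct n as [|n]; split; try easy.
exists (fun _ _ _ => 0), (fun _ _ _ => 1).
split; [apply reg_const|split; [apply reg_const|]].
exists 0; intros; match goal with |- Rabs ?z <= _ => replace z with 0 by ring end.
rewrite Rabs_R0; lra.
Qed.

Lemma bc_comp (H : R -> R) (K : R) g : bc g ->
  (forall t e m, box d e m -> continuous H (g t e m)) ->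
  (forall t e m, 0 <= t <= tau -> box d e m -> Rabs (H (g t e m)) <= K) ->
  bc (fun t e m => H (g t e m)).
Proof.
intros Hg HC HK; split; [|exists K; exact HK].
intros e m B t; apply (continuous_comp (fun t => g t e m) H); [apply Hg, B|apply HC, B].
Qed.

Lemma reg_inv n c g : 0 < c -> (forall t e m, box d e m -> c <= g t e m) ->
  reg n g -> reg n (fun t e m => / g t e m).
Proof.
intros c0 Hc.
assert (Bi : reg 0 g -> reg 0 (fun t e m => / g t e m)).
{ intros [Bg _]; split; [|easy]; apply (bc_comp Rinv (/ c)); [easy| |].
  - intros t e m B; specialize (Hc t e m B).
    apply continuity_pt_filterlim, (continuity_pt_inv id);
      [apply derivable_continuous_pt, derivable_pt_id|unfold id; lra].
  - intros t e m _ B; specialize (Hc t e m B).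
    rewrite Rabs_pos_eq by (apply Rlt_le, Rinv_0_lt_compat; lra).
    apply Rinv_le_contravar; easy. }
induction n as [|n IH]; [easy|intros Hg].
assert (Pg := reg_pred _ _ Hg); assert (Bg := reg_bc _ _ Hg).
assert (B1 : reg n (fun t e m => -1 * (/ g t e m * / g t e m)))
  by (apply reg_scal, reg_mult; apply IH, Pg).
destruct Hg as [_ (gE & gM & HE & HM & HG)].
split; [apply Bi; easy|].
eexists; eexists; split; [|split; [|apply (grad_comp Rinv
  (fun x => -1 * (/ x * / x)) (fun x => c <= x) (/ c * / c * / c) g gE gM)]];
  try easy; try (apply reg_mult; easy); try (eapply reg_bc; eassumption).
- intros x y Hx Hy.
  (* the remainder is explicit: [(x - y) ^ 2 / (x * y ^ 2)] *)
  replace (/ x - / y - -1 * (/ y * / y) * (x - y)) with ((/ x * / y * / y) * (x - y) ^ 2)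
    by (field; lra).
  assert (forall z, c <= z -> 0 <= / z <= / c).
  { intros z Hz; split; [apply Rlt_le, Rinv_0_lt_compat|apply Rinv_le_contravar]; lra. }
  destruct (H x Hx), (H y Hy).
  rewrite Rabs_pos_eq.
  + apply Rmult_le_compat_r; [apply pow2_ge_0|].
    repeat apply Rmult_le_compat; try easy; apply Rmult_le_pos; easy.
  + apply Rmult_le_pos; [|apply pow2_ge_0]; repeat apply Rmult_le_pos; easy.
- intros; apply Hc; easy.
Qed.

Lemma sqrt_lower c x : 0 < c -> c <= x -> sqrt c <= sqrt x /\ 0 < sqrt c.
Proof. intros; split; [apply sqrt_le_1|apply sqrt_lt_R0]; lra. Qed.

Lemma reg_sqrt n c g : 0 < c -> (forall t e m, box d e m -> c <= g t e m) ->
  reg n g -> reg n (fun t e m => sqrt (g t e m)).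
Proof.
intros c0 Hc.
assert (Bi : reg 0 g -> reg 0 (fun t e m => sqrt (g t e m))).
{ intros [Bg _]; split; [|easy].
  destruct (bc_pos_bound _ Bg) as (K & K0 & HK).
  apply (bc_comp sqrt (sqrt K)); [easy| |].
  - intros t e m B; specialize (Hc t e m B).
    apply continuity_pt_filterlim, continuity_pt_sqrt; lra.
  - intros t e m Ht B; specialize (Hc t e m B); specialize (HK t e m Ht B).
    rewrite Rabs_pos_eq in HK by lra.
    rewrite Rabs_pos_eq by apply sqrt_pos; apply sqrt_le_1; lra. }
induction n as [|n IH]; [easy|intros Hg].
assert (Pg := reg_pred _ _ Hg); assert (Bg := reg_bc _ _ Hg).
assert (B1 : reg n (fun t e m => / 2 * / sqrt (g t e m))).
{ apply reg_scal, (reg_inv n (sqrt c)); [apply sqrt_lt_R0, c0| |apply IH, Pg].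
  intros t e m B; apply sqrt_lower; [easy|apply Hc, B]. }
destruct Hg as [_ (gE & gM & HE & HM & HG)].
split; [apply Bi; easy|].
eexists; eexists; split; [|split; [|apply (grad_comp sqrt
  (fun x => / 2 * / sqrt x) (fun x => c <= x) (/ (8 * sqrt c ^ 3)) g gE gM)]];
  try easy; try (apply reg_mult; easy); try (eapply reg_bc; eassumption).
- intros x y Hx Hy.
  destruct (sqrt_lower c x c0 Hx) as [Sx S0], (sqrt_lower c y c0 Hy) as [Sy _].
  assert (Ex : sqrt x * sqrt x = x) by (apply sqrt_sqrt; lra).
  assert (Ey : sqrt y * sqrt y = y) by (apply sqrt_sqrt; lra).
  set (u := sqrt x) in *; set (v := sqrt y) in *; set (s := sqrt c) in *.
  (* the remainder is [- (u - v) ^ 2 / (2 * v)], and [u + v >= 2 * s] *)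
  rewrite <- Ex, <- Ey.
  replace (u - v - / 2 * / v * (u * u - v * v)) with (- (/ (2 * v) * (u - v) ^ 2))
    by (field; lra).
  rewrite Rabs_Ropp, Rabs_pos_eq.
  2: { apply Rmult_le_pos; [apply Rlt_le, Rinv_0_lt_compat; lra|apply pow2_ge_0]. }
  replace ((u * u - v * v) ^ 2) with ((u + v) ^ 2 * (u - v) ^ 2) by ring.
  rewrite <- Rmult_assoc; apply Rmult_le_compat_r; [apply pow2_ge_0|].
  apply Rmult_le_reg_r with (2 * v * (8 * s ^ 3)).
  { repeat apply Rmult_lt_0_compat; try lra; apply pow_lt; lra. }
  assert (s0 : s <> 0) by lra; assert (v0 : v <> 0) by lra.
  replace (/ (2 * v) * (2 * v * (8 * s ^ 3))) with (4 * s ^ 2 * (2 * s)) by (field; easy).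
  replace (/ (8 * s ^ 3) * (u + v) ^ 2 * (2 * v * (8 * s ^ 3)))
    with ((u + v) ^ 2 * (2 * v)) by (field; easy).
  apply Rmult_le_compat; [generalize (pow2_ge_0 s); lra|lra| |lra].
  replace (4 * s ^ 2) with ((2 * s) ^ 2) by ring; apply pow_incr; lra.
- intros; apply Hc; easy.
Qed.

Lemma bc_sin_cos g : bc g ->
  bc (fun t e m => sin (g t e m)) /\ bc (fun t e m => cos (g t e m)).
Proof.
intros Bg; split; apply (bc_comp _ 1); try easy; intros.
- eapply is_derive_continuous, is_derive_sin.
- apply Rabs_sin_le.
- eapply is_derive_continuous, is_derive_cos.
- apply Rabs_cos_le.
Qed.

Lemma reg_sin_cos n g : reg n g ->
  reg n (fun t e m => sin (g t e m)) /\ reg n (fun t e m => cos (g t e m)).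
Proof.
induction n as [|n IH]; intros Hg; assert (Bg := reg_bc _ _ Hg);
  destruct (bc_sin_cos g Bg) as [Bs Bc]; [easy|].
destruct (IH (reg_pred _ _ Hg)) as [Rs Rc].
assert (Rs' : reg n (fun t e m => - sin (g t e m))).
{ apply (reg_ext n (fun t e m => -1 * sin (g t e m))); [intros; ring|].
  apply reg_scal, Rs. }
destruct Hg as [_ (gE & gM & HE & HM & HG)].
split; split; try easy; eexists; eexists; (split; [|split; [|
  first [apply (grad_comp sin cos (fun _ => True) 1 g gE gM)
        |apply (grad_comp cos (fun x => - sin x) (fun _ => True) 1 g gE gM)]]]);
  try easy; try (apply reg_mult; easy); try (eapply reg_bc; eassumption);
  intros; first [apply sin_taylor|apply cos_taylor].
Qed.

Lemma reg_sin n g : reg n g -> reg n (fun t e m => sin (g t e m)).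
Proof. apply reg_sin_cos. Qed.

Lemma reg_cos n g : reg n g -> reg n (fun t e m => cos (g t e m)).
Proof. apply reg_sin_cos. Qed.

Lemma reg_exp n g : reg n g -> reg n (fun t e m => exp (g t e m)).
Proof.
assert (Bi : bc g -> bc (fun t e m => exp (g t e m))).
{ intros Bg; destruct (bc_pos_bound _ Bg) as (K & K0 & HK).
  apply (bc_comp exp (exp K)); [easy| |].
  - intros; eapply is_derive_continuous, is_derive_exp.
  - intros t e m Ht B; specialize (HK t e m Ht B).
    rewrite Rabs_pos_eq by apply exp_nonneg; apply exp_le.
    apply Rabs_le_between in HK; lra. }
induction n as [|n IH]; intros Hg; assert (Bg := reg_bc _ _ Hg); [split; auto|].
assert (Re := IH (reg_pred _ _ Hg)).
destruct Hg as [_ (gE & gM & HE & HM & HG)].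
destruct (bc_pos_bound _ Bg) as (K & K0 & HK).
split; [auto|]; eexists; eexists; split; [|split; [|
  apply (grad_comp exp exp (fun x => Rabs x <= K) (exp K) g gE gM)]];
  try easy; try (apply reg_mult; easy); try (eapply reg_bc; eassumption).
intros x y Hx Hy; apply (taylor_quadratic exp exp exp); intros z Hz.
split; [apply is_derive_exp|split; [apply is_derive_exp|]].
rewrite Rabs_pos_eq by apply exp_nonneg; apply exp_le.
apply Rabs_le_between in Hx; apply Rabs_le_between in Hy.
unfold Rmin, Rmax in Hz; destruct Rle_dec; lra.
Qed.

Lemma bc_int g : bc g -> bc (fun t e m => RInt (fun s => g s e m) 0 t).
Proof.
intros Bg; split.
- intros e m B t; eapply is_derive_continuous.
  apply (is_derive_RInt0 (fun s => g s e m)), Bg, B.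
- destruct (bc_pos_bound _ Bg) as (K & K0 & HK).
  exists (K * tau); intros t e m Ht B; apply abs_RInt_bound; [apply Bg, B|easy|].
  intros; apply HK; easy.
Qed.

Lemma derive_taylor_form (p q v w : R -> R) (p' q' v' w' x y s : R) :
  is_derive p s p' -> is_derive q s q' -> is_derive v s v' -> is_derive w s w' ->
  is_derive (fun t => p t - q t - v t * x - w t * y) s (p' - q' - v' * x - w' * y).
Proof.
intros Hp Hq Hv Hw.
apply is_derive_Rminus; [apply is_derive_Rminus|].
- apply is_derive_Rminus; assumption.
- apply (is_derive_scal_l v s v' x Hv).
- apply (is_derive_scal_l w s w' y Hw).
Qed.

Lemma grad_int g gE gM : bc g -> bc gE -> bc gM -> grad g gE gM ->
  grad (fun t e m => RInt (fun s => g s e m) 0 t)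
       (fun t e m => RInt (fun s => gE s e m) 0 t)
       (fun t e m => RInt (fun s => gM s e m) 0 t).
Proof.
intros Bg BE BM HG; destruct (grad_pos_bound _ _ _ HG) as (K & K0 & HK).
exists (K * tau); intros t e m e0 m0 Ht B B0.
set (h := fun t e m => RInt (fun s => g s e m) 0 t).
set (h1 := fun t => RInt (fun s => g s e m) 0 t - RInt (fun s => g s e0 m0) 0 t
  - RInt (fun s => gE s e0 m0) 0 t * (e - e0) - RInt (fun s => gM s e0 m0) 0 t * (m - m0)).
fold (h1 t); replace (h1 t) with (h1 t - h1 0) by (unfold h1; rewrite !RInt_00; ring).
replace (K * tau * _) with (K * (Rabs (e - e0) + Rabs (m - m0)) ^ 2 * (tau - 0)) by ring.
apply Rle_trans with (K * (Rabs (e - e0) + Rabs (m - m0)) ^ 2 * (t - 0)).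
2: { apply Rmult_le_compat_l; [|lra]; apply Rmult_le_pos; [easy|apply pow2_ge_0]. }
apply (derive_bound h1 (fun s => g s e m - g s e0 m0 - gE s e0 m0 * (e - e0)
  - gM s e0 m0 * (m - m0))); [lra|].
intros s Hs; split; [|apply HK; try easy; lra].
apply derive_taylor_form.
- apply (is_derive_RInt0 (fun s => g s e m)), Bg, B.
- apply (is_derive_RInt0 (fun s => g s e0 m0)), Bg, B0.
- apply (is_derive_RInt0 (fun s => gE s e0 m0)), BE, B0.
- apply (is_derive_RInt0 (fun s => gM s e0 m0)), BM, B0.
Qed.

Lemma reg_int n g : reg n g -> reg n (fun t e m => RInt (fun s => g s e m) 0 t).
Proof.
revert g; induction n as [|n IH]; intros g Hg; assert (Bg := reg_bc _ _ Hg).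
- split; [apply bc_int, Bg|easy].
- destruct Hg as [_ (gE & gM & HE & HM & HG)]; split; [apply bc_int, Bg|].
  eexists; eexists; split; [|split; [|apply (grad_int g gE gM)]];
    try (apply IH; easy); try (eapply reg_bc; eassumption); easy.
Qed.

Lemma grad_derive_eps g gE gM t e0 m0 : grad g gE gM -> 0 <= t <= tau ->
  Rabs e0 < d -> Rabs m0 <= d -> is_derive (fun e => g t e m0) e0 (gE t e0 m0).
Proof.
intros [K HK] Ht He Hm.
apply (is_derive_quadratic _ _ _ (d - Rabs e0) K); [lra|]; intros e Hd.
assert (Rabs e <= d).
{ replace e with ((e - e0) + e0) by ring.
  eapply Rle_trans; [apply Rabs_triang|]; lra. }
assert (B : box d e m0) by (split; easy).
assert (B0 : box d e0 m0) by (split; lra).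
specialize (HK t e m0 e0 m0 Ht B B0).
rewrite Rminus_diag, Rmult_0_r, Rminus_0_r, Rabs_R0, Rplus_0_r, pow2_abs in HK; exact HK.
Qed.

Lemma grad_derive_mu g gE gM t e0 m0 : grad g gE gM -> 0 <= t <= tau ->
  Rabs e0 <= d -> Rabs m0 < d -> is_derive (fun m => g t e0 m) m0 (gM t e0 m0).
Proof.
intros [K HK] Ht He Hm.
apply (is_derive_quadratic _ _ _ (d - Rabs m0) K); [lra|]; intros m Hd.
assert (Rabs m <= d).
{ replace m with ((m - m0) + m0) by ring.
  eapply Rle_trans; [apply Rabs_triang|]; lra. }
assert (B : box d e0 m) by (split; easy).
assert (B0 : box d e0 m0) by (split; lra).
specialize (HK t e0 m e0 m0 Ht B B0).
rewrite Rminus_diag, Rmult_0_r, Rminus_0_r, Rabs_R0, Rplus_0_l, pow2_abs in HK; exact HK.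
Qed.

End Regularity.

Lemma box_mono r d e m : r <= d -> box r e m -> box d e m.
Proof. intros H [A B]; split; lra. Qed.

Lemma reg_mono r d tau n g : r <= d -> reg d tau n g -> reg r tau n g.
Proof.
intros rd; revert g; induction n as [|n IH]; intros g Hg;
  destruct (reg_bc _ _ _ _ Hg) as [C [K HK]]; (split; [split; [|exists K]|]).
- intros; apply C; eapply box_mono; eassumption.
- intros; apply HK; [easy|eapply box_mono; eassumption].
- easy.
- intros; apply C; eapply box_mono; eassumption.
- intros; apply HK; [easy|eapply box_mono; eassumption].
- destruct Hg as [_ (gE & gM & HE & HM & [A HA])]; exists gE, gM.
  split; [auto|split; [auto|exists A]].
  intros; apply HA; [easy| |]; eapply box_mono; eassumption.
Qed.
(** Freezing the time; a function independent of time is regular on any time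
    interval. *)
Lemma reg_eval d tau tau' n g t : 0 <= t <= tau -> reg d tau n g ->
  reg d tau' n (fun _ e m => g t e m).
Proof.
intros Ht; revert g; induction n as [|n IH]; intros g Hg;
  assert (B0 : bounded_cont d tau' (fun _ e m => g t e m)) by
    (destruct (reg_bc _ _ _ _ Hg) as [_ [K HK]];
     split; [intros; apply continuous_const|exists K; auto]); [easy|].
destruct Hg as [_ (gE & gM & HE & HM & [C HC])]; split; [easy|].
eexists; eexists; split; [apply IH, HE|split; [apply IH, HM|]].
exists C; intros; apply HC; easy.
Qed.

(** * Smooth dependence of solutions on parameters *)

Section ParametricSolution.

Variables (d tau : R) (a b psi : R -> R -> R -> R).
Hypothesis d0 : 0 < d.
Hypothesis tau0 : 0 < tau.
Hypothesis a_reg : forall n, reg d tau n a.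
Hypothesis b_reg : forall n, reg d tau n b.
Hypothesis psi_eq : forall e m, box d e m -> forall t,
  is_derive (fun t => psi t e m) t (a t e m - b t e m * cos (psi t e m)).
Hypothesis psi_0 : forall e m, box d e m -> psi 0 e m = 0.

Let tau0' : 0 <= tau := Rlt_le _ _ tau0.

Lemma psi_bc : bounded_cont d tau psi.
Proof.
split; [intros e m B t; eapply is_derive_continuous, psi_eq, B|].
destruct (bc_pos_bound _ _ _ (reg_bc _ _ _ _ (a_reg 0))) as (A & A0 & HA).
destruct (bc_pos_bound _ _ _ (reg_bc _ _ _ _ (b_reg 0))) as (C & C0 & HC).
exists ((A + C) * tau); intros t e m Ht B.
apply Rle_trans with ((A + C) * (t - 0)); [|apply Rmult_le_compat_l; lra].
replace (psi t e m) with (psi t e m - psi 0 e m) by (rewrite psi_0 by easy; ring).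
apply (derive_bound (fun t => psi t e m) (fun t => a t e m - b t e m * cos (psi t e m)));
  [lra|].
intros s Hs; split; [apply psi_eq, B|].
assert (Ht' : 0 <= s <= tau) by lra.
specialize (HA s e m Ht' B); specialize (HC s e m Ht' B).
eapply Rle_trans; [apply Rabs_triang|]; rewrite Rabs_Ropp.
apply Rplus_le_compat, Rabs_mult_le1; [easy|easy|apply Rabs_cos_le].
Qed.

Lemma cos_lip x y : Rabs (cos x - cos y) <= Rabs (x - y).
Proof.
rewrite !cos_sin; eapply Rle_trans; [apply sin_lip|].
right; f_equal; ring.
Qed.

Lemma psi_lip : exists L, 0 <= L /\
  forall t e m e0 m0, 0 <= t <= tau -> box d e m -> box d e0 m0 ->
    Rabs (psi t e m - psi t e0 m0) <= L * (Rabs (e - e0) + Rabs (m - m0)).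
Proof.
destruct (reg_lip _ _ _ _ (a_reg 1)) as (La & La0 & HLa).
destruct (reg_lip _ _ _ _ (b_reg 1)) as (Lb & Lb0 & HLb).
destruct (bc_pos_bound _ _ _ (reg_bc _ _ _ _ (b_reg 0))) as (C & C0 & HC).
exists ((La + Lb) * exp ((2 * C + 1) * tau)); split.
{ apply Rmult_le_pos; [lra|apply exp_nonneg]. }
intros t e m e0 m0 Ht B B0.
set (N := Rabs (e - e0) + Rabs (m - m0)).
assert (N0 : 0 <= N) by apply (dist_bound d e m e0 m0 B B0).
set (eta := (La + Lb) * N).
assert (eta0 : 0 <= eta) by (apply Rmult_le_pos; lra).
assert (G := gronwall (fun s => psi s e m - psi s e0 m0)
  (fun s => (a s e m - b s e m * cos (psi s e m))
            - (a s e0 m0 - b s e0 m0 * cos (psi s e0 m0))) C eta t (proj1 Ht) C0).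
cbv beta in G; rewrite !psi_0 in G by easy.
assert (Hx : 1 <= exp ((2 * C + 1) * tau)).
{ apply Rle_trans with (exp 0); [rewrite exp_0; lra|apply exp_le, Rmult_le_pos; lra]. }
apply Rsqr_incr_0_var.
2: { repeat apply Rmult_le_pos; try lra; apply exp_nonneg. }
rewrite !Rsqr_pow2, pow2_abs.
apply Rle_trans with (eta ^ 2 * exp ((2 * C + 1) * t)).
- replace ((0 - 0) ^ 2 + eta ^ 2) with (eta ^ 2) in G by ring.
  generalize (pow2_ge_0 eta); intros.
  eapply Rle_trans; [|apply G]; [lra|].
  intros s Hs; split.
  + apply (is_derive_minus (fun s => psi s e m) (fun s => psi s e0 m0)); apply psi_eq; easy.
  + assert (Hs' : 0 <= s <= tau) by lra.
    specialize (HLa s e m e0 m0 Hs' B B0); specialize (HLb s e m e0 m0 Hs' B B0).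
    specialize (HC s e0 m0 Hs' B0).
    match goal with |- Rabs ?z <= _ => replace z with
      ((a s e m - a s e0 m0) + (- ((b s e m - b s e0 m0) * cos (psi s e m))
       + - (b s e0 m0 * (cos (psi s e m) - cos (psi s e0 m0))))) by ring end.
    eapply Rle_trans; [apply Rabs_triang|].
    assert (Rabs (- ((b s e m - b s e0 m0) * cos (psi s e m))) <= Lb * N).
    { rewrite Rabs_Ropp; apply Rabs_mult_le1; [easy|apply Rabs_cos_le]. }
    assert (Rabs (- (b s e0 m0 * (cos (psi s e m) - cos (psi s e0 m0))))
      <= C * Rabs (psi s e m - psi s e0 m0)).
    { rewrite Rabs_Ropp; apply Rabs_mult_le; [easy|apply cos_lip]. }
    eapply Rle_trans; [apply Rplus_le_compat_l, Rabs_triang|].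
    unfold eta; fold N in HLa; lra.
- replace (((La + Lb) * exp ((2 * C + 1) * tau) * N) ^ 2) with
    (eta ^ 2 * (exp ((2 * C + 1) * tau)) ^ 2) by (unfold eta; ring).
  apply Rmult_le_compat_l; [apply pow2_ge_0|].
  apply Rle_trans with (exp ((2 * C + 1) * tau)); [apply exp_le; nra|nra].
Qed.

(** The variational equation of [psi] is linear; [var_sol h] is its solution
    with inhomogeneous term [h], by variation of constants. *)
Definition var_exp (t e m : R) : R := RInt (fun s => b s e m * sin (psi s e m)) 0 t.

Definition var_sol (h : R -> R -> R -> R) (t e m : R) : R :=
  exp (var_exp t e m) * RInt (fun s => h s e m * exp (- var_exp s e m)) 0 t.

Lemma reg_var_sol n h : reg d tau n psi -> reg d tau n h -> reg d tau n (var_sol h).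
Proof.
intros Hp Hh.
assert (HA : reg d tau n var_exp).
{ apply (reg_int d tau n (fun s e m => b s e m * sin (psi s e m))).
  apply reg_mult; [apply b_reg|apply reg_sin; [apply tau0'|apply Hp]]. }
apply (reg_mult d tau n (fun t e m => exp (var_exp t e m))); [apply reg_exp, HA|].
apply (reg_int d tau n (fun s e m => h s e m * exp (- var_exp s e m))).
apply reg_mult; [easy|]; apply (reg_exp d tau n (fun s e m => - var_exp s e m)).
apply (reg_ext d tau n (fun s e m => -1 * var_exp s e m)); [intros; ring|].
apply reg_scal; [apply tau0'|easy].
Qed.

(** The difference of two solutions satisfies the variational equation up to a
    quadratic error, by the expansions of [a], [b] and [cos]. *)
Lemma psi_gradient aE aM bE bM :
  bounded_cont d tau aE -> bounded_cont d tau aM ->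
  bounded_cont d tau bE -> bounded_cont d tau bM ->
  has_gradient d tau a aE aM -> has_gradient d tau b bE bM ->
  has_gradient d tau psi
    (var_sol (fun t e m => aE t e m - bE t e m * cos (psi t e m)))
    (var_sol (fun t e m => aM t e m - bM t e m * cos (psi t e m))).
Proof.
intros BaE BaM BbE BbM Ga Gb.
destruct psi_lip as (L & L0 & HL).
destruct (reg_lip _ _ _ _ (b_reg 1)) as (Lb & Lb0 & HLb).
destruct (bc_pos_bound _ _ _ (reg_bc _ _ _ _ (b_reg 0))) as (C & C0 & HC).
destruct (grad_pos_bound _ _ _ _ _ Ga) as (Ka & Ka0 & HKa).
destruct (grad_pos_bound _ _ _ _ _ Gb) as (Kb & Kb0 & HKb).
destruct (bc_sin_cos d tau psi psi_bc) as [Bs Bc].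
set (Q := Ka + Kb + Lb * L + C * L ^ 2).
exists (exp (2 * (C * tau)) * (Q * tau)).
intros t e m e0 m0 Ht B B0.
set (N := Rabs (e - e0) + Rabs (m - m0)).
assert (N0 : 0 <= N) by apply (dist_bound d e m e0 m0 B B0).
assert (Q0 : 0 <= Q).
{ unfold Q; generalize (pow2_ge_0 L); intros; nra. }
set (hE := fun s => aE s e0 m0 - bE s e0 m0 * cos (psi s e0 m0)).
set (hM := fun s => aM s e0 m0 - bM s e0 m0 * cos (psi s e0 m0)).
assert (CE : forall s, continuous hE s).
{ intros s; apply (continuous_minus (fun s => aE s e0 m0)); [apply BaE, B0|].
  apply (continuous_mult (fun s => bE s e0 m0)); [apply BbE, B0|apply Bc, B0]. }
assert (CM : forall s, continuous hM s).
{ intros s; apply (continuous_minus (fun s => aM s e0 m0)); [apply BaM, B0|].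
  apply (continuous_mult (fun s => bM s e0 m0)); [apply BbM, B0|apply Bc, B0]. }
set (al := fun s => b s e0 m0 * sin (psi s e0 m0)).
assert (Cal : forall s, continuous al s).
{ intros s; apply (continuous_mult (fun s => b s e0 m0));
    [apply (reg_bc _ _ _ _ (b_reg 0)), B0|apply Bs, B0]. }
assert (P := linear_perturbation (fun s => psi s e m - psi s e0 m0)
  (fun s => (a s e m - b s e m * cos (psi s e m))
            - (a s e0 m0 - b s e0 m0 * cos (psi s e0 m0)))
  al (fun s => hE s * (e - e0) + hM s * (m - m0)) C (Q * N ^ 2) t (proj1 Ht) Cal).
cbv beta in P; rewrite !psi_0, Rminus_diag, Rplus_0_l in P by easy.
assert (Split : RInt (fun s => (hE s * (e - e0) + hM s * (m - m0)) * exp (- RInt al 0 s)) 0 t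
  = RInt (fun s => hE s * exp (- RInt al 0 s)) 0 t * (e - e0)
  + RInt (fun s => hM s * exp (- RInt al 0 s)) 0 t * (m - m0)).
{ assert (Cx : forall s, continuous (fun s => exp (- RInt al 0 s)) s).
  { intros s; apply (continuous_comp (fun s => - RInt al 0 s) exp).
    - apply (continuous_opp (fun s => RInt al 0 s)).
      eapply is_derive_continuous, is_derive_RInt0, Cal.
    - eapply is_derive_continuous, is_derive_exp. }
  rewrite <- (RInt_lin (fun s => hE s * exp (- RInt al 0 s)) (fun s => hM s * exp (- RInt al 0 s))).
  - apply RInt_ext; intros; Rsimpl; ring.
  - intros s; apply (continuous_mult hE); [apply CE|apply Cx].
  - intros s; apply (continuous_mult hM); [apply CM|apply Cx]. }
rewrite Split in P.
change (Rabs (psi t e m - psi t e0 m0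
  - exp (RInt al 0 t) * RInt (fun s => hE s * exp (- RInt al 0 s)) 0 t * (e - e0)
  - exp (RInt al 0 t) * RInt (fun s => hM s * exp (- RInt al 0 s)) 0 t * (m - m0))
  <= exp (2 * (C * tau)) * (Q * tau) * N ^ 2).
match goal with |- Rabs ?z <= _ => match type of P with _ -> _ -> Rabs ?w <= _ =>
  replace z with w by ring end end.
eapply Rle_trans; [apply P|].
- intros s; apply (continuous_plus (fun s => hE s * (e - e0)));
    [apply (continuous_mult hE)|apply (continuous_mult hM)];
    first [apply CE|apply CM|apply continuous_const].
- intros s Hs; assert (Hs' : 0 <= s <= tau) by lra; split; [|split].
  + apply (is_derive_minus (fun s => psi s e m) (fun s => psi s e0 m0)); apply psi_eq; easy.
  + apply Rabs_mult_le1; [apply HC; easy|apply Rabs_sin_le].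
  + specialize (HL s e m e0 m0 Hs' B B0); specialize (HLb s e m e0 m0 Hs' B B0).
    specialize (HC s e0 m0 Hs' B0).
    specialize (HKa s e m e0 m0 Hs' B B0); specialize (HKb s e m e0 m0 Hs' B B0).
    assert (Tc := cos_taylor (psi s e m) (psi s e0 m0)).
    assert (Lc := cos_lip (psi s e m) (psi s e0 m0)).
    fold N in HL, HLb, HKa, HKb.
    match type of HKa with Rabs ?z <= _ => set (ra := z) in * end.
    match type of HKb with Rabs ?z <= _ => set (rb := z) in * end.
    match type of Tc with Rabs ?z <= _ => set (rc := z) in * end.
    match goal with |- Rabs ?z <= _ => replace z with
      (ra + (- (rb * cos (psi s e0 m0)) + (- ((b s e m - b s e0 m0)
         * (cos (psi s e m) - cos (psi s e0 m0))) + - (b s e0 m0 * rc))))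
      by (unfold ra, rb, rc, al, hE, hM; ring) end.
    assert (I1 : Rabs (- (rb * cos (psi s e0 m0))) <= Kb * N ^ 2).
    { rewrite Rabs_Ropp; apply Rabs_mult_le1; [easy|apply Rabs_cos_le]. }
    assert (I2 : Rabs (- ((b s e m - b s e0 m0) * (cos (psi s e m) - cos (psi s e0 m0))))
      <= (Lb * N) * (L * N)).
    { rewrite Rabs_Ropp; apply Rabs_mult_le; [easy|lra]. }
    assert (I3 : Rabs (- (b s e0 m0 * rc)) <= C * (L * N) ^ 2).
    { rewrite Rabs_Ropp; apply Rabs_mult_le; [easy|].
      eapply Rle_trans; [apply Tc|]; rewrite Rmult_1_l, <- pow2_abs.
      apply pow_incr; split; [apply Rabs_pos|easy]. }
    unfold Q.
    eapply Rle_trans; [apply Rabs_triang|].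
    eapply Rle_trans; [apply Rplus_le_compat_l, Rabs_triang|].
    eapply Rle_trans; [apply Rplus_le_compat_l, Rplus_le_compat_l, Rabs_triang|].
    nra.
- apply Rle_trans with (exp (2 * (C * tau)) * (Q * N ^ 2 * tau)); [|right; ring].
  assert (0 <= Q * N ^ 2) by (apply Rmult_le_pos; [easy|apply pow2_ge_0]).
  apply Rmult_le_compat; [apply exp_nonneg| |apply exp_le|].
  + apply Rmult_le_pos; lra.
  + apply Rmult_le_compat_l; [lra|apply Rmult_le_compat_l; lra].
  + apply Rmult_le_compat_l; lra.
Qed.

Lemma reg_cos_comb n x y : reg d tau n psi -> reg d tau n x -> reg d tau n y ->
  reg d tau n (fun t e m => x t e m - y t e m * cos (psi t e m)).
Proof.
intros Hp Hx Hy.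
apply (reg_ext d tau n (fun t e m => x t e m + -1 * (y t e m * cos (psi t e m))));
  [intros; ring|].
apply reg_plus; [easy|apply reg_scal; [apply tau0'|]].
apply reg_mult; [easy|apply reg_cos; [apply tau0'|easy]].
Qed.

(** The gradient of [psi] is built from [psi] itself, so regularity of order
    [n] propagates to order [n + 1]. *)
Lemma psi_reg n : reg d tau n psi.
Proof.
induction n as [|n IH]; [split; [apply psi_bc|easy]|].
destruct (a_reg (S n)) as [_ (aE & aM & HaE & HaM & Ga)].
destruct (b_reg (S n)) as [_ (bE & bM & HbE & HbM & Gb)].
split; [apply psi_bc|]; eexists; eexists; split; [|split; [|
  apply (psi_gradient aE aM bE bM); try (eapply reg_bc; eassumption); easy]];
  apply reg_var_sol; try easy; apply reg_cos_comb; easy.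
Qed.

(** At the origin the coefficients vanish, so [psi] is identically zero and the
    variational equation reduces to an integration. *)
Lemma psi_derivatives_0 (a1 b1 : R -> R) :
  (forall s, is_derive (fun e => a s e 0) 0 (a1 s)) -> (forall s m, a s 0 m = 0) ->
  (forall s e, b s e 0 = 0) -> (forall s, is_derive (fun m => b s 0 m) 0 (b1 s)) ->
  is_derive (fun e => psi tau e 0) 0 (RInt a1 0 tau) /\
  is_derive (fun m => psi tau 0 m) 0 (- RInt b1 0 tau).
Proof.
intros Da a0 b0 Db.
assert (B0 : box d 0 0) by (split; rewrite Rabs_R0; lra).
assert (p0 : forall t, psi t 0 0 = 0).
{ intros t; transitivity (psi 0 0 0); [|apply psi_0, B0].
  apply (derive_zero_eq (fun t => psi t 0 0)); intros s; evar_last; [apply psi_eq, B0|].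
  rewrite a0, b0; ring. }
assert (A0 : forall t, var_exp t 0 0 = 0).
{ intros t; unfold var_exp; rewrite (RInt_ext _ (fun _ => 0)).
  - rewrite RInt_const; Rsimpl; ring.
  - intros s _; rewrite b0; apply Rmult_0_l. }
assert (V : forall h, var_sol h tau 0 0 = RInt (fun s => h s 0 0) 0 tau).
{ intros h; unfold var_sol; rewrite A0, exp_0, Rmult_1_l; apply RInt_ext; intros s _.
  rewrite A0, Ropp_0, exp_0; apply Rmult_1_r. }
destruct (a_reg 1) as [_ (aE & aM & HaE & HaM & Ga)].
destruct (b_reg 1) as [_ (bE & bM & HbE & HbM & Gb)].
assert (G := psi_gradient aE aM bE bM (proj1 HaE) (proj1 HaM) (proj1 HbE) (proj1 HbM) Ga Gb).
assert (R0 : Rabs 0 < d) by (rewrite Rabs_R0; lra).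
assert (R0' : Rabs 0 <= d) by lra.
assert (Tt : 0 <= tau <= tau) by lra.
assert (U : forall (u v : R -> R) x l, (forall y, u y = v y) -> is_derive v 0 x ->
          is_derive u 0 l -> l = x).
{ intros u v x l E H1 H2.
  rewrite <- (is_derive_unique _ _ _ H1), <- (is_derive_unique _ _ _ H2).
  apply Derive_ext, E. }
split; evar_last.
- apply (grad_derive_eps d tau psi _ _ tau 0 0 G Tt R0 R0').
- rewrite V; apply RInt_ext; rewrite Rmin_left, Rmax_right by lra; intros s Hs.
  assert (Hs' : 0 <= s <= tau) by lra.
  rewrite (U _ (fun _ => 0) 0 (bE s 0 0) (fun e => b0 s e));
    [|apply is_derive_Rconst
     |apply (grad_derive_eps d tau b _ _ s 0 0 Gb Hs' R0 R0')].
  rewrite (U _ _ (a1 s) (aE s 0 0) (fun e => eq_refl) (Da s)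
    (grad_derive_eps d tau a _ _ s 0 0 Ga Hs' R0 R0')).
  rewrite Rmult_0_l; apply Rminus_0_r.
- apply (grad_derive_mu d tau psi _ _ tau 0 0 G Tt R0' R0).
- rewrite V, <- (RInt_opp b1).
  2: { apply (ex_RInt_ext (fun s => bM s 0 0)).
       - rewrite Rmin_left, Rmax_right by lra; intros s Hs.
         apply (U _ _ _ _ (fun m => eq_refl) (Db s)).
         apply (grad_derive_mu d tau b _ _ s 0 0 Gb); lra.
       - apply (@ex_RInt_continuous R_CompleteNormedModule); intros z _.
         apply (proj1 HbM), B0. }
  apply RInt_ext; rewrite Rmin_left, Rmax_right by lra; intros s Hs.
  assert (Hs' : 0 <= s <= tau) by lra.
  rewrite (U _ (fun _ => 0) 0 (aM s 0 0) (fun m => a0 s m));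
    [|apply is_derive_Rconst
     |apply (grad_derive_mu d tau a _ _ s 0 0 Ga Hs' R0' R0)].
  rewrite (U _ _ (b1 s) (bM s 0 0) (fun m => eq_refl) (Db s)
    (grad_derive_mu d tau b _ _ s 0 0 Gb Hs' R0' R0)), p0, cos_0; Rsimpl; ring.
Qed.

End ParametricSolution.

(** * Implicit functions *)

Lemma ex_derive_n_S (f f1 : R -> R) n x :
  locally x (fun y => is_derive f y (f1 y)) -> ex_derive_n f1 n x ->
  ex_derive_n f (S n) x.
Proof.
intros H Hn; destruct n as [|k].
- exists (f1 x); apply (locally_singleton _ _ H).
- change (ex_derive (Derive_n f (S k)) x).
  apply (ex_derive_ext_loc (Derive_n f1 k)); [|exact Hn].
  apply (filter_imp (fun y => locally y (fun z => Derive f z = f1 z))).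
  + intros y Hy; symmetry.
    replace (S k) with (k + 1)%nat by lia; rewrite <- Derive_n_comp.
    apply Derive_n_ext_loc, Hy.
  + apply locally_locally; apply (filter_imp (fun y => is_derive f y (f1 y))); [|exact H].
    intros z Hz; apply is_derive_unique, Hz.
Qed.

(** [e] is a curve in the box of radius [r], with slope [G]; the slope is a
    function of the point only, so that differentiating repeatedly along the
    curve never leaves the regular functions. *)
Definition integral_curve (r delta : R) (G : R -> R -> R) (e : R -> R) : Prop :=
  exists L K, 0 <= L /\ forall m, Rabs m < delta -> box r (e m) m /\
    forall m0, Rabs m0 < delta -> Rabs (e m - e m0) <= L * Rabs (m - m0) /\
      Rabs (e m - e m0 - G (e m0) m0 * (m - m0)) <= K * (m - m0) ^ 2.

Lemma open_interval delta m0 : Rabs m0 < delta -> 0 < delta - Rabs m0 /\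
  forall m, Rabs (m - m0) < delta - Rabs m0 -> Rabs m < delta.
Proof.
intros H; split; [lra|]; intros m Hm; replace m with ((m - m0) + m0) by ring.
eapply Rle_lt_trans; [apply Rabs_triang|lra].
Qed.

Lemma curve_derive r delta tau G e g gE gM m0 :
  0 <= tau -> integral_curve r delta G e -> has_gradient r tau g gE gM ->
  Rabs m0 < delta ->
  is_derive (fun m => g 0 (e m) m) m0 (gE 0 (e m0) m0 * G (e m0) m0 + gM 0 (e m0) m0).
Proof.
intros t0 (L & K & L0 & H) HG Hm0.
destruct (grad_pos_bound _ _ _ _ _ HG) as (C & C0 & HC).
destruct (open_interval delta m0 Hm0) as [d0 Hd].
apply (is_derive_quadratic _ _ _ _ (C * (L + 1) ^ 2 + Rabs (gE 0 (e m0) m0) * K) d0).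
intros m Hm; apply Hd in Hm.
destruct (H m Hm) as [B A]; destruct (A m0 Hm0) as [AL AK].
destruct (H m0 Hm0) as [B0 _].
assert (T0 : 0 <= 0 <= tau) by lra.
specialize (HC 0 (e m) m (e m0) m0 T0 B B0).
match goal with |- Rabs ?z <= _ => replace z with
  ((g 0 (e m) m - g 0 (e m0) m0 - gE 0 (e m0) m0 * (e m - e m0)
    - gM 0 (e m0) m0 * (m - m0))
   + gE 0 (e m0) m0 * (e m - e m0 - G (e m0) m0 * (m - m0))) by ring end.
eapply Rle_trans; [apply Rabs_triang|].
rewrite (Rmult_plus_distr_r (C * (L + 1) ^ 2)); apply Rplus_le_compat.
- eapply Rle_trans; [apply HC|]; rewrite Rmult_assoc; apply Rmult_le_compat_l; [easy|].
  rewrite <- (pow2_abs (m - m0)), <- Rpow_mult_distr; apply pow_incr.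
  split; [apply Rplus_le_le_0_compat; apply Rabs_pos|lra].
- rewrite Rabs_mult, Rmult_assoc; apply Rmult_le_compat_l; [apply Rabs_pos|easy].
Qed.

Lemma curve_smooth r delta tau G e n :
  0 <= tau -> integral_curve r delta G e ->
  (forall n, reg r tau n (fun _ => G)) -> forall g, reg r tau n g ->
  forall m, Rabs m < delta -> ex_derive_n (fun m => g 0 (e m) m) n m.
Proof.
intros t0 He HG; induction n as [|n IH]; intros g Hg m Hm; [easy|].
destruct Hg as [_ (gE & gM & HE & HM & Hgr)].
apply (ex_derive_n_S _ (fun m => gE 0 (e m) m * G (e m) m + gM 0 (e m) m)).
- destruct (open_interval delta m Hm) as [d0 Hd].
  exists (mkposreal _ d0); intros y Hy.
  apply (curve_derive r delta tau G e g gE gM); try easy; apply Hd, Hy.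
- apply (IH (fun t x y => gE t x y * G x y + gM t x y)); [|easy].
  apply (reg_plus r tau n (fun t x y => gE t x y * G x y)); [|easy].
  apply (reg_mult r tau n gE (fun _ => G)); [easy|apply HG].
Qed.

Lemma choose_curve (delta : R) (P : R -> R -> Prop) :
  (forall m, Rabs m < delta -> exists x, P m x) ->
  exists e : R -> R, forall m, Rabs m < delta -> P m (e m).
Proof.
intros H; apply (functional_choice (fun m x => Rabs m < delta -> P m x)).
intros m; destruct (Rlt_dec (Rabs m) delta) as [L|L].
- destruct (H m L) as [x Hx]; exists x; auto.
- exists 0; intros; contradiction.
Qed.

(** Where the derivative of [F] in its first argument is positive, the zero set is the graph of
    a Lipschitz function; the first order expansion of [F] at its zeros then
    gives the slope of this graph as a regular function of the point. *)
Lemma implicit_curve (d J : R) (F : R -> R -> R) :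
  0 < d -> 0 < J -> (forall n, reg d 0 n (fun _ => F)) -> F 0 0 = 0 ->
  is_derive (fun x => F x 0) 0 J -> is_derive (fun m => F 0 m) 0 (- J) ->
  exists (r delta C : R) (e : R -> R), 0 < delta <= r /\ r <= d /\
    (forall m, Rabs m < delta -> Rabs (e m) < r /\ F (e m) m = 0 /\
       (forall x, Rabs x <= r -> x < e m -> F x m < 0) /\
       Rabs (e m - m) <= C * m ^ 2) /\
    (forall n m, Rabs m < delta -> ex_derive_n e n m).
Proof.
intros d0 J0 HF F0 DE DM.
assert (T0 : 0 <= 0 <= 0) by lra.
destruct (HF 2%nat) as [_ (FE & FM & HE & HM & HG)].
destruct (grad_pos_bound _ _ _ _ _ HG) as (K & K0 & HK).
destruct (reg_lip d 0 0 FE HE) as (L & L0 & HL).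
destruct (reg_lip d 0 0 (fun _ => F) (HF 1%nat)) as (M & M0 & HM').
assert (B0 : box d 0 0) by (split; rewrite Rabs_R0; lra).
assert (R0 : Rabs 0 < d) by (rewrite Rabs_R0; lra).
assert (E0 : FE 0 0 0 = J).
{ rewrite <- (is_derive_unique _ _ _ DE); symmetry; apply is_derive_unique.
  apply (grad_derive_eps d 0 (fun _ => F) FE FM 0 0 0 HG T0 R0 (Rlt_le _ _ R0)). }
assert (M00 : FM 0 0 0 = - J).
{ rewrite <- (is_derive_unique _ _ _ DM); symmetry; apply is_derive_unique.
  apply (grad_derive_mu d 0 (fun _ => F) FE FM 0 0 0 HG T0 (Rlt_le _ _ R0) R0). }
(* on the box of radius [r] the difference quotients of [F] in its first
   argument are at least [J / 4] *)
set (r := Rmin (d / 2) (J / (8 * (K + L + 1)))).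
assert (KL : 0 < 8 * (K + L + 1)) by lra.
assert (r0 : 0 < r) by (apply Rmin_glb_lt; [lra|apply Rdiv_lt_0_compat; lra]).
assert (rd : r <= d / 2) by apply Rmin_l.
assert (rJ : 8 * (K + L + 1) * r <= J).
{ replace J with (8 * (K + L + 1) * (J / (8 * (K + L + 1)))) by (field; lra).
  apply Rmult_le_compat_l; [lra|apply Rmin_r]. }
assert (Kr : 0 <= K * r) by (apply Rmult_le_pos; lra).
assert (Lr : 0 <= L * r) by (apply Rmult_le_pos; lra).
assert (up : forall x m, box r x m -> box d x m)
  by (intros x m; apply box_mono; lra).
assert (FEJ : forall x m, box r x m -> J / 2 <= FE 0 x m).
{ intros x m B; specialize (HL 0 x m 0 0 T0 (up _ _ B) B0); rewrite E0, !Rminus_0_r in HL.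
  destruct B as [B1 B2]; apply Rabs_le_between in HL.
  assert (L * (Rabs x + Rabs m) <= L * (2 * r)) by (apply Rmult_le_compat_l; lra).
  lra. }
assert (Mono : forall x y m, box r x m -> box r y m -> x <= y ->
          J / 4 * (y - x) <= F y m - F x m).
{ intros x y m Bx By xy.
  specialize (HK 0 y m x m T0 (up _ _ By) (up _ _ Bx)).
  rewrite Rminus_diag, Rmult_0_r, Rminus_0_r, Rabs_R0, Rplus_0_r, pow2_abs in HK.
  apply Rabs_le_between in HK; specialize (FEJ x m Bx).
  assert (y - x <= 2 * r).
  { destruct Bx as [X _], By as [Y _].
    apply Rabs_le_between in X; apply Rabs_le_between in Y; lra. }
  assert (K * (y - x) ^ 2 <= J / 4 * (y - x)).
  { replace (K * (y - x) ^ 2) with (K * (y - x) * (y - x)) by ring.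
    apply Rmult_le_compat_r; [lra|].
    apply Rle_trans with (K * (2 * r)); [apply Rmult_le_compat_l; lra|lra]. }
  assert (J / 2 * (y - x) <= FE 0 x m * (y - x)) by (apply Rmult_le_compat_r; lra).
  lra. }
set (delta := Rmin r (J * r / (8 * (M + 1)))).
assert (dl0 : 0 < delta).
{ apply Rmin_glb_lt; [lra|apply Rdiv_lt_0_compat; [apply Rmult_lt_0_compat|]; lra]. }
assert (dlr : delta <= r) by apply Rmin_l.
assert (dlJ : 8 * (M + 1) * delta <= J * r).
{ replace (J * r) with (8 * (M + 1) * (J * r / (8 * (M + 1)))) by (field; lra).
  apply Rmult_le_compat_l; [lra|apply Rmin_r]. }
assert (bx : forall x m, Rabs x <= r -> Rabs m < delta -> box r x m)
  by (intros x m X Y; split; lra).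
assert (Ex : forall m, Rabs m < delta -> exists x, Rabs x < r /\ F x m = 0).
{ intros m Hm.
  assert (rr : Rabs r <= r) by (rewrite Rabs_pos_eq; lra).
  assert (rr' : Rabs (- r) <= r) by (rewrite Rabs_Ropp; easy).
  assert (r00 : Rabs 0 <= r) by (rewrite Rabs_R0; lra).
  assert (Sm : Rabs (F 0 m) <= M * delta).
  { specialize (HM' 0 0 m 0 0 T0 (up _ _ (bx _ _ r00 Hm)) B0).
    rewrite F0, !Rminus_0_r, Rabs_R0, Rplus_0_l in HM'.
    eapply Rle_trans; [apply HM'|apply Rmult_le_compat_l; lra]. }
  apply Rabs_le_between in Sm.
  assert (P := Mono 0 r m (bx _ _ r00 Hm) (bx _ _ rr Hm) ltac:(lra)).
  assert (N := Mono (- r) 0 m (bx _ _ rr' Hm) (bx _ _ r00 Hm) ltac:(lra)).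
  assert (Md : M * delta < J / 4 * r).
  { assert (0 <= M * delta) by (apply Rmult_le_pos; lra).
    assert (0 < J * r) by (apply Rmult_lt_0_compat; lra); lra. }
  destruct (Ranalysis5.IVT_interv (fun x => F x m) (- r) r) as (x & Hx & Zx);
    [|lra|lra|lra|].
  - intros x Hx; assert (Hx' : Rabs x < d) by (apply Rabs_lt_between; lra).
    apply continuity_pt_filterlim, (is_derive_continuous (fun x => F x m) x (FE 0 x m)).
    apply (grad_derive_eps d 0 (fun _ => F) FE FM 0 x m HG T0 Hx'); lra.
  - exists x; split; [|exact Zx]; apply Rabs_lt_between; split.
    + destruct (Req_dec x (- r)); [subst x; lra|lra].
    + destruct (Req_dec x r); [subst x; lra|lra]. }
destruct (choose_curve delta _ Ex) as [e He]; clear Ex.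
assert (be : forall m, Rabs m < delta -> box r (e m) m).
{ intros m Hm; apply bx; [|easy]; apply Rlt_le, He, Hm. }
assert (Lip : forall m m0, Rabs m < delta -> Rabs m0 < delta ->
          Rabs (e m - e m0) <= 4 * M / J * Rabs (m - m0)).
{ intros m m0 Hm Hm0.
  assert (b1 : box r (e m) m0) by (apply bx; [apply Rlt_le, He, Hm|easy]).
  specialize (HM' 0 (e m) m0 (e m) m T0 (up _ _ b1) (up _ _ (be _ Hm))).
  rewrite (proj2 (He m Hm)), Rminus_diag, Rabs_R0, Rplus_0_l, Rminus_0_r in HM'.
  rewrite Rabs_minus_sym in HM'.
  assert (A : J / 4 * Rabs (e m - e m0) <= Rabs (F (e m) m0)).
  { destruct (He m0 Hm0) as [_ Z0]; destruct (Rle_dec (e m) (e m0)) as [le|gt].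
    - assert (P := Mono _ _ _ b1 (be _ Hm0) le); rewrite Z0 in P.
      rewrite (Rabs_left1 (e m - e m0)) by lra.
      generalize (Rle_abs (- F (e m) m0)); rewrite Rabs_Ropp; lra.
    - assert (P := Mono _ _ _ (be _ Hm0) b1 ltac:(lra)); rewrite Z0 in P.
      rewrite (Rabs_pos_eq (e m - e m0)) by lra.
      generalize (Rle_abs (F (e m) m0)); lra. }
  apply Rmult_le_reg_l with (J / 4); [lra|].
  replace (J / 4 * (4 * M / J * Rabs (m - m0))) with (M * Rabs (m - m0)) by (field; lra).
  lra. }
set (G := fun x m => - (FM 0 x m * / FE 0 x m)).
assert (HGr : forall n, reg r 0 n (fun _ => G)).
{ intros n; destruct (HF (S n)) as [_ (fE & fM & HfE & HfM & Hf)].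
  assert (RE : reg r 0 n (fun _ x m => FE 0 x m)).
  { apply (reg_ext r 0 n (fun _ x m => fE 0 x m)).
    - intros _ x m [X Y]; transitivity (Derive (fun x => F x m) x);
        [symmetry|]; apply is_derive_unique.
      + apply (grad_derive_eps d 0 (fun _ => F) fE fM 0 x m Hf T0); lra.
      + apply (grad_derive_eps d 0 (fun _ => F) FE FM 0 x m HG T0); lra.
    - apply (reg_mono r d); [lra|apply (reg_eval d 0 0 n fE 0 T0 HfE)]. }
  assert (RM : reg r 0 n (fun _ x m => FM 0 x m)).
  { apply (reg_ext r 0 n (fun _ x m => fM 0 x m)).
    - intros _ x m [X Y]; transitivity (Derive (fun m => F x m) m);
        [symmetry|]; apply is_derive_unique.
      + apply (grad_derive_mu d 0 (fun _ => F) fE fM 0 x m Hf T0); lra.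
      + apply (grad_derive_mu d 0 (fun _ => F) FE FM 0 x m HG T0); lra.
    - apply (reg_mono r d); [lra|apply (reg_eval d 0 0 n fM 0 T0 HfM)]. }
  apply (reg_ext r 0 n (fun _ x m => -1 * (FM 0 x m * / FE 0 x m)));
    [intros; unfold G; ring|].
  apply reg_scal; [lra|]; apply (reg_mult r 0 n (fun _ x m => FM 0 x m)); [easy|].
  apply (reg_inv r 0 (Rle_refl 0) n (J / 2)); [lra| |easy].
  intros _ x m; apply FEJ. }
(* the Lipschitz constant of [e] *)
set (L' := 4 * M / J).
assert (L'0 : 0 <= L') by (unfold L'; apply Rmult_le_pos;
  [lra|apply Rlt_le, Rinv_0_lt_compat, J0]).
assert (Quad : forall m m0, Rabs m < delta -> Rabs m0 < delta ->
  Rabs (e m - e m0 - G (e m0) m0 * (m - m0)) <= 2 / J * K * (L' + 1) ^ 2 * (m - m0) ^ 2).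
{ intros m m0 Hm Hm0.
  specialize (HK 0 (e m) m (e m0) m0 T0 (up _ _ (be _ Hm)) (up _ _ (be _ Hm0))).
  rewrite (proj2 (He m Hm)), (proj2 (He m0 Hm0)) in HK.
  specialize (FEJ _ _ (be _ Hm0)).
  set (p := FE 0 (e m0) m0) in *; set (q := FM 0 (e m0) m0) in *.
  replace (e m - e m0 - G (e m0) m0 * (m - m0)) with
    (/ p * - (0 - 0 - p * (e m - e m0) - q * (m - m0)))
    by (unfold G; fold p q; field; lra).
  rewrite Rabs_mult, Rabs_Ropp, Rabs_pos_eq
    by (apply Rlt_le, Rinv_0_lt_compat; lra).
  replace (2 / J * K * (L' + 1) ^ 2 * (m - m0) ^ 2) with
    (2 / J * (K * (((L' + 1) * Rabs (m - m0)) ^ 2)))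
    by (rewrite Rpow_mult_distr, pow2_abs; ring).
  apply Rmult_le_compat; [apply Rlt_le, Rinv_0_lt_compat; lra|apply Rabs_pos| |].
  - replace (2 / J) with (/ (J / 2)) by (field; lra); apply Rinv_le_contravar; lra.
  - eapply Rle_trans; [apply HK|]; apply Rmult_le_compat_l; [easy|].
    apply pow_incr; specialize (Lip m m0 Hm Hm0); fold L' in Lip.
    split; [apply Rplus_le_le_0_compat; apply Rabs_pos|lra]. }
assert (dl00 : Rabs 0 < delta) by (rewrite Rabs_R0; easy).
assert (e0 : e 0 = 0).
{ assert (b00 : box r 0 0) by (split; lra).
  destruct (He 0 dl00) as [_ Z0]; destruct (Rle_dec (e 0) 0) as [H|H].
  - assert (P := Mono _ _ _ (be _ dl00) b00 H); rewrite Z0, F0 in P; nra.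
  - assert (P := Mono _ _ _ b00 (be _ dl00) ltac:(lra)); rewrite Z0, F0 in P; nra. }
exists r, delta, (2 / J * K * (L' + 1) ^ 2), e.
split; [lra|split; [lra|split]].
- intros m Hm; destruct (He m Hm) as [A Z]; split; [easy|split; [easy|split]].
  + intros x Hx xe; assert (P := Mono x (e m) m (bx _ _ Hx Hm) (be _ Hm) ltac:(lra)).
    rewrite Z in P; assert (0 < J / 4 * (e m - x)) by (apply Rmult_lt_0_compat; lra); lra.
  + specialize (Quad m 0 Hm dl00); rewrite e0, !Rminus_0_r in Quad.
    replace (G 0 0) with 1 in Quad by (unfold G; rewrite E0, M00; field; lra).
    rewrite Rmult_1_l in Quad; exact Quad.
- intros n m Hm.
  apply (curve_smooth r delta 0 G e n (Rle_refl 0)) with (g := fun _ x _ => x); try easy.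
  + exists L', (2 / J * K * (L' + 1) ^ 2); split; [easy|].
    intros m' Hm'; split; [apply be, Hm'|]; intros m0 Hm0; split; [apply Lip|apply Quad]; easy.
  + apply reg_eps; lra.
Qed.

(** * Derivatives of the curvature of the ellipse *)

(** [iw t] is the inverse of the speed of the ellipse.  The derivatives [k0],
    [k1], [k2], [k3] of [kappa], of orders 1 to 4, are polynomials in [cos t],
    [sin t] and [iw t]. *)
Definition usq (t : R) : R := 4 - 3 * cos t ^ 2.
Definition iw (t : R) : R := / sqrt (usq t).

Lemma usq_bounds t : 1 <= usq t <= 4.
Proof. unfold usq; generalize (COS_bound t); nra. Qed.

Lemma sqrt_usq_pos t : 0 < sqrt (usq t).
Proof. apply sqrt_lt_R0; generalize (usq_bounds t); lra. Qed.

Lemma iw_pos t : 0 < iw t.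
Proof. apply Rinv_0_lt_compat, sqrt_usq_pos. Qed.

Lemma iw_usq t : iw t ^ 2 * usq t = 1.
Proof.
unfold iw; generalize (sqrt_usq_pos t); intros.
rewrite <- (sqrt_sqrt (usq t)) at 2 by (generalize (usq_bounds t); lra).
field; lra.
Qed.

Lemma iw_le_1 t : iw t <= 1.
Proof.
generalize (iw_usq t) (iw_pos t) (usq_bounds t); intros; nra.
Qed.

Lemma sqrt_usq t : sqrt (usq t) = usq t * iw t.
Proof.
unfold iw; rewrite <- (sqrt_sqrt (usq t)) at 2 by (generalize (usq_bounds t); lra).
field; apply Rgt_not_eq, sqrt_usq_pos.
Qed.

Lemma sin_sq t : sin t ^ 2 = 1 - cos t ^ 2.
Proof. generalize (sin2_cos2 t); unfold Rsqr; lra. Qed.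

Lemma usq_derive t : is_derive usq t (6 * cos t * sin t).
Proof. unfold usq; auto_derive; [easy|ring]. Qed.

Lemma iw_derive t : is_derive iw t (- 3 * cos t * sin t * iw t ^ 3).
Proof.
generalize (sqrt_usq_pos t); intros; unfold iw; evar_last.
- apply is_derive_inv; [|lra].
  apply is_derive_sqrt; [apply usq_derive|generalize (usq_bounds t); lra].
- Rsimpl; field; lra.
Qed.

Definition k0 (t : R) : R := -18 * (cos t * sin t * iw t ^ 5).
Definition k1 (t : R) : R := -18 * ((9 * cos t ^ 4 - 4 * cos t ^ 2 - 4) * iw t ^ 7).
Definition k2 (t : R) : R :=
  -18 * (cos t * sin t * (- 81 * cos t ^ 4 - 84 * cos t ^ 2 + 116) * iw t ^ 9).
Definition k3 (t : R) : R :=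
  -18 * (((2 * cos t ^ 2 - 1) * (- 81 * cos t ^ 4 - 84 * cos t ^ 2 + 116) * usq t
          + 2 * cos t ^ 2 * (1 - cos t ^ 2) * (162 * cos t ^ 2 + 84) * usq t
          - 27 * cos t ^ 2 * (1 - cos t ^ 2) * (- 81 * cos t ^ 4 - 84 * cos t ^ 2 + 116))
         * iw t ^ 11).

Lemma poly_iw_derive (p : R -> R) (p' : R) n t : is_derive p t p' ->
  is_derive (fun t => -18 * (p t * iw t ^ n)) t
    (-18 * ((p' * usq t - 3 * INR n * cos t * sin t * p t) * iw t ^ (n + 2))).
Proof.
intros Hp; evar_last.
- apply is_derive_scal, (is_derive_mult p (fun t => iw t ^ n)); [apply Hp| |].
  + apply is_derive_pow, iw_derive.
  + intros; apply Rmult_comm.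
- rewrite pow_add; generalize (iw_usq t); intros E; Rsimpl.
  destruct n as [|n]; [simpl; rewrite !Rmult_1_r in *|].
  + transitivity (-18 * (p' * (iw t ^ 2 * usq t))); [rewrite E; ring|simpl; ring].
  + transitivity (-18 * (p' * (iw t ^ S n) * (iw t ^ 2 * usq t)
      + p t * (INR (S n) * (- 3 * cos t * sin t * iw t ^ 3) * iw t ^ n))).
    * rewrite E; simpl Nat.pred; ring.
    * rewrite <- tech_pow_Rmult; ring.
Qed.

Lemma k0_derive t : is_derive k0 t (k1 t).
Proof.
assert (P : is_derive (fun t => cos t * sin t) t (cos t ^ 2 - sin t ^ 2))
  by (auto_derive; [easy|ring]).
evar_last; [apply (poly_iw_derive _ _ 5 t P)|].
unfold k1, usq; simpl INR; simpl (5 + 2)%nat; generalize (sin_sq t).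
intros E; transitivity (-18 * (((cos t ^ 2 - sin t ^ 2) * (4 - 3 * cos t ^ 2)
  - 15 * cos t ^ 2 * sin t ^ 2) * iw t ^ 7)); [ring|rewrite E; ring].
Qed.

Lemma k1_derive t : is_derive k1 t (k2 t).
Proof.
assert (P : is_derive (fun t => 9 * cos t ^ 4 - 4 * cos t ^ 2 - 4) t
          (- 36 * cos t ^ 3 * sin t + 8 * cos t * sin t)) by (auto_derive; [easy|ring]).
evar_last; [apply (poly_iw_derive _ _ 7 t P)|].
unfold k2, usq; simpl INR; simpl (7 + 2)%nat; ring.
Qed.

Lemma k2_derive t : is_derive k2 t (k3 t).
Proof.
assert (P : is_derive (fun t => cos t * sin t * (- 81 * cos t ^ 4 - 84 * cos t ^ 2 + 116)) t
   ((cos t ^ 2 - sin t ^ 2) * (- 81 * cos t ^ 4 - 84 * cos t ^ 2 + 116)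
    + cos t * sin t * (324 * cos t ^ 3 * sin t + 168 * cos t * sin t)))
  by (auto_derive; [easy|ring]).
evar_last; [apply (poly_iw_derive _ _ 9 t P)|].
unfold k3, usq; simpl INR; simpl (9 + 2)%nat; generalize (sin_sq t).
intros E; transitivity (-18 * ((((cos t ^ 2 - sin t ^ 2)
    * (- 81 * cos t ^ 4 - 84 * cos t ^ 2 + 116)
    + cos t ^ 2 * sin t ^ 2 * (324 * cos t ^ 2 + 168)) * (4 - 3 * cos t ^ 2)
  - 27 * cos t ^ 2 * sin t ^ 2 * (- 81 * cos t ^ 4 - 84 * cos t ^ 2 + 116)) * iw t ^ 11));
  [ring|rewrite E; ring].
Qed.

Lemma k3_ex_derive t : ex_derive k3 t.
Proof.
unfold k3, usq; auto_derive.
repeat match goal with |- _ /\ _ => split end; try exact I; eexists; apply iw_derive.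
Qed.

Lemma Derive_kappa_k0 t : Derive kappa t = k0 t.
Proof.
rewrite Derive_kappa; fold (usq t).
replace (Rpower (usq t) (5 / 2)) with (sqrt (usq t) ^ 5).
- unfold k0, iw; generalize (sqrt_usq_pos t); intros; field; lra.
- rewrite <- Rpower_sqrt by (generalize (usq_bounds t); lra).
  rewrite <- Rpower_pow by apply exp_pos.
  rewrite Rpower_mult; f_equal; simpl; lra.
Qed.

Lemma k_continuous t :
  continuous iw t /\ continuous k0 t /\ continuous k1 t /\ continuous k2 t /\
  continuous k3 t.
Proof.
split; [eapply is_derive_continuous, iw_derive|].
split; [eapply is_derive_continuous, k0_derive|].
split; [eapply is_derive_continuous, k1_derive|].
split; [eapply is_derive_continuous, k2_derive|].
destruct (k3_ex_derive t) as [l Hl]; eapply is_derive_continuous, Hl.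
Qed.

Lemma abs_poly_iw p n K t : Rabs p <= K -> Rabs (-18 * (p * iw t ^ n)) <= 18 * K.
Proof.
intros H; rewrite Rabs_mult, (Rabs_left (-18)) by lra.
replace (- -18) with 18 by ring; apply Rmult_le_compat_l; [lra|].
apply Rabs_mult_le1; [easy|].
rewrite Rabs_pos_eq by (apply pow_le, Rlt_le, iw_pos).
rewrite <- (pow1 n); apply pow_incr; split; [apply Rlt_le, iw_pos|apply iw_le_1].
Qed.

Lemma k_bounds t : Rabs (k0 t) <= 18 /\ Rabs (k1 t) <= 306 /\ Rabs (k2 t) <= 5058.
Proof.
assert (C : 0 <= cos t ^ 2 <= 1) by (generalize (COS_bound t); nra).
assert (S : Rabs (cos t * sin t) <= 1)
  by (apply Rabs_mult_le1; [apply Rabs_cos_le|apply Rabs_sin_le]).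
split; [|split].
- replace 18 with (18 * 1) by ring; apply abs_poly_iw, S.
- replace 306 with (18 * 17) by ring; apply abs_poly_iw, Rabs_le; nra.
- replace 5058 with (18 * 281) by ring; apply abs_poly_iw.
  rewrite Rmult_comm; apply Rabs_mult_le1; [|easy].
  apply Rabs_le; nra.
Qed.

(** * The coefficients of the angle equation *)

Definition vsq (t e : R) : R := usq t + e ^ 2 * k1 t ^ 2.

(** [4 + e ^ 2 * qsq t] is the squared norm of the cross product of the first
    two derivatives of the center curve. *)
Definition qsq (t : R) : R :=
  (k2 t * cos t + k1 t * sin t) ^ 2 + 4 * (k2 t * sin t - k1 t * cos t) ^ 2.

(** Minus the speed times the torsion of the center curve. *)
Definition acoef (t e m : R) : R :=
  - 2 * (e * ((k1 t + k3 t) * (sqrt (vsq t e) * / (4 + e ^ 2 * qsq t)))).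

(** Minus the derivative of the radius times the curvature times the speed,
    divided by the square root of the difference between the squares of the
    speed and of the derivative of the radius. *)
Definition bcoef (t e m : R) : R :=
  -1 * (m * (k1 t * (sqrt (4 + e ^ 2 * qsq t)
     * / (vsq t e * sqrt (vsq t e - m ^ 2 * k1 t ^ 2))))).

(** Size of the parameter box: it keeps [vsq t e - m ^ 2 * k1 t ^ 2] away
    from zero. *)
Definition dbox : R := / 1000.

Lemma k1_small t m : Rabs m <= dbox -> 0 <= m ^ 2 * k1 t ^ 2 <= / 2.
Proof.
intros Hm; destruct (k_bounds t) as (_ & H & _).
rewrite <- Rpow_mult_distr, <- pow2_abs, Rabs_mult.
assert (Rabs m * Rabs (k1 t) <= dbox * 306)
  by (rewrite <- Rabs_mult; apply Rabs_mult_le; easy).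
assert (0 <= Rabs m * Rabs (k1 t)) by (apply Rmult_le_pos; apply Rabs_pos).
unfold dbox in *; nra.
Qed.

Lemma vsq_lower t e : 1 <= vsq t e.
Proof.
unfold vsq; generalize (usq_bounds t) (pow2_ge_0 (e * k1 t)); rewrite Rpow_mult_distr; lra.
Qed.

Lemma qsq_nonneg t : 0 <= qsq t.
Proof.
unfold qsq; generalize (pow2_ge_0 (k2 t * cos t + k1 t * sin t))
  (pow2_ge_0 (k2 t * sin t - k1 t * cos t)); lra.
Qed.

Lemma four_lower t e : 4 <= 4 + e ^ 2 * qsq t.
Proof. generalize (Rmult_le_pos _ _ (pow2_ge_0 e) (qsq_nonneg t)); lra. Qed.

Lemma vsq_gap t e m : Rabs m <= dbox -> / 2 <= vsq t e - m ^ 2 * k1 t ^ 2.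
Proof. intros H; generalize (vsq_lower t e) (k1_small t m H); lra. Qed.

Lemma qsq_continuous t : continuous qsq t.
Proof.
apply (ex_derive_continuous qsq); unfold qsq; auto_derive.
repeat match goal with |- _ /\ _ => split end; try exact I;
  match goal with
  | |- context [k1] => exists (k2 t); apply k1_derive
  | |- _ => exists (k3 t); apply k2_derive
  end.
Qed.

Section CoefReg.
Variable tau : R.
Hypothesis tau0 : 0 <= tau.

Lemma usq_reg n : reg dbox tau n (fun t _ _ => usq t).
Proof. apply reg_time; [easy|intros; eapply is_derive_continuous, usq_derive]. Qed.

Lemma k1_reg n : reg dbox tau n (fun t _ _ => k1 t).
Proof. apply reg_time; [easy|intros t; destruct (k_continuous t) as (_ & _ & C1 & _); exact C1]. Qed.

Lemma reg_sq n g : reg dbox tau n g -> reg dbox tau n (fun t e m => g t e m ^ 2).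
Proof.
intros H; apply (reg_ext dbox tau n (fun t e m => g t e m * g t e m));
  [intros; ring|apply reg_mult; easy].
Qed.

Lemma vsq_reg n : reg dbox tau n (fun t e _ => vsq t e).
Proof.
apply (reg_plus dbox tau n (fun t _ _ => usq t)); [apply usq_reg|].
apply (reg_mult dbox tau n (fun _ e _ => e ^ 2)).
- apply (reg_sq n (fun _ e _ => e)), reg_eps, tau0.
- apply (reg_sq n (fun t _ _ => k1 t)), k1_reg.
Qed.

Lemma four_reg n : reg dbox tau n (fun t e _ => 4 + e ^ 2 * qsq t).
Proof.
apply (reg_plus dbox tau n (fun _ _ _ => 4)); [apply reg_const, tau0|].
apply (reg_mult dbox tau n (fun _ e _ => e ^ 2)).
- apply (reg_sq n (fun _ e _ => e)), reg_eps, tau0.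
- apply reg_time; [easy|apply qsq_continuous].
Qed.

Lemma acoef_reg n : reg dbox tau n acoef.
Proof.
apply reg_scal; [easy|].
apply (reg_mult dbox tau n (fun _ e _ => e)); [apply reg_eps, tau0|].
apply (reg_mult dbox tau n (fun t _ _ => k1 t + k3 t)).
- apply (reg_time dbox tau tau0 n (fun t => k1 t + k3 t)); intros t.
  destruct (k_continuous t) as (_ & _ & C1 & _ & C3); apply (continuous_plus k1 k3 t C1 C3).
- apply (reg_mult dbox tau n (fun t e _ => sqrt (vsq t e))).
  + apply (reg_sqrt dbox tau tau0 n 1); [lra|intros; apply vsq_lower|apply vsq_reg].
  + apply (reg_inv dbox tau tau0 n 4); [lra|intros; apply four_lower|apply four_reg].
Qed.

Lemma bcoef_reg n : reg dbox tau n bcoef.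
Proof.
apply reg_scal; [easy|].
apply (reg_mult dbox tau n (fun _ _ m => m)); [apply reg_mu, tau0|].
apply (reg_mult dbox tau n (fun t _ _ => k1 t)); [apply k1_reg|].
apply (reg_mult dbox tau n (fun t e _ => sqrt (4 + e ^ 2 * qsq t))).
- apply (reg_sqrt dbox tau tau0 n 4); [lra|intros; apply four_lower|apply four_reg].
- apply (reg_inv dbox tau tau0 n (1 * sqrt (/ 2))).
  + generalize (sqrt_lt_R0 (/ 2)); lra.
  + intros t e m [_ B]; apply Rmult_le_compat; [lra|apply sqrt_pos|apply vsq_lower|].
    apply sqrt_le_1_alt, vsq_gap, B.
  + apply (reg_mult dbox tau n (fun t e _ => vsq t e)); [apply vsq_reg|].
    apply (reg_sqrt dbox tau tau0 n (/ 2)); [lra|intros t e m [_ B]; apply vsq_gap, B|].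
    apply (reg_ext dbox tau n (fun t e m => vsq t e + -1 * (m ^ 2 * k1 t ^ 2)));
      [intros; ring|].
    apply (reg_plus dbox tau n (fun t e _ => vsq t e)); [apply vsq_reg|].
    apply reg_scal; [easy|].
    apply (reg_mult dbox tau n (fun _ _ m => m ^ 2)).
    * apply (reg_sq n (fun _ _ m => m)), reg_mu, tau0.
    * apply (reg_sq n (fun t _ _ => k1 t)), k1_reg.
Qed.
End CoefReg.

Lemma cos_2PI_shift x k : cos (x + IZR k * (2 * PI)) = cos x.
Proof. rewrite !cos_sin, <- Rplus_assoc; apply sin_2PI_shift. Qed.

Lemma coef_shift t e m k :
  acoef (t + IZR k * (2 * PI)) e m = acoef t e m /\
  bcoef (t + IZR k * (2 * PI)) e m = bcoef t e m.
Proof.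
unfold acoef, bcoef, vsq, qsq, k3, k2, k1, iw, usq; rewrite cos_2PI_shift, sin_2PI_shift; easy.
Qed.

Lemma coef_even t e m : acoef (- t) e m = acoef t e m /\ bcoef (- t) e m = bcoef t e m.
Proof.
assert (E1 : k1 (- t) = k1 t) by (unfold k1, iw, usq; rewrite cos_neg; easy).
assert (E3 : k3 (- t) = k3 t) by (unfold k3, iw, usq; rewrite cos_neg; easy).
assert (E2 : k2 (- t) = - k2 t) by (unfold k2, iw, usq; rewrite cos_neg, sin_neg; ring).
assert (Eq : qsq (- t) = qsq t) by (unfold qsq; rewrite E1, E2, cos_neg, sin_neg; ring).
assert (Ev : vsq (- t) e = vsq t e) by (unfold vsq, usq; rewrite E1, cos_neg; easy).
unfold acoef, bcoef; rewrite E1, E3, Eq, Ev; easy.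
Qed.

Lemma coef_continuous e m t : box dbox e m ->
  continuous (fun t => acoef t e m) t /\ continuous (fun t => bcoef t e m) t.
Proof.
intros B; split.
- apply (proj1 (reg_bc _ _ _ _ (acoef_reg 1 Rle_0_1 0)) e m B).
- apply (proj1 (reg_bc _ _ _ _ (bcoef_reg 1 Rle_0_1 0)) e m B).
Qed.

Lemma coef_bounded e m : box dbox e m ->
  exists M, 0 < M /\ forall t, Rabs (acoef t e m) + Rabs (bcoef t e m) <= M.
Proof.
intros B.
assert (P : 0 <= 2 * PI) by (generalize PI_RGT_0; lra).
destruct (proj2 (reg_bc _ _ _ _ (acoef_reg _ P 0))) as [K HK].
destruct (proj2 (reg_bc _ _ _ _ (bcoef_reg _ P 0))) as [L HL].
exists (Rabs K + Rabs L + 1); split; [generalize (Rabs_pos K) (Rabs_pos L); lra|].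
intros t; destruct (mod_2PI 0 t) as (k & s & -> & Hs).
destruct (coef_shift s e m k) as [-> ->].
assert (Hs' : 0 <= s <= 2 * PI) by lra.
specialize (HK s e m Hs' B); specialize (HL s e m Hs' B).
generalize (Rle_abs K) (Rle_abs L); lra.
Qed.

(** * First order averages *)

(** The derivatives of [acoef] in [e] and of [bcoef] in [m] at the origin. *)
Definition a1 (t : R) : R := - / 2 * ((k1 t + k3 t) * (usq t * iw t)).
Definition b1 (t : R) : R := - 2 * (k1 t * iw t ^ 3).

Lemma acoef_derive_0 t : is_derive (fun e => acoef t e 0) 0 (a1 t).
Proof.
unfold acoef, vsq; generalize (usq_bounds t); intros U; auto_derive.
- split; [|split; [|easy]]; [lra|generalize (four_lower t 0); lra].
- replace (usq t + _) with (usq t) by ring; rewrite sqrt_usq.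
  unfold a1; generalize (iw_pos t); intros; field; split; nra.
Qed.

Lemma iw_cube t : iw t ^ 3 = / (usq t * (usq t * iw t)).
Proof.
generalize (iw_usq t) (iw_pos t) (usq_bounds t); intros E I U.
apply Rmult_eq_reg_r with (usq t * (usq t * iw t)).
- rewrite Rinv_l; [|repeat apply Rmult_integral_contrapositive_currified; lra].
  transitivity ((iw t ^ 2 * usq t) ^ 2); [ring|rewrite E; ring].
- repeat apply Rmult_integral_contrapositive_currified; lra.
Qed.

Lemma bcoef_derive_0 t : is_derive (fun m => bcoef t 0 m) 0 (b1 t).
Proof.
unfold bcoef, vsq; generalize (usq_bounds t) (sqrt_usq_pos t); intros U S.
replace (4 + 0 ^ 2 * qsq t) with (2 * 2) by ring; rewrite sqrt_square by lra.
replace (usq t + 0 ^ 2 * k1 t ^ 2) with (usq t) by ring.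
assert (E : usq t + - (0 * (0 * 1) * (k1 t * (k1 t * 1))) = usq t) by ring.
auto_derive.
- rewrite E; repeat split; try lra; apply Rgt_not_eq, Rmult_lt_0_compat; lra.
- rewrite E; unfold b1; rewrite iw_cube, sqrt_usq; generalize (iw_pos t); intros.
  field; lra.
Qed.

(** The average is an integral by parts: with [w] the speed of the ellipse and
    [kappa = 2 / w ^ 3] one has [w + w'' = 2 * kappa], so that [a1] and [b1]
    both differ from [k0 ^ 2] by derivatives of periodic functions. *)
Definition a1_prim (t : R) : R :=
  - / 2 * (usq t * iw t * k2 t - 3 * cos t * sin t * iw t * k1 t + 4 * iw t ^ 3 * k0 t).

Definition b1_prim (t : R) : R := - 2 * (iw t ^ 3 * k0 t).

(** The right hand side is the second derivative of the speed [usq * iw]. *)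
Lemma speed_identity t :
  4 * iw t ^ 3 - usq t * iw t
  = 3 * (cos t ^ 2 - sin t ^ 2) * iw t - 9 * cos t ^ 2 * sin t ^ 2 * iw t ^ 3.
Proof.
assert (E : iw t = iw t ^ 3 * usq t)
  by (transitivity (iw t * (iw t ^ 2 * usq t)); [rewrite iw_usq; ring|ring]).
rewrite E at 2 3; rewrite sin_sq; unfold usq; ring.
Qed.

Lemma a1_prim_derive t : is_derive a1_prim t (a1 t - k0 t ^ 2).
Proof.
unfold a1_prim; auto_derive.
- repeat match goal with |- _ /\ _ => split end; try exact I;
  match goal with
  | |- context [usq] => exists (6 * cos t * sin t); apply usq_derive
  | |- context [iw] => exists (- 3 * cos t * sin t * iw t ^ 3); apply iw_derive
  | |- context [k0] => exists (k1 t); apply k0_derive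
  | |- context [k1] => exists (k2 t); apply k1_derive
  | |- context [k2] => exists (k3 t); apply k2_derive
  end.
- replace (Derive (fun x : R => usq x) t) with (6 * cos t * sin t)
    by (symmetry; apply is_derive_unique; exact (usq_derive t));
  replace (Derive (fun x : R => iw x) t) with (- 3 * cos t * sin t * iw t ^ 3)
    by (symmetry; apply is_derive_unique; exact (iw_derive t));
  replace (Derive (fun x : R => k0 x) t) with (k1 t)
    by (symmetry; apply is_derive_unique; exact (k0_derive t));
  replace (Derive (fun x : R => k1 x) t) with (k2 t)
    by (symmetry; apply is_derive_unique; exact (k1_derive t));
  replace (Derive (fun x : R => k2 x) t) with (k3 t)
    by (symmetry; apply is_derive_unique; exact (k2_derive t)).
  assert (E1 : usq t * iw t ^ 3 = iw t)
    by (transitivity (iw t * (iw t ^ 2 * usq t)); [ring|rewrite iw_usq; ring]).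
  transitivity (- / 2 * ((6 * cos t * sin t * iw t - 3 * cos t * sin t * (usq t * iw t ^ 3)
      - 3 * cos t * sin t * iw t) * k2 t + usq t * iw t * k3 t
    - (3 * (cos t ^ 2 - sin t ^ 2) * iw t - 9 * cos t ^ 2 * sin t ^ 2 * iw t ^ 3) * k1 t
    + 2 * (-18 * (cos t * sin t * iw t ^ 5)) * k0 t + 4 * iw t ^ 3 * k1 t)); [ring|].
  rewrite E1, <- (speed_identity t).
  fold (k0 t); unfold a1; field.
Qed.

Lemma b1_prim_derive t : is_derive b1_prim t (b1 t - k0 t ^ 2).
Proof.
unfold b1_prim; auto_derive.
- repeat match goal with |- _ /\ _ => split end; try exact I;
  match goal with
  | |- context [iw] => exists (- 3 * cos t * sin t * iw t ^ 3); apply iw_derive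
  | |- context [k0] => exists (k1 t); apply k0_derive
  end.
- replace (Derive (fun x : R => iw x) t) with (- 3 * cos t * sin t * iw t ^ 3)
    by (symmetry; apply is_derive_unique; exact (iw_derive t));
  replace (Derive (fun x : R => k0 x) t) with (k1 t)
    by (symmetry; apply is_derive_unique; exact (k0_derive t)).
  unfold b1.
  transitivity (- 2 * (k1 t * iw t ^ 3) - (-18 * (cos t * sin t * iw t ^ 5)) * k0 t); [ring|].
  fold (k0 t); ring.
Qed.

Definition J0 : R := RInt (fun t => k0 t ^ 2) 0 PI.

Lemma prim_average (g P : R -> R) : (forall t, continuous g t) ->
  (forall t, is_derive P t (g t - k0 t ^ 2)) -> P 0 = 0 -> P PI = 0 -> RInt g 0 PI = J0.
Proof.
intros Hg HP P0 PPI.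
assert (Ck : forall t, continuous (fun t => k0 t ^ 2) t).
{ intros t; eapply is_derive_continuous, is_derive_pow, k0_derive. }
set (z := fun t => RInt g 0 t - RInt (fun t => k0 t ^ 2) 0 t - P t).
assert (E : z PI = z 0).
{ apply derive_zero_eq; intros s; evar_last.
  - apply (is_derive_minus (fun t => RInt g 0 t - RInt (fun t => k0 t ^ 2) 0 t) P);
      [|apply HP].
    apply (is_derive_minus (fun t => RInt g 0 t)); apply is_derive_RInt0; assumption.
  - Rsimpl; ring. }
unfold z in E; rewrite !RInt_00, P0, PPI in E; unfold J0; lra.
Qed.

Lemma k_odd_zero t : sin t = 0 -> k0 t = 0 /\ k2 t = 0.
Proof. intros E; unfold k0, k2; rewrite E; split; ring. Qed.

Lemma average_a1 : RInt a1 0 PI = J0.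
Proof.
apply (prim_average a1 a1_prim).
- intros t; destruct (k_continuous t) as (Ci & _ & C1 & _ & C3); unfold a1.
  apply (continuous_scal_r (- / 2) (fun t => (k1 t + k3 t) * (usq t * iw t))).
  apply (continuous_mult (fun t => k1 t + k3 t)).
  + apply (continuous_plus k1 k3 t C1 C3).
  + apply (continuous_mult usq iw t); [eapply is_derive_continuous, usq_derive|apply Ci].
- apply a1_prim_derive.
- destruct (k_odd_zero 0 sin_0) as [E0 E2]; unfold a1_prim; rewrite E0, E2, sin_0; ring.
- destruct (k_odd_zero PI sin_PI) as [E0 E2]; unfold a1_prim; rewrite E0, E2, sin_PI; ring.
Qed.

Lemma average_b1 : RInt b1 0 PI = J0.
Proof.
apply (prim_average b1 b1_prim).
- intros t; destruct (k_continuous t) as (_ & _ & C1 & _); unfold b1.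
  apply (continuous_scal_r (- 2) (fun t => k1 t * iw t ^ 3)).
  apply (continuous_mult k1 (fun t => iw t ^ 3)); [apply C1|].
  eapply is_derive_continuous, is_derive_pow, iw_derive.
- apply b1_prim_derive.
- destruct (k_odd_zero 0 sin_0) as [E0 _]; unfold b1_prim; rewrite E0; ring.
- destruct (k_odd_zero PI sin_PI) as [E0 _]; unfold b1_prim; rewrite E0; ring.
Qed.

Lemma J0_pos : 0 < J0.
Proof.
assert (P := PI_RGT_0).
assert (Ck : forall t, continuous (fun t => k0 t ^ 2) t).
{ intros t; eapply is_derive_continuous, is_derive_pow, k0_derive. }
apply Rlt_le_trans with (RInt (fun t => k0 t ^ 2) 0 (PI / 2)).
- apply RInt_gt_0; [lra| |intros; apply Ck].
  intros t Ht; apply pow2_gt_0; unfold k0.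
  assert (0 < cos t) by (apply cos_gt_0; lra).
  assert (0 < sin t) by (apply sin_gt_0; lra).
  apply Rlt_not_eq.
  assert (0 < cos t * sin t * iw t ^ 5); [|lra].
  apply Rmult_lt_0_compat; [apply Rmult_lt_0_compat; easy|apply pow_lt, iw_pos].
- apply (derive_nonneg_le (fun t => RInt (fun t => k0 t ^ 2) 0 t) (fun t => k0 t ^ 2)); [lra|].
  intros s _; split; [apply (is_derive_RInt0 (fun t => k0 t ^ 2)), Ck|apply pow2_ge_0].
Qed.

(** * Vector calculus *)

Lemma vec_ext (v w : vec) : vx v = vx w -> vy v = vy w -> vz v = vz w -> v = w.
Proof.
destruct v as [[v1 v2] v3], w as [[w1 w2] w3]; unfold vx, vy, vz; simpl.
intros -> -> ->; easy.
Qed.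

Lemma vx_plus (v w : vec) : vx (plus v w) = vx v + vx w. Proof. reflexivity. Qed.
Lemma vy_plus (v w : vec) : vy (plus v w) = vy v + vy w. Proof. reflexivity. Qed.
Lemma vz_plus (v w : vec) : vz (plus v w) = vz v + vz w. Proof. reflexivity. Qed.
Lemma vx_scal k (v : vec) : vx (scal k v) = k * vx v. Proof. reflexivity. Qed.
Lemma vy_scal k (v : vec) : vy (scal k v) = k * vy v. Proof. reflexivity. Qed.
Lemma vz_scal k (v : vec) : vz (scal k v) = k * vz v. Proof. reflexivity. Qed.
Lemma vx_mk x y z : vx (x, y, z) = x. Proof. reflexivity. Qed.
Lemma vy_mk x y z : vy (x, y, z) = y. Proof. reflexivity. Qed.
Lemma vz_mk x y z : vz (x, y, z) = z. Proof. reflexivity. Qed.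

Lemma vx_zero : vx zero = 0. Proof. reflexivity. Qed.
Lemma vy_zero : vy zero = 0. Proof. reflexivity. Qed.
Lemma vz_zero : vz zero = 0. Proof. reflexivity. Qed.

Ltac vsimpl := unfold dot, cross; repeat first
  [ rewrite vx_plus | rewrite vy_plus | rewrite vz_plus
  | rewrite vx_scal | rewrite vy_scal | rewrite vz_scal
  | rewrite vx_zero | rewrite vy_zero | rewrite vz_zero
  | rewrite vx_mk | rewrite vy_mk | rewrite vz_mk ].

Definition vderive (f : R -> vec) (t : R) (l : vec) : Prop :=
  is_derive (fun u => vx (f u)) t (vx l) /\ is_derive (fun u => vy (f u)) t (vy l) /\
  is_derive (fun u => vz (f u)) t (vz l).

Lemma vderive_unique f t l : vderive f t l -> vDerive f t = l.
Proof.
intros (X & Y & Z); apply vec_ext; apply is_derive_unique; assumption.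
Qed.

Lemma vDerive_ext f g t : (forall u, f u = g u) -> vDerive f t = vDerive g t.
Proof.
intros E; apply vec_ext; apply Derive_ext; intros u; rewrite E; easy.
Qed.

Lemma vderive_eq f t l l' : vderive f t l -> l = l' -> vderive f t l'.
Proof. intros H <-; exact H. Qed.

Lemma vderive_const (w : vec) t : vderive (fun _ => w) t zero.
Proof. split; [|split]; apply is_derive_Rconst. Qed.

Lemma vderive_ext f g t l : (forall u, f u = g u) -> vderive f t l -> vderive g t l.
Proof.
intros E (X & Y & Z); split; [|split];
  [eapply is_derive_ext, X|eapply is_derive_ext, Y|eapply is_derive_ext, Z];
  intros u; simpl; rewrite E; easy.
Qed.

Lemma vderive_plus f g t f' g' : vderive f t f' -> vderive g t g' ->
  vderive (fun u => plus (f u) (g u)) t (plus f' g').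
Proof.
intros (X & Y & Z) (X' & Y' & Z'); split; [|split].
- apply (is_derive_plus _ _ _ _ _ X X').
- apply (is_derive_plus _ _ _ _ _ Y Y').
- apply (is_derive_plus _ _ _ _ _ Z Z').
Qed.

Lemma vderive_scal (h : R -> R) f t h' f' : is_derive h t h' -> vderive f t f' ->
  vderive (fun u => scal (h u) (f u)) t (plus (scal h' (f t)) (scal (h t) f')).
Proof.
intros H (X & Y & Z); split; [|split].
- exact (is_derive_Rmult h (fun u => vx (f u)) _ _ _ H X).
- exact (is_derive_Rmult h (fun u => vy (f u)) _ _ _ H Y).
- exact (is_derive_Rmult h (fun u => vz (f u)) _ _ _ H Z).
Qed.

Lemma dot_derive f g t f' g' : vderive f t f' -> vderive g t g' ->
  is_derive (fun u => dot (f u) (g u)) t (dot f' (g t) + dot (f t) g').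
Proof.
intros (X & Y & Z) (X' & Y' & Z'); unfold dot; evar_last.
- apply is_derive_Rplus; [apply is_derive_Rplus|]; apply is_derive_Rmult; eassumption.
- cbv beta; ring.
Qed.

Lemma cross_derive f g t f' g' : vderive f t f' -> vderive g t g' ->
  vderive (fun u => cross (f u) (g u)) t (plus (cross f' (g t)) (cross (f t) g')).
Proof.
intros (X & Y & Z) (X' & Y' & Z'); split; [|split]; unfold cross; evar_last.
- apply (is_derive_Rminus (fun u => vy (f u) * vz (g u)) (fun u => vz (f u) * vy (g u)));
    apply is_derive_Rmult; eassumption.
- cbv beta; vsimpl; ring.
- apply (is_derive_Rminus (fun u => vz (f u) * vx (g u)) (fun u => vx (f u) * vz (g u)));
    apply is_derive_Rmult; eassumption.
- cbv beta; vsimpl; ring.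
- apply (is_derive_Rminus (fun u => vx (f u) * vy (g u)) (fun u => vy (f u) * vx (g u)));
    apply is_derive_Rmult; eassumption.
- cbv beta; vsimpl; ring.
Qed.

Lemma dot_nonneg v : 0 <= dot v v.
Proof.
unfold dot; generalize (Rle_0_sqr (vx v)) (Rle_0_sqr (vy v)) (Rle_0_sqr (vz v)).
unfold Rsqr; lra.
Qed.

Lemma vnorm_sq v : vnorm v * vnorm v = dot v v.
Proof. apply sqrt_sqrt, dot_nonneg. Qed.

Lemma vnorm_scal k v : 0 <= k -> dot v v = 1 -> vnorm (scal k v) = k.
Proof.
intros k0 H; apply sqrt_lem_1; [apply dot_nonneg|easy|].
transitivity (k * k * dot v v); [rewrite H; ring|unfold dot; vsimpl; ring].
Qed.

(** * Moving frames *)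

(** In frame coordinates the geometry of a canal surface becomes algebra:
    [comb] preserves both products, and it is differentiated by the Frenet
    equations. *)
Definition comb (T N x : vec) : vec :=
  plus (scal (vx x) T) (plus (scal (vy x) N) (scal (vz x) (cross T N))).

Definition orthonormal (T N : vec) : Prop := dot T T = 1 /\ dot N N = 1 /\ dot T N = 0.

Lemma cross_T (T N : vec) : orthonormal T N -> cross N (cross T N) = T.
Proof.
intros (HT & HN & HTN).
assert (E : cross N (cross T N) = plus (scal (dot N N) T) (scal (- dot T N) N))
  by (apply vec_ext; vsimpl; ring).
rewrite E, HN, HTN; apply vec_ext; vsimpl; ring.
Qed.

Lemma cross_N (T N : vec) : orthonormal T N -> cross (cross T N) T = N.
Proof.
intros (HT & HN & HTN).
assert (E : cross (cross T N) T = plus (scal (dot T T) N) (scal (- dot T N) T))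
  by (apply vec_ext; vsimpl; ring).
rewrite E, HT, HTN; apply vec_ext; vsimpl; ring.
Qed.

Lemma comb_cross T N x y : orthonormal T N ->
  cross (comb T N x) (comb T N y) = comb T N (cross x y).
Proof.
intros H.
transitivity (plus (scal (vy x * vz y - vz x * vy y) (cross N (cross T N)))
  (plus (scal (vz x * vx y - vx x * vz y) (cross (cross T N) T))
        (scal (vx x * vy y - vy x * vx y) (cross T N)))).
- assert (Bil : forall B, cross (plus (scal (vx x) T) (plus (scal (vy x) N) (scal (vz x) B)))
      (plus (scal (vx y) T) (plus (scal (vy y) N) (scal (vz y) B))) =
    plus (scal (vy x * vz y - vz x * vy y) (cross N B))
      (plus (scal (vz x * vx y - vx x * vz y) (cross B T))
            (scal (vx x * vy y - vy x * vx y) (cross T N))))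
    by (intros B; apply vec_ext; vsimpl; ring).
  apply Bil.
- rewrite cross_T, cross_N by easy; reflexivity.
Qed.

Lemma comb_dot T N x y : orthonormal T N -> dot (comb T N x) (comb T N y) = dot x y.
Proof.
intros (HT & HN & HTN).
assert (HB : dot (cross T N) (cross T N) = dot T T * dot N N - dot T N * dot T N)
  by (vsimpl; ring).
assert (HTB : dot T (cross T N) = 0) by (vsimpl; ring).
assert (HNB : dot N (cross T N) = 0) by (vsimpl; ring).
transitivity (vx x * vx y * dot T T + vy x * vy y * dot N N
  + vz x * vz y * dot (cross T N) (cross T N)
  + (vx x * vy y + vy x * vx y) * dot T N + (vx x * vz y + vz x * vx y) * dot T (cross T N)
  + (vy x * vz y + vz x * vy y) * dot N (cross T N)).
- clear; unfold comb; generalize (cross T N); intros B; vsimpl; ring.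
- rewrite HB, HTB, HNB, HT, HN, HTN; vsimpl; ring.
Qed.

Lemma comb_plus T N x y : plus (comb T N x) (comb T N y) = comb T N (plus x y).
Proof. apply vec_ext; unfold comb; vsimpl; ring. Qed.

Lemma comb_scal T N k x : scal k (comb T N x) = comb T N (scal k x).
Proof. apply vec_ext; unfold comb; vsimpl; ring. Qed.

Lemma comb_inj T N x y : orthonormal T N -> comb T N x = comb T N y -> x = y.
Proof.
intros H E.
assert (D : forall z, dot x z = dot y z) by (intros z;
  rewrite <- (comb_dot T N x z H), <- (comb_dot T N y z H), E; easy).
apply vec_ext.
- generalize (D (1, 0, 0)); unfold dot; vsimpl; lra.
- generalize (D (0, 1, 0)); unfold dot; vsimpl; lra.
- generalize (D (0, 0, 1)); unfold dot; vsimpl; lra.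
Qed.

Lemma comb_derive (T N : R -> vec) (x : R -> vec) (p q : R) (t : R) (x' : vec) :
  orthonormal (T t) (N t) ->
  vderive T t (scal p (N t)) ->
  vderive N t (plus (scal (- p) (T t)) (scal q (cross (T t) (N t)))) ->
  vderive x t x' ->
  vderive (fun u => comb (T u) (N u) (x u)) t
    (comb (T t) (N t) (plus x' (- p * vy (x t), p * vx (x t) - q * vz (x t), q * vy (x t)))).
Proof.
intros H HT HN (X & Y & Z).
assert (HB := cross_derive _ _ _ _ _ HT HN).
assert (D := vderive_plus _ _ _ _ _ (vderive_scal _ _ _ _ _ X HT)
  (vderive_plus _ _ _ _ _ (vderive_scal _ _ _ _ _ Y HN) (vderive_scal _ _ _ _ _ Z HB))).
apply (vderive_eq _ _ _ _ D).
assert (E : plus (cross (scal p (N t)) (N t))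
  (cross (T t) (plus (scal (- p) (T t)) (scal q (cross (T t) (N t))))) = scal (- q) (N t)).
{ transitivity (scal (- q) (cross (cross (T t) (N t)) (T t))).
  - generalize (cross (T t) (N t)); intros B; apply vec_ext; vsimpl; ring.
  - rewrite cross_N; easy. }
rewrite E; unfold comb; generalize (cross (T t) (N t)); intros B.
apply vec_ext; vsimpl; ring.
Qed.

Lemma cos_sq x : cos x * cos x = 1 - sin x * sin x.
Proof. generalize (sin2_cos2 x); unfold Rsqr; lra. Qed.

(** * Principal directions of a canal surface *)

(** The curve is given through its Frenet equations in the parameter [t]: [v]
    is the speed, [p] and [q] are the speed times the curvature and times the
    torsion.  [C] and [S] are the cosine and sine of [theta], and [G > 0] is
    the condition for an immersion. *)
Section CanalFrame.

Variables (c : R -> vec) (r v p q r1 C1 : R -> R).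
Notation T := (tangent c).
Notation N := (normal c).
Let C (t : R) : R := - dds c r t.
Let S (t : R) : R := sqrt (1 - C t ^ 2).
Let lam (t phi : R) : R := - (C1 t / S t) + p t * cos phi.
Let H (t phi : R) : R := q t * S t - p t * C t * sin phi.
Let G (t phi : R) : R := v t * S t - r t * lam t phi.

Hypothesis frame : forall t, orthonormal (T t) (N t).
Hypothesis c_derive : forall t, vderive c t (scal (v t) (T t)).
Hypothesis T_derive : forall t, vderive T t (scal (p t) (N t)).
Hypothesis N_derive : forall t,
  vderive N t (plus (scal (- p t) (T t)) (scal (q t) (cross (T t) (N t)))).
Hypothesis r_pos : forall t, 0 < r t.
Hypothesis v_pos : forall t, 0 < v t.
Hypothesis r_derive : forall t, is_derive r t (r1 t).
Hypothesis r1_eq : forall t, r1 t = - v t * C t.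
Hypothesis C_derive : forall t, is_derive (fun t => - dds c r t) t (C1 t).
Hypothesis C_bound : forall t, Rabs (dds c r t) < 1.
Hypothesis G_pos : forall t phi, 0 < G t phi.

Lemma C_sq t : 0 < 1 - C t ^ 2.
Proof.
unfold C; generalize (C_bound t); intros B; apply Rabs_lt_between in B.
replace ((- dds c r t) ^ 2) with (dds c r t ^ 2) by ring; nra.
Qed.

Lemma S_pos t : 0 < S t.
Proof. apply sqrt_lt_R0, C_sq. Qed.

Lemma S_sq t : S t * S t = 1 - C t * C t.
Proof.
unfold S; rewrite sqrt_sqrt by (apply Rlt_le, C_sq); ring.
Qed.

Lemma S_derive t : is_derive S t (- C t * (C1 t / S t)).
Proof.
unfold S; evar_last.
- apply (is_derive_sqrt (fun t => 1 - C t ^ 2)); [|apply C_sq].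
  apply is_derive_Rminus; [apply is_derive_Rconst|].
  apply is_derive_pow, C_derive.
- fold (S t); generalize (S_pos t); intros; simpl; unfold C; field; lra.
Qed.

(** Coordinates, in the Frenet frame, of the unit vector from the center to
    the surface, and of the orthonormal basis of the tangent plane consisting
    of its derivative with respect to [theta] and the direction of the circle. *)
Definition ray (t phi : R) : vec := (C t, S t * cos phi, S t * sin phi).
Definition tplane (t phi x y : R) : vec :=
  comb (T t) (N t) (- S t * x, C t * cos phi * x - sin phi * y,
                    C t * sin phi * x + cos phi * y).

Lemma canal_comb t phi :
  canal c r t phi = plus (c t) (comb (T t) (N t) (scal (r t) (ray t phi))).
Proof.
unfold canal, theta; fold (C t).
assert (B : -1 <= C t <= 1)
  by (generalize (C_bound t); intros B; apply Rabs_lt_between in B; unfold C; lra).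
rewrite cos_acos, sin_acos by easy.
replace (sqrt (1 - (C t)²)) with (S t) by (unfold S, Rsqr; f_equal; ring).
unfold binormal, comb, ray; generalize (cross (T t) (N t)); intros; apply vec_ext; vsimpl; ring.
Qed.

Lemma sphere_derive_t (f f1 : R -> R) t phi : is_derive f t (f1 t) ->
  vderive (fun u => comb (T u) (N u) (scal (f u) (ray u phi))) t
    (plus (scal (f1 t) (comb (T t) (N t) (ray t phi)))
          (tplane t phi (f t * lam t phi) (f t * H t phi))).
Proof.
intros Hf.
assert (D : vderive (fun u => scal (f u) (ray u phi)) t
  (f1 t * C t + f t * C1 t, (f1 t * S t + f t * (- C t * (C1 t / S t))) * cos phi,
   (f1 t * S t + f t * (- C t * (C1 t / S t))) * sin phi)).
{ assert (DS := is_derive_Rmult _ _ _ _ _ Hf (S_derive t)).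
  split; [|split].
  - exact (is_derive_Rmult _ _ _ _ _ Hf (C_derive t)).
  - apply (is_derive_ext (fun u => f u * S u * cos phi)); [intros; apply Rmult_assoc|].
    apply (is_derive_scal_l (fun u => f u * S u) t _ (cos phi) DS).
  - apply (is_derive_ext (fun u => f u * S u * sin phi)); [intros; apply Rmult_assoc|].
    apply (is_derive_scal_l (fun u => f u * S u) t _ (sin phi) DS). }
assert (E := comb_derive T N _ (p t) (q t) t _ (frame t) (T_derive t) (N_derive t) D).
apply (vderive_eq _ _ _ _ E).
unfold tplane; rewrite comb_scal, comb_plus; f_equal.
unfold lam, H, ray; generalize (S_sq t) (S_pos t); intros SS S0.
assert (EC : C1 t = C1 t / S t * S t) by (field; lra).
set (k := C1 t / S t) in *; rewrite EC.
assert (cs := cos_sq phi).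
apply vec_ext; vsimpl.
- ring.
- apply Rminus_diag_uniq; match goal with |- ?z = 0 => replace z with
    (f t * p t * C t * (1 - sin phi * sin phi - cos phi * cos phi)) by ring end.
  rewrite cs; ring.
- ring.
Qed.

Lemma ray_derive_phi (k t phi : R) :
  vderive (fun y => comb (T t) (N t) (scal k (ray t y))) phi (tplane t phi 0 (k * S t)).
Proof.
assert (D : vderive (fun y => scal k (ray t y)) phi
  (0, k * S t * - sin phi, k * S t * cos phi)).
{ split; [|split].
  - apply (is_derive_Rconst (k * C t)).
  - apply (is_derive_ext (fun y => k * S t * cos y)); [intros; apply Rmult_assoc|].
    apply is_derive_scal, is_derive_cos.
  - apply (is_derive_ext (fun y => k * S t * sin y)); [intros; apply Rmult_assoc|].
    apply is_derive_scal, is_derive_sin. }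
assert (ZT : vderive (fun _ => T t) phi (scal 0 (N t)))
  by (apply (vderive_eq _ _ _ _ (vderive_const _ phi)), vec_ext; vsimpl; ring).
assert (ZN : vderive (fun _ => N t) phi
    (plus (scal (- 0) (T t)) (scal 0 (cross (T t) (N t)))))
  by (apply (vderive_eq _ _ _ _ (vderive_const _ phi)), vec_ext; vsimpl; ring).
assert (E := comb_derive (fun _ => T t) (fun _ => N t) _ 0 0 phi _ (frame t) ZT ZN D).
apply (vderive_eq _ _ _ _ E).
unfold tplane; f_equal; apply vec_ext; vsimpl; ring.
Qed.

Lemma tplane_lin t phi a b x y x' y' :
  plus (scal a (tplane t phi x y)) (scal b (tplane t phi x' y')) =
  tplane t phi (a * x + b * x') (a * y + b * y').
Proof.
unfold tplane; rewrite !comb_scal, comb_plus; f_equal; apply vec_ext; vsimpl; ring.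
Qed.

Lemma tplane_inj t phi x y x' y' :
  tplane t phi x y = tplane t phi x' y' -> x = x' /\ y = y'.
Proof.
intros E; apply (comb_inj (T t) (N t) _ _ (frame t)) in E.
assert (SS := S_sq t); assert (cs := cos_sq phi).
assert (E1 := f_equal vx E); assert (E2 := f_equal vy E); assert (E3 := f_equal vz E).
rewrite !vx_mk in E1; rewrite !vy_mk in E2; rewrite !vz_mk in E3.
assert (Ex : x = x').
{ apply Rmult_eq_reg_l with (- S t); [easy|generalize (S_pos t); lra]. }
split; [easy|]; subst x'.
transitivity (cos phi * (cos phi * y) + sin phi * (sin phi * y));
  [|transitivity (cos phi * (cos phi * y') + sin phi * (sin phi * y'))].
- transitivity (cos phi * cos phi * y + sin phi * sin phi * y); [rewrite cs|]; ring.
- replace (cos phi * y) with (cos phi * y') by lra.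
  replace (sin phi * y) with (sin phi * y') by lra; easy.
- transitivity (cos phi * cos phi * y' + sin phi * sin phi * y'); [|rewrite cs]; ring.
Qed.

Lemma tplane_cross t phi x y x' y' :
  cross (tplane t phi x y) (tplane t phi x' y') =
  scal (x * y' - y * x') (comb (T t) (N t) (ray t phi)).
Proof.
unfold tplane; rewrite comb_cross, comb_scal by apply frame; f_equal; unfold ray.
assert (cs := cos_sq phi); assert (SS := S_sq t).
apply vec_ext; vsimpl.
- transitivity (C t * (x * y' - y * x') * (cos phi * cos phi + sin phi * sin phi));
    [ring|rewrite cs; ring].
- ring.
- ring.
Qed.

Lemma canal_d1 t phi :
  vderive (fun u => canal c r u phi) t (tplane t phi (- G t phi) (r t * H t phi)).
Proof.
apply (vderive_ext (fun u => plus (c u) (comb (T u) (N u) (scal (r u) (ray u phi)))));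
  [intros; symmetry; apply canal_comb|].
assert (D := vderive_plus _ _ _ _ _ (c_derive t) (sphere_derive_t r r1 t phi (r_derive t))).
apply (vderive_eq _ _ _ _ D).
replace (T t) with (comb (T t) (N t) (1, 0, 0)) at 1
  by (apply vec_ext; unfold comb; vsimpl; ring).
unfold tplane; rewrite !comb_scal, !comb_plus; f_equal.
unfold G, ray; rewrite r1_eq; generalize (S_sq t); intros SS.
apply vec_ext; vsimpl.
- apply Rminus_diag_uniq; match goal with |- ?z = 0 => replace z with
    (v t * (1 - C t * C t - S t * S t)) by ring end.
  rewrite SS; ring.
- ring.
- ring.
Qed.

Lemma canal_d2 t phi :
  vderive (fun y => canal c r t y) phi (tplane t phi 0 (r t * S t)).
Proof.
apply (vderive_ext (fun y => plus (c t) (comb (T t) (N t) (scal (r t) (ray t y)))));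
  [intros; symmetry; apply canal_comb|].
assert (D := vderive_plus _ _ _ _ _ (vderive_const (c t) phi) (ray_derive_phi (r t) t phi)).
rewrite plus_zero_l in D; exact D.
Qed.

(** The cross product of the partial derivatives is [- G * r * S] times the
    ray; the sign of [G] orients the normal towards the center. *)
Lemma canal_unit_normal t phi :
  unit_normal (canal c r) t phi = comb (T t) (N t) (scal (-1) (ray t phi)).
Proof.
assert (K0 : 0 < G t phi * (r t * S t)).
{ apply Rmult_lt_0_compat; [apply G_pos|apply Rmult_lt_0_compat; [apply r_pos|apply S_pos]]. }
assert (E1 : Defs.d1 (canal c r) t phi = tplane t phi (- G t phi) (r t * H t phi))
  by exact (vderive_unique _ _ _ (canal_d1 t phi)).
assert (E2 : Defs.d2 (canal c r) t phi = tplane t phi 0 (r t * S t))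
  by exact (vderive_unique _ _ _ (canal_d2 t phi)).
unfold unit_normal; cbv zeta; rewrite E1, E2.
rewrite tplane_cross.
replace (scal (- G t phi * (r t * S t) - r t * H t phi * 0) (comb (T t) (N t) (ray t phi)))
  with (scal (G t phi * (r t * S t)) (comb (T t) (N t) (scal (-1) (ray t phi)))).
2: { rewrite !comb_scal; f_equal; apply vec_ext; vsimpl; ring. }
set (K := G t phi * (r t * S t)) in *; clearbody K.
rewrite vnorm_scal; [|lra|].
- apply vec_ext; vsimpl; field; lra.
- rewrite comb_dot by apply frame; assert (SS := S_sq t); assert (cs := cos_sq phi).
  unfold ray; vsimpl.
  transitivity (C t * C t + S t * S t * (cos phi * cos phi + sin phi * sin phi)); [ring|].
  rewrite cs, SS; ring.
Qed.

(** In the basis of [tplane] both the surface and its normal have triangular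
    derivatives, so Rodrigues' equation splits into two scalar ones. *)
Lemma principal_iff t phi a b k :
  principal (canal c r) t phi a b k <->
  (a <> 0 \/ b <> 0) /\ a * lam t phi = - k * a * G t phi /\
  (1 - k * r t) * (a * H t phi + b * S t) = 0.
Proof.
assert (N1 : Defs.d1 (unit_normal (canal c r)) t phi = tplane t phi (- lam t phi) (- H t phi)).
{ unfold Defs.d1; rewrite (vDerive_ext _ _ t (fun u => canal_unit_normal u phi)).
  apply vderive_unique.
  assert (D := sphere_derive_t (fun _ => -1) (fun _ => 0) t phi
    (is_derive_Rconst (-1) t)).
  apply (vderive_eq _ _ _ _ D).
  unfold tplane; rewrite comb_scal, comb_plus; f_equal; apply vec_ext; vsimpl; ring. }
assert (N2 : Defs.d2 (unit_normal (canal c r)) t phi = tplane t phi 0 (- S t)).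
{ unfold Defs.d2; rewrite (vDerive_ext (fun y => unit_normal (canal c r) t y) _ phi
    (fun y => canal_unit_normal t y)).
  apply vderive_unique.
  replace (- S t) with (-1 * S t) by ring; apply ray_derive_phi. }
assert (E1 : Defs.d1 (canal c r) t phi = tplane t phi (- G t phi) (r t * H t phi))
  by exact (vderive_unique _ _ _ (canal_d1 t phi)).
assert (E2 : Defs.d2 (canal c r) t phi = tplane t phi 0 (r t * S t))
  by exact (vderive_unique _ _ _ (canal_d2 t phi)).
unfold principal; rewrite N1, N2, E1, E2.
rewrite !tplane_lin.
replace (scal (- k) (tplane t phi (a * - G t phi + b * 0) (a * (r t * H t phi) + b * (r t * S t))))
  with (tplane t phi (k * a * G t phi) (- k * (a * (r t * H t phi) + b * (r t * S t)))).
2: { unfold tplane; rewrite comb_scal; f_equal; apply vec_ext; vsimpl; ring. }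
split; intros [E F]; (split; [exact E|]).
- apply tplane_inj in F; destruct F as [F1 F2]; split; lra.
- destruct F as [F1 F2]; f_equal; lra.
Qed.

(** Along the circles the principal curvature is [1 / r]; in the other
    direction it is [- lam / G], smaller because [G + r * lam = v * S > 0]. *)
Lemma minimal_principal_iff t phi d :
  minimal_principal (canal c r) t phi 1 d <-> H t phi + d * S t = 0.
Proof.
assert (G0 := G_pos t phi); assert (S0 := S_pos t); assert (r0 := r_pos t).
assert (vS : 0 < G t phi + r t * lam t phi).
{ unfold G; generalize (Rmult_lt_0_compat _ _ (v_pos t) S0); lra. }
split.
- intros (k & P & _); apply principal_iff in P; destruct P as (_ & E1 & E2).
  apply Rmult_integral in E2; destruct E2 as [E2|E2]; [exfalso|lra].
  assert (E3 : r t * lam t phi = - (k * r t) * G t phi)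
    by (rewrite Rmult_1_l in E1; rewrite E1; ring).
  replace (k * r t) with 1 in E3 by lra; lra.
- intros E; exists (- lam t phi / G t phi); split.
  + apply principal_iff; split; [left; lra|split; [field; lra|]].
    rewrite Rmult_1_l, E; ring.
  + intros a' b' k' P; apply principal_iff in P; destruct P as (Nz & E1 & E2).
    apply Rmult_le_reg_r with (G t phi); [easy|].
    replace (- lam t phi / G t phi * G t phi) with (- lam t phi) by (field; lra).
    destruct (Req_dec a' 0) as [Z|Z].
    * destruct Nz as [Nz|Nz]; [contradiction|]; subst a'.
      rewrite Rmult_0_l, Rplus_0_l in E2.
      apply Rmult_integral in E2; destruct E2 as [E2|E2].
      2: { apply Rmult_integral in E2; lra. }
      apply Rmult_le_reg_l with (r t); [easy|].
      rewrite <- Rmult_assoc, (Rmult_comm (r t) k'); replace (k' * r t) with 1 by lra; lra.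
    * assert (lam t phi = - k' * G t phi)
        by (apply Rmult_eq_reg_l with a'; [rewrite E1; ring|easy]).
      lra.
Qed.

Lemma leaf_canal_iff phi :
  leaf (canal c r) phi <->
  forall t, is_derive phi t (- q t + p t * (C t / S t) * sin (phi t)).
Proof.
assert (E : forall t x d, H t x + d * S t = 0 <-> d = - q t + p t * (C t / S t) * sin x).
{ intros t x d; generalize (S_pos t); unfold H; intros S0; split; intros E.
  - apply Rmult_eq_reg_r with (S t); [|lra].
    replace ((- q t + p t * (C t / S t) * sin x) * S t) with
      (- (q t * S t - p t * C t * sin x)) by (field; lra); lra.
  - rewrite E; field; lra. }
split.
- intros L t; destruct (L t) as (d & D & P).
  apply minimal_principal_iff, E in P; rewrite P in D; exact D.
- intros D t; eexists; split; [apply D|apply minimal_principal_iff, E; easy].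
Qed.

End CanalFrame.

(** * Frenet frames in an arbitrary parameter *)

Section Frenet.

Variables c c1 c2 c3 : R -> vec.
Hypothesis D1 : forall t, vderive c t (c1 t).
Hypothesis D2 : forall t, vderive c1 t (c2 t).
Hypothesis D3 : forall t, vderive c2 t (c3 t).
Hypothesis regular : forall t, 0 < dot (c1 t) (c1 t).
Hypothesis biregular : forall t, 0 < dot (cross (c1 t) (c2 t)) (cross (c1 t) (c2 t)).

Let v (t : R) : R := vnorm (c1 t).
Let B (t : R) : vec := cross (c1 t) (c2 t).
Let W (t : R) : R := vnorm (B t).

(** The Frenet equations with respect to the parameter: the speed times the
    curvature, and the speed times the torsion. *)
Definition frenet_p (t : R) : R := W t / v t ^ 2.
Definition frenet_q (t : R) : R := v t * dot (B t) (c3 t) / W t ^ 2.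

Lemma v_pos t : 0 < v t.
Proof. apply sqrt_lt_R0, regular. Qed.

Lemma W_pos t : 0 < W t.
Proof. apply sqrt_lt_R0, biregular. Qed.

Lemma v_sq t : v t * v t = dot (c1 t) (c1 t).
Proof. apply vnorm_sq. Qed.

Lemma W_sq t : W t * W t = dot (B t) (B t).
Proof. apply vnorm_sq. Qed.

Lemma vnorm_derive f t f' : vderive f t f' -> 0 < dot (f t) (f t) ->
  is_derive (fun u => vnorm (f u)) t (dot (f t) f' / vnorm (f t)).
Proof.
intros H P; unfold vnorm at 1; evar_last.
- apply (is_derive_sqrt (fun u => dot (f u) (f u))); [|exact P].
  apply dot_derive; exact H.
- assert (0 < vnorm (f t)) by (apply sqrt_lt_R0, P).
  fold (vnorm (f t)); replace (dot f' (f t)) with (dot (f t) f') by (vsimpl; ring).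
  field; lra.
Qed.

Lemma inv_vnorm_derive f t f' : vderive f t f' -> 0 < dot (f t) (f t) ->
  is_derive (fun u => / vnorm (f u)) t (- dot (f t) f' / vnorm (f t) ^ 3).
Proof.
intros H P; assert (0 < vnorm (f t)) by (apply sqrt_lt_R0, P); evar_last.
- apply (is_derive_inv (fun u => vnorm (f u))); [apply (vnorm_derive f t f' H P)|lra].
- cbv beta; field; lra.
Qed.

Lemma speed_eq t : speed c t = v t.
Proof. unfold speed; rewrite (vderive_unique _ _ _ (D1 t)); easy. Qed.

Lemma tangent_eq t : tangent c t = scal (/ v t) (c1 t).
Proof. unfold tangent, vdds; rewrite speed_eq, (vderive_unique _ _ _ (D1 t)); easy. Qed.

Lemma c_derive_tangent t : vderive c t (scal (v t) (tangent c t)).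
Proof.
replace (scal (v t) (tangent c t)) with (c1 t); [apply D1|].
rewrite tangent_eq; generalize (v_pos t); intros.
apply vec_ext; vsimpl; field; lra.
Qed.

Definition nvec (t : R) : vec := scal (/ (W t * v t)) (cross (B t) (c1 t)).

Lemma tangent_derive_nvec t : vderive (tangent c) t (scal (frenet_p t) (nvec t)).
Proof.
apply (vderive_ext (fun u => scal (/ v u) (c1 u)));
  [intros; symmetry; apply tangent_eq|].
assert (D := vderive_scal _ _ _ _ _ (inv_vnorm_derive _ _ _ (D2 t) (regular t)) (D2 t)).
fold (v t) in D.
apply (vderive_eq _ _ _ _ D).
assert (v0 := v_pos t); assert (W0 := W_pos t).
transitivity (scal (/ v t ^ 3) (plus (scal (v t * v t) (c2 t))
                                     (scal (- dot (c1 t) (c2 t)) (c1 t)))).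
- change (vnorm (c1 t)) with (v t).
  generalize (dot (c1 t) (c2 t)); intros; apply vec_ext; vsimpl; field; lra.
- replace (plus (scal (v t * v t) (c2 t)) (scal (- dot (c1 t) (c2 t)) (c1 t)))
    with (cross (B t) (c1 t)) by (rewrite v_sq; unfold B; apply vec_ext; vsimpl; ring).
  unfold nvec, frenet_p; generalize (cross (B t) (c1 t)); intros; apply vec_ext; vsimpl;
    field; lra.
Qed.

Lemma dot_scal k f g : dot (scal k f) (scal k g) = k ^ 2 * dot f g.
Proof. vsimpl; ring. Qed.

Lemma lagrange f g : dot (cross f g) (cross f g) = dot f f * dot g g - dot f g * dot f g.
Proof. vsimpl; ring. Qed.

Lemma dot_cross_l f g : dot (cross f g) f = 0.
Proof. vsimpl; ring. Qed.

Lemma dot_cross_r f g : dot g (cross f g) = 0.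
Proof. vsimpl; ring. Qed.

Lemma nvec_dot t : dot (nvec t) (nvec t) = 1.
Proof.
assert (v0 := v_pos t); assert (W0 := W_pos t).
unfold nvec; rewrite dot_scal, lagrange, <- v_sq, <- W_sq; unfold B.
rewrite dot_cross_l; field; lra.
Qed.

Lemma curvature_eq t : curvature c t = W t / v t ^ 3.
Proof.
assert (v0 := v_pos t); assert (W0 := W_pos t).
unfold curvature, vdds; rewrite speed_eq, (vderive_unique _ _ _ (tangent_derive_nvec t)).
replace (scal (/ v t) (scal (frenet_p t) (nvec t))) with (scal (W t / v t ^ 3) (nvec t)).
- apply vnorm_scal; [|apply nvec_dot].
  apply Rlt_le, Rdiv_lt_0_compat; [easy|apply pow_lt, v0].
- generalize (nvec t); intros; unfold frenet_p; apply vec_ext; vsimpl; field; lra.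
Qed.

Lemma normal_eq t : normal c t = nvec t.
Proof.
assert (v0 := v_pos t); assert (W0 := W_pos t).
unfold normal, vdds; rewrite curvature_eq, speed_eq,
  (vderive_unique _ _ _ (tangent_derive_nvec t)).
generalize (nvec t); intros; unfold frenet_p; apply vec_ext; vsimpl; field; lra.
Qed.

Lemma tangent_derive t : vderive (tangent c) t (scal (frenet_p t) (normal c t)).
Proof. rewrite normal_eq; apply tangent_derive_nvec. Qed.

Lemma frenet_orthonormal t : orthonormal (tangent c t) (normal c t).
Proof.
assert (v0 := v_pos t); assert (W0 := W_pos t).
rewrite normal_eq, tangent_eq; split; [|split].
- rewrite dot_scal, <- v_sq; field; lra.
- apply nvec_dot.
- transitivity (/ v t * / (W t * v t) * dot (c1 t) (cross (B t) (c1 t))).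
  + unfold nvec; generalize (cross (B t) (c1 t)); intros; vsimpl; ring.
  + rewrite dot_cross_r; ring.
Qed.

Lemma binormal_eq t : cross (tangent c t) (normal c t) = scal (/ W t) (B t).
Proof.
assert (v0 := v_pos t); assert (W0 := W_pos t).
rewrite normal_eq, tangent_eq; unfold nvec.
transitivity (scal (/ v t * / (W t * v t)) (cross (c1 t) (cross (B t) (c1 t)))).
- generalize (cross (B t) (c1 t)); intros; apply vec_ext; vsimpl; ring.
- replace (cross (c1 t) (cross (B t) (c1 t))) with (scal (v t * v t) (B t)).
  + generalize (B t); intros; apply vec_ext; vsimpl; field; lra.
  + rewrite v_sq; unfold B; apply vec_ext; vsimpl; ring.
Qed.

(** The binormal is differentiated first, because its closed form is the
    simplest; the normal is then the cross product of binormal and tangent. *)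
Lemma binormal_derive t :
  vderive (fun u => scal (/ W u) (B u)) t (scal (- frenet_q t) (normal c t)).
Proof.
assert (v0 := v_pos t); assert (W0 := W_pos t).
assert (DB : vderive B t (cross (c1 t) (c3 t))).
{ assert (D := cross_derive _ _ _ _ _ (D2 t) (D3 t)).
  replace (plus (cross (c2 t) (c2 t)) (cross (c1 t) (c3 t))) with (cross (c1 t) (c3 t)) in D;
    [exact D|apply vec_ext; vsimpl; ring]. }
assert (D := vderive_scal _ _ _ _ _ (inv_vnorm_derive B t _ DB (biregular t)) DB).
apply (vderive_eq _ _ _ _ D).
change (vnorm (B t)) with (W t).
transitivity (scal (/ W t ^ 3) (plus (scal (W t * W t) (cross (c1 t) (c3 t)))
  (scal (- dot (B t) (cross (c1 t) (c3 t))) (B t)))).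
- generalize (dot (B t) (cross (c1 t) (c3 t))) (cross (c1 t) (c3 t)) (B t); intros;
    apply vec_ext; vsimpl; field; lra.
- replace (plus (scal (W t * W t) (cross (c1 t) (c3 t)))
      (scal (- dot (B t) (cross (c1 t) (c3 t))) (B t)))
    with (scal (- dot (B t) (c3 t)) (cross (B t) (c1 t))).
  + rewrite normal_eq; unfold nvec, frenet_q.
    generalize (cross (B t) (c1 t)) (dot (B t) (c3 t)); intros; apply vec_ext; vsimpl;
      field; lra.
  + rewrite W_sq; unfold B; apply vec_ext; vsimpl; ring.
Qed.

Lemma normal_derive t : vderive (normal c) t
  (plus (scal (- frenet_p t) (tangent c t))
        (scal (frenet_q t) (cross (tangent c t) (normal c t)))).
Proof.
apply (vderive_ext (fun u => cross (scal (/ W u) (B u)) (tangent c u))).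
{ intros u; rewrite <- binormal_eq; apply cross_N, frenet_orthonormal. }
assert (D := cross_derive _ _ _ _ _ (binormal_derive t) (tangent_derive t)).
apply (vderive_eq _ _ _ _ D).
cbv beta; rewrite <- binormal_eq.
transitivity (plus (scal (- frenet_p t) (cross (normal c t) (cross (tangent c t) (normal c t))))
  (scal (frenet_q t) (cross (tangent c t) (normal c t)))).
- generalize (tangent c t) (normal c t); intros X Y; apply vec_ext; vsimpl; ring.
- rewrite cross_T by apply frenet_orthonormal; easy.
Qed.

End Frenet.

(** * The canal surfaces of the family *)

Definition center1 (e t : R) : vec := (- 2 * sin t, cos t, e * k1 t).
Definition center2 (e t : R) : vec := (- 2 * cos t, - sin t, e * k2 t).
Definition center3 (e t : R) : vec := (2 * sin t, - cos t, e * k3 t).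

Lemma center_derive e t : vderive (center e) t (center1 e t).
Proof.
split; [|split]; unfold center, center1.
- apply (is_derive_ext (fun u => 2 * cos u)); [easy|]; rewrite vx_mk.
  auto_derive; [easy|ring].
- apply (is_derive_ext sin); [easy|apply is_derive_sin].
- apply (is_derive_ext (fun u => e * k0 u)).
  + intros u; rewrite vz_mk, Derive_kappa_k0; easy.
  + apply is_derive_scal, k0_derive.
Qed.

Lemma center1_derive e t : vderive (center1 e) t (center2 e t).
Proof.
split; [|split]; unfold center1, center2.
- apply (is_derive_ext (fun u => - 2 * sin u)); [easy|]; rewrite vx_mk.
  auto_derive; [easy|ring].
- apply (is_derive_ext cos); [easy|apply is_derive_cos].
- apply (is_derive_ext (fun u => e * k1 u)); [easy|apply is_derive_scal, k1_derive].
Qed.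

Lemma center2_derive e t : vderive (center2 e) t (center3 e t).
Proof.
split; [|split]; unfold center2, center3.
- apply (is_derive_ext (fun u => - 2 * cos u)); [easy|]; rewrite vx_mk.
  auto_derive; [easy|ring].
- apply (is_derive_ext (fun u => - sin u)); [easy|].
  apply (is_derive_opp sin), is_derive_sin.
- apply (is_derive_ext (fun u => e * k2 u)); [easy|apply is_derive_scal, k2_derive].
Qed.

Lemma center_vsq e t : dot (center1 e t) (center1 e t) = vsq t e.
Proof.
unfold center1, vsq, usq; vsimpl; generalize (cos_sq t); generalize (k1 t); intros x C.
transitivity (4 * (sin t * sin t) + cos t * cos t + e ^ 2 * x ^ 2); [ring|].
replace (sin t * sin t) with (1 - cos t * cos t) by lra; ring.
Qed.

Lemma center_cross e t : cross (center1 e t) (center2 e t) =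
  (e * (k2 t * cos t + k1 t * sin t), 2 * e * (k2 t * sin t - k1 t * cos t), 2).
Proof.
unfold center1, center2; generalize (cos_sq t) (k1 t) (k2 t); intros C x y.
apply vec_ext; vsimpl; [ring|ring|].
transitivity (2 * (sin t * sin t) + 2 * (cos t * cos t)); [ring|rewrite C; ring].
Qed.

Lemma center_qsq e t : dot (cross (center1 e t) (center2 e t))
  (cross (center1 e t) (center2 e t)) = 4 + e ^ 2 * qsq t.
Proof.
rewrite center_cross; unfold qsq; generalize (k1 t) (k2 t); intros x y; vsimpl; ring.
Qed.

Lemma center_det e t : dot (cross (center1 e t) (center2 e t)) (center3 e t)
  = 2 * e * (k1 t + k3 t).
Proof.
rewrite center_cross; unfold center3; generalize (cos_sq t).
generalize (k1 t) (k2 t) (k3 t); intros x y z C; vsimpl.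
transitivity (2 * e * (x * (sin t * sin t + cos t * cos t) + z)); [ring|rewrite C; ring].
Qed.

Lemma center_regular e t : 0 < dot (center1 e t) (center1 e t).
Proof. rewrite center_vsq; generalize (vsq_lower t e); lra. Qed.

Lemma center_biregular e t : 0 < dot (cross (center1 e t) (center2 e t))
  (cross (center1 e t) (center2 e t)).
Proof. rewrite center_qsq; generalize (four_lower t e); lra. Qed.

Lemma radius_derive rho m t : is_derive (radius rho m) t (m * k1 t).
Proof.
apply (is_derive_ext (fun u => rho + m * k0 u)).
- intros u; unfold radius; rewrite Derive_kappa_k0; easy.
- evar_last; [apply (is_derive_Rplus (fun _ => rho));
    [apply is_derive_Rconst|apply is_derive_scal, k0_derive]|].
  apply Rplus_0_l.
Qed.

Section Surface.

Variables e m rho : R.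
Hypothesis small : box dbox e m.
Hypothesis rho_small : 0 < rho < dbox.
Hypothesis radius_pos : forall t, 0 < radius rho m t.

Let v (t : R) : R := vnorm (center1 e t).
Let W (t : R) : R := vnorm (cross (center1 e t) (center2 e t)).
Let a12 (t : R) : R := dot (center1 e t) (center2 e t).
Let S (t : R) : R := sqrt (1 - (- dds (center e) (radius rho m) t) ^ 2).

Lemma v_eq t : v t = sqrt (vsq t e).
Proof. unfold v, vnorm; rewrite center_vsq; easy. Qed.

Lemma W_eq t : W t = sqrt (4 + e ^ 2 * qsq t).
Proof. unfold W, vnorm; rewrite center_qsq; easy. Qed.

Lemma v_ge_1 t : 1 <= v t.
Proof. rewrite v_eq, <- sqrt_1; apply sqrt_le_1_alt, vsq_lower. Qed.

Lemma dds_radius t : dds (center e) (radius rho m) t = m * k1 t * / v t.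
Proof.
unfold dds; rewrite (is_derive_unique _ _ _ (radius_derive rho m t)).
rewrite (speed_eq (center e) (center1 e)) by apply center_derive; easy.
Qed.

(** The derivative, in the parameter, of [- dr/ds]. *)
Definition ddr (t : R) : R := - (m * (k2 t * / v t - k1 t * (a12 t / v t ^ 3))).

Lemma dds_radius_derive t : is_derive (fun u => - dds (center e) (radius rho m) u) t (ddr t).
Proof.
apply (is_derive_ext (fun u => - (m * (k1 u * / v u)))).
{ intros u; rewrite dds_radius, Rmult_assoc; reflexivity. }
evar_last.
- apply (is_derive_opp (fun u => m * (k1 u * / v u))), is_derive_scal.
  apply (is_derive_Rmult k1); [apply k1_derive|].
  apply (inv_vnorm_derive _ _ _ (center1_derive e t) (center_regular e t)).
- change (vnorm (center1 e t)) with (v t).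
  unfold ddr, a12; Rsimpl; unfold Rdiv; ring.
Qed.

Lemma inv_v_bound t n : 0 < / v t ^ n <= 1.
Proof.
generalize (v_ge_1 t); intros V; split; [apply Rinv_0_lt_compat, pow_lt; lra|].
rewrite <- Rinv_1; apply Rinv_le_contravar; [lra|apply pow_R1_Rle, V].
Qed.

(** Crude bounds on the box of parameters; with a radius below [1 / 50] they
    leave a wide margin in the immersion condition. *)
Lemma small_bounds t :
  Rabs (dds (center e) (radius rho m) t) <= / 3 /\ Rabs (ddr t) <= 7 /\
  0 < W t <= 13 /\ radius rho m t <= / 50.
Proof.
destruct small as [se sm]; destruct (k_bounds t) as (K0 & K1 & K2).
assert (V1 := inv_v_bound t 1); rewrite pow_1 in V1.
assert (V3 := inv_v_bound t 3).
assert (M1 := Rabs_mult_le m (k1 t) _ _ sm K1); assert (E1 := Rabs_mult_le e (k1 t) _ _ se K1).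
assert (M2 := Rabs_mult_le m (k2 t) _ _ sm K2); assert (E2 := Rabs_mult_le e (k2 t) _ _ se K2).
assert (M0 := Rabs_mult_le m (k0 t) _ _ sm K0).
assert (inv : forall x i K, Rabs x <= K -> 0 < i <= 1 -> Rabs (x * i) <= K)
  by (intros; apply Rabs_mult_le1; [|rewrite Rabs_pos_eq]; lra).
assert (cs : Rabs (cos t * sin t) <= 1)
  by (apply Rabs_mult_le1; [apply Rabs_cos_le|apply Rabs_sin_le]).
unfold dbox in *; split; [|split; [|split]].
- rewrite dds_radius; eapply Rle_trans; [apply inv; eassumption|lra].
- assert (A : Rabs (a12 t) <= 5).
  { unfold a12, center1, center2; vsimpl.
    replace (-2 * sin t * (-2 * cos t) + cos t * - sin t + e * k1 t * (e * k2 t))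
      with (3 * (cos t * sin t) + (e * k1 t) * (e * k2 t)) by ring.
    eapply Rle_trans; [apply Rabs_triang|].
    rewrite !(Rabs_mult 3), (Rabs_pos_eq 3) by lra.
    generalize (Rabs_mult_le _ _ _ _ E1 E2).
    lra. }
  unfold ddr; rewrite Rabs_Ropp.
  replace (m * (k2 t * / v t - k1 t * (a12 t / v t ^ 3))) with
    (m * k2 t * / v t + - (m * k1 t * a12 t * / v t ^ 3)) by (unfold Rdiv; ring).
  eapply Rle_trans; [apply Rabs_triang|]; rewrite Rabs_Ropp.
  assert (Rabs (m * k2 t * / v t) <= / 1000 * 5058) by (apply inv; easy).
  assert (Rabs (m * k1 t * a12 t * / v t ^ 3) <= / 1000 * 306 * 5).
  { apply inv; [apply Rabs_mult_le; easy|easy]. }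
  lra.
- rewrite W_eq; split; [apply sqrt_lt_R0; generalize (four_lower t e); lra|].
  rewrite <- (sqrt_square 13) by lra; apply sqrt_le_1_alt.
  assert (C := Rabs_cos_le t); assert (Sn := Rabs_sin_le t).
  assert (X : Rabs (e * k2 t * cos t + e * k1 t * sin t) <= 54 / 10).
  { eapply Rle_trans; [apply Rabs_triang|].
    generalize (Rabs_mult_le1 _ _ _ E2 C) (Rabs_mult_le1 _ _ _ E1 Sn); lra. }
  assert (Y : Rabs (e * k2 t * sin t - e * k1 t * cos t) <= 54 / 10).
  { eapply Rle_trans; [apply Rabs_triang|]; rewrite Rabs_Ropp.
    generalize (Rabs_mult_le1 _ _ _ E2 Sn) (Rabs_mult_le1 _ _ _ E1 C); lra. }
  replace (e ^ 2 * qsq t) with ((e * k2 t * cos t + e * k1 t * sin t) ^ 2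
    + 4 * (e * k2 t * sin t - e * k1 t * cos t) ^ 2) by (unfold qsq; ring).
  apply Rabs_le_between in X; apply Rabs_le_between in Y.
  set (x := e * k2 t * cos t + e * k1 t * sin t) in *.
  set (y := e * k2 t * sin t - e * k1 t * cos t) in *.
  assert (x ^ 2 <= (54 / 10) ^ 2) by nra.
  assert (y ^ 2 <= (54 / 10) ^ 2) by nra.
  lra.
- unfold radius; rewrite Derive_kappa_k0.
  apply Rabs_le_between in M0; lra.
Qed.

Lemma S_bounds t : 8 / 9 <= S t <= 1.
Proof.
destruct (small_bounds t) as (D & _); apply Rabs_le_between in D.
unfold S; replace ((- dds (center e) (radius rho m) t) ^ 2)
  with (dds (center e) (radius rho m) t ^ 2) by ring.
set (x := dds (center e) (radius rho m) t) in *.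
split.
- rewrite <- (sqrt_square (8 / 9)) by lra; apply sqrt_le_1_alt; nra.
- apply Rle_trans with (sqrt 1); [apply sqrt_le_1_alt; nra|rewrite sqrt_1; lra].
Qed.

Lemma scaled_bound x i K : 0 <= x <= K -> 0 < i <= 1 -> 0 <= x * i <= K.
Proof. intros; split; [apply Rmult_le_pos; lra|nra]. Qed.

Lemma center_canal : is_canal (center e) (radius rho m).
Proof.
intros t; destruct (small_bounds t) as (BD & Bd & BW & Br); assert (BS := S_bounds t).
assert (v1 := v_ge_1 t); assert (r0 := radius_pos t).
assert (D2r : dds (center e) (dds (center e) (radius rho m)) t = - (ddr t / v t)).
{ unfold dds at 1.
  rewrite (speed_eq (center e) (center1 e)) by apply center_derive; fold (v t).
  assert (H := is_derive_opp _ _ _ (dds_radius_derive t)).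
  replace (Derive (dds (center e) (radius rho m)) t) with (- ddr t).
  - unfold Rdiv; ring.
  - symmetry; apply is_derive_unique; revert H; apply is_derive_ext.
    intros u; unfold opp; simpl; apply Ropp_involutive. }
rewrite (speed_eq (center e) (center1 e)), (curvature_eq (center e) (center1 e) (center2 e)),
  D2r by (first [apply center_derive|apply center1_derive|apply center_regular
    |apply center_biregular]).
fold (v t) (W t).
replace (dds (center e) (radius rho m) t ^ 2)
  with ((- dds (center e) (radius rho m) t) ^ 2) by ring.
fold (S t).
assert (V3 : 0 < / v t ^ 3 <= 1) by apply inv_v_bound.
assert (V1 : 0 < / v t ^ 1 <= 1) by apply inv_v_bound; rewrite pow_1 in V1.
split; [lra|split; [apply Rdiv_lt_0_compat; [lra|apply pow_lt; lra]|]].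
split; [easy|split; [lra|]].
assert (P1 : 0 <= W t * / v t ^ 3 <= 13) by (apply scaled_bound; [lra|easy]).
assert (rS : 0 < radius rho m t * S t) by (apply Rmult_lt_0_compat; lra).
apply (proj1 (Rlt_div_r _ _ _ rS)).
apply Rabs_le_between in BD; apply Rabs_le_between in Bd.
set (x := dds (center e) (radius rho m) t) in *.
assert (L : W t / v t ^ 3 * (radius rho m t * S t) <= 13 * / 50).
{ apply Rmult_le_compat; [apply P1|lra|apply P1|].
  rewrite <- (Rmult_1_r (/ 50)); apply Rmult_le_compat; lra. }
assert (Q : - (7 * / 50) <= radius rho m t * (ddr t / v t)).
{ unfold Rdiv; assert (-7 <= ddr t * / v t) by nra; nra. }
assert ((- x) ^ 2 <= / 9) by nra.
lra.
Qed.

Lemma leaf_center_iff phi : leaf (canal_family e rho m) phi <->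
  solves (angle_eq (fun t => acoef t e m) (fun t => bcoef t e m)) phi.
Proof.
unfold canal_family.
assert (H := leaf_canal_iff (center e) (radius rho m) v (frenet_p (center1 e) (center2 e))
  (frenet_q (center1 e) (center2 e) (center3 e)) (fun t => m * k1 t) ddr
  (frenet_orthonormal _ _ _ (center_derive e) (center1_derive e) (center_regular e)
    (center_biregular e))
  (c_derive_tangent _ _ (center_derive e) (center_regular e))
  (tangent_derive _ _ _ (center_derive e) (center1_derive e) (center_regular e)
    (center_biregular e))
  (normal_derive _ _ _ _ (center_derive e) (center1_derive e) (center2_derive e)
    (center_regular e) (center_biregular e))).
assert (H' : leaf (canal (center e) (radius rho m)) phi <->
  forall t, is_derive phi t (- frenet_q (center1 e) (center2 e) (center3 e) t
    + frenet_p (center1 e) (center2 e) t * (- dds (center e) (radius rho m) t / S t)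
      * sin (phi t))).
{ apply H; clear H.
  - apply radius_pos.
  - intros t; generalize (v_ge_1 t); lra.
  - intros t; apply radius_derive.
  - intros t; rewrite dds_radius; generalize (v_ge_1 t); intros; field; lra.
  - apply dds_radius_derive.
  - intros t; destruct (small_bounds t); lra.
  - intros t x; destruct (small_bounds t) as (_ & Bd & BW & Br); fold (S t).
    assert (BS := S_bounds t); assert (v1 := v_ge_1 t); assert (r0 := radius_pos t).
    assert (P : 0 <= frenet_p (center1 e) (center2 e) t <= 13).
    { unfold frenet_p; fold (v t) (W t).
      apply (scaled_bound (W t) (/ v t ^ 2)); [lra|apply inv_v_bound]. }
    assert (Pc : frenet_p (center1 e) (center2 e) t * cos x <= 13)
      by (generalize (COS_bound x); nra).
    assert (Q : - (ddr t / S t) <= 8).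
    { apply Rabs_le_between in Bd.
      assert (I : 0 < / S t <= 9 / 8).
      { split; [apply Rinv_0_lt_compat; lra|].
        replace (9 / 8) with (/ (8 / 9)) by field; apply Rinv_le_contravar; lra. }
      unfold Rdiv; nra. }
    assert (radius rho m t * (- (ddr t / S t) + frenet_p (center1 e) (center2 e) t * cos x)
      <= radius rho m t * 21) by (apply Rmult_le_compat_l; lra).
    nra. }
rewrite H'; clear H H'.
assert (E : forall t x, - frenet_q (center1 e) (center2 e) (center3 e) t
    + frenet_p (center1 e) (center2 e) t * (- dds (center e) (radius rho m) t / S t) * x
    = acoef t e m + bcoef t e m * x).
{ intros t x; f_equal; [|f_equal].
  - unfold frenet_q; rewrite center_det; fold (v t) (W t).
    replace (W t ^ 2) with (4 + e ^ 2 * qsq t).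
    2: { rewrite W_eq; rewrite pow2_sqrt; [easy|].
         generalize (four_lower t e); lra. }
    unfold acoef; rewrite v_eq; unfold Rdiv; ring.
  - unfold frenet_p; fold (v t) (W t).
    assert (gap := vsq_gap t e m (proj2 small)).
    assert (ES : S t = sqrt (vsq t e - m ^ 2 * k1 t ^ 2) * / v t).
    { assert (v1 := v_ge_1 t).
      assert (vv : v t * v t = vsq t e)
        by (rewrite v_eq; apply sqrt_sqrt; generalize (vsq_lower t e); lra).
      assert (Y : sqrt (vsq t e - m ^ 2 * k1 t ^ 2) * / v t
        * (sqrt (vsq t e - m ^ 2 * k1 t ^ 2) * / v t)
        = 1 - (- dds (center e) (radius rho m) t) ^ 2).
      { rewrite dds_radius.
        transitivity (sqrt (vsq t e - m ^ 2 * k1 t ^ 2) * sqrt (vsq t e - m ^ 2 * k1 t ^ 2)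
          * / (v t * v t)); [field; lra|].
        rewrite sqrt_sqrt, <- vv by lra; field; lra. }
      unfold S; rewrite <- Y; apply sqrt_square, Rmult_le_pos; [apply sqrt_pos|].
      apply Rlt_le, Rinv_0_lt_compat; lra. }
    rewrite ES, dds_radius; unfold bcoef.
    assert (0 < sqrt (vsq t e - m ^ 2 * k1 t ^ 2)) by (apply sqrt_lt_R0; lra).
    generalize (v_ge_1 t); intros.
    replace (vsq t e * sqrt (vsq t e - m ^ 2 * k1 t ^ 2))
      with (v t ^ 2 * sqrt (vsq t e - m ^ 2 * k1 t ^ 2)).
    2: { rewrite v_eq; rewrite pow2_sqrt; [easy|].
         generalize (vsq_lower t e); lra. }
    rewrite <- W_eq; generalize dependent (sqrt (vsq t e - m ^ 2 * k1 t ^ 2)); intros.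
    field; lra. }
unfold solves, angle_eq; split; intros K t; [rewrite <- E|rewrite E]; apply K.
Qed.

End Surface.

(** * The half turn displacement *)

Definition fam_flow (e m t x : R) : R :=
  aflow (fun t => acoef t e m) (fun t => bcoef t e m) t x.

Lemma fam_flow_spec e m x : box dbox e m ->
  solves (angle_eq (fun t => acoef t e m) (fun t => bcoef t e m)) (fun t => fam_flow e m t x)
  /\ fam_flow e m 0 x = x.
Proof.
intros B; destruct (coef_bounded e m B) as (M & M0 & HM).
assert (Ca := fun t => proj1 (coef_continuous e m t B)).
assert (Cb := fun t => proj2 (coef_continuous e m t B)).
split; [apply (aflow_solves _ _ M Ca Cb M0 HM)|apply (aflow_0 _ _ M Ca Cb M0 HM)].
Qed.

(** [acoef] is odd and [bcoef] is even in [e], hence [phi -> - phi] exchanges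
    the equations for [e] and [- e]. *)
Lemma fam_flow_opp e m t x : box dbox e m ->
  fam_flow (- e) m t (- x) = - fam_flow e m t x.
Proof.
intros B.
assert (B' : box dbox (- e) m) by (destruct B; split; rewrite ?Rabs_Ropp; easy).
destruct (coef_bounded _ _ B') as (M & M0 & HM).
assert (Ca := fun t => proj1 (coef_continuous _ _ t B')).
assert (Cb := fun t => proj2 (coef_continuous _ _ t B')).
destruct (fam_flow_spec e m x B) as [Sv S0].
assert (H : solves (angle_eq (fun t => acoef t (- e) m) (fun t => bcoef t (- e) m))
  (fun t => - fam_flow e m t x)).
{ intros s; evar_last; [apply (is_derive_opp (fun t => fam_flow e m t x)), Sv|].
  unfold angle_eq, acoef, bcoef, vsq; rewrite sin_neg.
  replace ((- e) ^ 2) with (e ^ 2) by ring; Rsimpl; ring. }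
assert (U := aflow_unique _ _ M Ca Cb M0 HM _ H t); cbv beta in U.
rewrite S0 in U; symmetry; exact U.
Qed.

(** Half a period suffices by reversibility; the displacement of [PI / 2] is
    obtained from this one by the reflection above. *)
Definition displ (e m : R) : R := fam_flow e m PI (- (PI / 2)) + PI / 2.

(** The zero set of [displ] is the curve of [e] for which the leaf through
    [- PI / 2] closes up; the first order part of [displ] is [J0 * (e - m)]. *)
Lemma displ_curve : exists (r delta K : R) (eps : R -> R),
  0 < delta <= r /\ r <= dbox /\
  (forall m, Rabs m < delta -> Rabs (eps m) < r /\ displ (eps m) m = 0 /\
     (forall x, Rabs x <= r -> x < eps m -> displ x m < 0) /\
     Rabs (eps m - m) <= K * m ^ 2) /\
  (forall n m, Rabs m < delta -> ex_derive_n eps n m).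
Proof.
assert (d0 : 0 < dbox) by (unfold dbox; lra).
assert (P0 := PI_RGT_0); assert (P0' := Rlt_le _ _ P0).
set (psi := fun t e m => fam_flow e m t (- (PI / 2)) + PI / 2).
assert (psi_eq : forall e m, box dbox e m -> forall t,
  is_derive (fun t => psi t e m) t (acoef t e m - bcoef t e m * cos (psi t e m))).
{ intros e m B t; destruct (fam_flow_spec e m (- (PI / 2)) B) as [Sv _]; evar_last.
  - apply (is_derive_Rplus (fun t => fam_flow e m t (- (PI / 2))) (fun _ => PI / 2));
      [apply Sv|apply is_derive_Rconst].
  - unfold angle_eq, psi; set (x := fam_flow e m t (- (PI / 2))).
    replace (cos (x + PI / 2)) with (- sin x)
      by (rewrite cos_plus, cos_PI2, sin_PI2; ring).
    Rsimpl; ring. }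
assert (psi_0 : forall e m, box dbox e m -> psi 0 e m = 0).
{ intros e m B; destruct (fam_flow_spec e m (- (PI / 2)) B) as [_ S0].
  unfold psi; rewrite S0; ring. }
assert (B0 : box dbox 0 0) by (split; rewrite Rabs_R0; lra).
destruct (psi_derivatives_0 dbox PI acoef bcoef psi d0 P0 (acoef_reg PI P0')
  (bcoef_reg PI P0') psi_eq psi_0 a1 b1) as [DE DM].
{ apply acoef_derive_0. }
{ intros; unfold acoef; ring. }
{ intros; unfold bcoef; ring. }
{ apply bcoef_derive_0. }
rewrite average_a1 in DE; rewrite average_b1 in DM.
apply (implicit_curve dbox J0 displ d0 J0_pos); try easy.
- intros n; apply (reg_eval dbox PI 0 n psi PI); [lra|].
  apply (psi_reg dbox PI acoef bcoef); try easy; [apply acoef_reg, P0'|apply bcoef_reg, P0'].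
- assert (Z : psi PI 0 0 = psi 0 0 0).
  { apply derive_zero_eq with (f := fun t => psi t 0 0); intros s; evar_last;
      [apply psi_eq, B0|unfold acoef, bcoef; ring]. }
  rewrite psi_0 in Z by easy; exact Z.
Qed.

Section FamilyCycles.

Variables e m rho : R.
Hypothesis small : box dbox e m.
Hypothesis rho_small : 0 < rho < dbox.
Hypothesis radius_pos : forall t, 0 < radius rho m t.

Lemma coef_periodic t : acoef (t + 2 * PI) e m = acoef t e m /\
  bcoef (t + 2 * PI) e m = bcoef t e m.
Proof. generalize (coef_shift t e m 1); rewrite Rmult_1_l; easy. Qed.

Lemma two_PI_pos : 0 < 2 * PI.
Proof. generalize PI_RGT_0; lra. Qed.

Lemma half_turn x : fam_flow e m (2 * PI / 2) x = fam_flow e m PI x.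
Proof. f_equal; field. Qed.

Lemma half_turn_pos : fam_flow e m PI (PI / 2) = PI / 2 - displ (- e) m.
Proof.
unfold displ; rewrite fam_flow_opp by easy.
rewrite <- (Ropp_involutive (PI / 2)) at 1.
replace (- - (PI / 2)) with (PI / 2) by ring; ring.
Qed.

Lemma two_hyperbolic : displ e m < 0 -> displ (- e) m < 0 ->
  has_two_hyperbolic_cycles (2 * PI) (canal_family e rho m).
Proof.
intros N N'; destruct (coef_bounded e m small) as (M & M0 & HM).
apply (two_hyperbolic_of_half_turn _ _ M (2 * PI)
  (fun t => proj1 (coef_continuous e m t small))
  (fun t => proj2 (coef_continuous e m t small)) M0 HM two_PI_pos
  (fun t => proj1 (coef_periodic t)) (fun t => proj2 (coef_periodic t))
  (fun t => proj1 (coef_even t e m)) (fun t => proj2 (coef_even t e m)) _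
  (leaf_center_iff e m rho small rho_small radius_pos)); fold (fam_flow e m (2 * PI / 2)).
- change (fam_flow e m (2 * PI / 2) (- (PI / 2)) < - (PI / 2)).
  rewrite half_turn; unfold displ in N; lra.
- change (PI / 2 < fam_flow e m (2 * PI / 2) (PI / 2)).
  rewrite half_turn, half_turn_pos; lra.
Qed.

Lemma one_double s : s = 1 \/ s = -1 -> displ (- s * e) m = 0 -> displ (s * e) m < 0 ->
  has_one_double_cycle (2 * PI) (canal_family e rho m).
Proof.
intros Hs Z N; destruct (coef_bounded e m small) as (M & M0 & HM).
apply (one_double_of_half_turn _ _ M (2 * PI)
  (fun t => proj1 (coef_continuous e m t small))
  (fun t => proj2 (coef_continuous e m t small)) M0 HM two_PI_pos
  (fun t => proj1 (coef_periodic t)) (fun t => proj2 (coef_periodic t))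
  (fun t => proj1 (coef_even t e m)) (fun t => proj2 (coef_even t e m)) _
  (leaf_center_iff e m rho small rho_small radius_pos) s Hs).
- change (fam_flow e m (2 * PI / 2) (s * (PI / 2)) = s * (PI / 2)); rewrite half_turn.
  destruct Hs as [E|E].
  + replace (- s * e) with (- e) in Z by (rewrite E; ring).
    rewrite E, !Rmult_1_l, half_turn_pos; lra.
  + replace (- s * e) with e in Z by (rewrite E; ring); unfold displ in Z.
    replace (s * (PI / 2)) with (- (PI / 2)) by (rewrite E; ring); lra.
- change (s * fam_flow e m (2 * PI / 2) (- s * (PI / 2)) < - (PI / 2)); rewrite half_turn.
  destruct Hs as [E|E].
  + replace (s * e) with e in N by (rewrite E; ring); unfold displ in N.
    replace (- s * (PI / 2)) with (- (PI / 2)) by (rewrite E; ring).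
    rewrite E; lra.
  + replace (s * e) with (- e) in N by (rewrite E; ring).
    replace (- s * (PI / 2)) with (PI / 2) by (rewrite E; field).
    rewrite half_turn_pos, E; lra.
Qed.

End FamilyCycles.

Theorem proposition8 :
  exists (eps1 eps2 : R -> R) (delta C1 C2 : R),
    0 < delta /\
    (forall (n : nat) (mu : R), Rabs mu < delta ->
       ex_derive_n eps1 n mu /\ ex_derive_n eps2 n mu) /\
    (forall mu : R, Rabs mu < delta ->
       Rabs (eps1 mu + mu) <= C1 * mu ^ 2 /\
       Rabs (eps2 mu - mu) <= C2 * mu ^ 2) /\
    forall rho mu : R,
      0 < rho < delta -> 0 < mu < delta ->
      (forall t : R, 0 < radius rho mu t) ->
      (forall eps : R, eps1 mu <= eps <= eps2 mu ->
         is_canal (center eps) (radius rho mu)) /\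
      (forall eps : R, eps1 mu < eps < eps2 mu ->
         has_two_hyperbolic_cycles (2 * PI) (canal_family eps rho mu)) /\
      has_one_double_cycle (2 * PI) (canal_family (eps1 mu) rho mu) /\
      has_one_double_cycle (2 * PI) (canal_family (eps2 mu) rho mu).
Proof.
destruct displ_curve as (r & d & K & eps & Hd & Hr & He & Sm).
(* for [mu < / (Rabs K + 1)] the quadratic error cannot make [eps mu] negative *)
set (delta := Rmin d (/ (Rabs K + 1))).
assert (K1 : 0 < Rabs K + 1) by (generalize (Rabs_pos K); lra).
assert (D0 : 0 < delta) by (apply Rmin_glb_lt; [lra|apply Rinv_0_lt_compat, K1]).
assert (Dd : delta <= d) by apply Rmin_l.
exists (fun mu => - eps mu), eps, delta, K, K.
split; [easy|split; [|split]].
- intros n mu Hmu; split; [apply ex_derive_n_opp|]; apply Sm; lra.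
- intros mu Hmu; destruct (He mu ltac:(lra)) as (_ & _ & _ & Q); split; [|easy].
  rewrite <- Rabs_Ropp; replace (- (- eps mu + mu)) with (eps mu - mu) by ring; easy.
- intros rho mu Hrho Hmu Hpos.
  assert (Am : Rabs mu < d) by (rewrite Rabs_pos_eq; lra).
  destruct (He mu Am) as (Er & Z & N & Q).
  assert (Epos : 0 < eps mu).
  { assert (K * mu ^ 2 < mu).
    { assert (L : mu * (Rabs K + 1) < 1).
      { apply Rlt_le_trans with (/ (Rabs K + 1) * (Rabs K + 1)); [|right; field; lra].
        apply Rmult_lt_compat_r; [easy|]; apply Rlt_le_trans with delta; [easy|apply Rmin_r]. }
      generalize (Rle_abs K); nra. }
    apply Rabs_le_between in Q; lra. }
  rewrite Rabs_pos_eq in Er by lra.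
  assert (Bx : forall x, - eps mu <= x <= eps mu -> Rabs x <= r /\ box dbox x mu).
  { intros x Hx; assert (Rabs x <= r) by (apply Rabs_le; lra).
    split; [easy|split; [lra|rewrite Rabs_pos_eq; lra]]. }
  assert (Hrho' : 0 < rho < dbox) by lra.
  assert (Neg : forall x, - eps mu <= x -> x < eps mu -> displ x mu < 0).
  { intros x L U; apply N; [apply Bx; lra|easy]. }
  split; [|split; [|split]].
  + intros x Hx; apply center_canal; try easy; apply Bx, Hx.
  + intros x Hx; apply two_hyperbolic; try easy; [apply Bx; lra|apply Neg; lra|apply Neg; lra].
  + apply (one_double _ _ _ (proj2 (Bx (- eps mu) ltac:(lra))) Hrho' Hpos 1); [auto| |].
    * rewrite <- Z; f_equal; ring.
    * apply Neg; lra.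
  + apply (one_double _ _ _ (proj2 (Bx (eps mu) ltac:(lra))) Hrho' Hpos (-1)); [auto| |].
    * rewrite <- Z; f_equal; ring.
    * apply Neg; lra.
Qed.
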